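(* Let $\alpha\in(0,2]$, $c>0$, $a>0$. Let $Q_t^{\alpha,c,a}$ be the law on $(C[0,1],\mathcal{B}(C[0,1]))$ (uniform topology) of $\{\widehat Z_t^{\alpha,c,a}(s):s\in[0,1]\}$, and let $Q^{\alpha,c,a}$ be the law of the centered continuous Gaussian process $\{G^{\alpha,c,a}(s):s\in[0,1]\}$ with covariance $\mathrm{Cov}(G^{\alpha,c,a}(s),G^{\alpha,c,a}(r))=\frac12\big(f^{\alpha,c,a}(s)+f^{\alpha,c,a}(r)-f^{\alpha,c,a}(|s-r|)\big)$. Then $Q_t^{\alpha,c,a}\Rightarrow Q^{\alpha,c,a}$ weakly as $t\to\infty$.
   Context: A symmetric $\alpha$-stable process with parameters $\alpha\in(0,2]$, $c>0$ is a Lévy process $(X(t))_{t\ge0}$ on $\mathbb{R}$ with $X(0)=0$ and $\mathbb{E}[e^{i\theta X(t)}]=\exp(-tc|\theta|^\alpha)$ (for $\alpha=2$ a Gaussian process). Let $(X_j)_{j\in\mathbb{Z}}$ be independent copies, $\epsilon\sim\mathrm{Uniform}[0,1]$ independent of them, and $u_j=a(j-\epsilon)$. Define $N_t^{\alpha,c,a}[0,L]=\sum_{j\in\mathbb{Z}}\mathbb{I}[X_j(t)+u_j\in[0,L]]$. Let $\widehat N_t^{\alpha,c,a}[0,st^{1/\alpha}]$ be the continuous function of $s$ equal to $s\mapsto N_t^{\alpha,c,a}[0,st^{1/\alpha}]$ except at its points of discontinuity, where one linearly interpolates, and set $\widehat Z_t^{\alpha,c,a}(s)=\big(\widehat N_t^{\alpha,c,a}[0,st^{1/\alpha}]-st^{1/\alpha}/a\big)/t^{1/(2\alpha)}$.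 Define $f^{\alpha,c,a}(0)=0$ and for $s>0$, $f^{\alpha,c,a}(s)=\frac{4s}{a\pi}\int_0^\infty\frac{\sin^2(u/2)}{u^2}(1-e^{-2c(u/s)^\alpha})\,\mathrm{d}u$. *)

(* Defs.v *)
From HB Require Import structures.
From mathcomp Require Import all_boot all_order all_algebra.
From mathcomp Require Import all_classical all_reals all_analysis.
Set Implicit Arguments. Unset Strict Implicit. Unset Printing Implicit Defensive.
Import Order.TTheory GRing.Theory Num.Theory.
Import numFieldNormedType.Exports.
Local Open Scope classical_set_scope.
Local Open Scope ring_scope.

Section ProbDefs.
Context {d : measure_display} {T : measurableType d} {R : realType}
  (P : probability T R).

Definition preimage_events (X : T -> R) : set (set T) :=
  [set A | exists B : set R, measurable B /\ A = X @^-1` B].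

Definition process_events (X : R -> T -> R) : set (set T) :=
  <<s [set A | exists t, 0 <= t /\ preimage_events (X t) A] >>.

Definition mutually_independent (I : eqType) (E : I -> set (set T)) : Prop :=
  forall (J : seq I) (A : I -> set T), uniq J ->
    (forall i, i \in J -> E i (A i)) ->
    fine (P (\bigcap_(i in [set` J]) A i)) = \prod_(i <- J) fine (P (A i)).

Definition cadlag (f : R -> R) : Prop :=
  forall t, 0 <= t ->
    f x @[x --> t^'+] --> f t /\ (0 < t -> cvg (f x @[x --> t^'-])).

Definition indep_increments (X : R -> T -> R) : Prop :=
  forall ts : seq R, sorted <=%R ts -> all (fun t => 0 <= t) ts ->
    mutually_independent (fun k : nat =>
      if (k.+1 < size ts)%N then
        preimage_events (fun w => X (nth 0 ts k.+1) w - X (nth 0 ts k) w)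
      else [set A | A = set0 \/ A = setT]).

Definition stationary_increments (X : R -> T -> R) : Prop :=
  forall s t, 0 <= s -> 0 <= t -> forall B : set R, measurable B ->
    P ((fun w => X (s + t) w - X s w) @^-1` B) = P (X t @^-1` B).

Definition levy_process (X : R -> T -> R) : Prop :=
  [/\ forall t, 0 <= t -> measurable_fun setT (X t),
      forall w, X 0 w = 0,
      indep_increments X,
      stationary_increments X &
      exists N : set T, [/\ measurable N, P N = 0 &
        forall w, ~ N w -> cadlag (fun t => X t w)]].

(* symmetric alpha-stable process: E[exp(i theta X(t))] = exp(-t c |theta|^alpha),
   written as real and imaginary parts *)
Definition sym_stable_process (alpha c : R) (X : R -> T -> R) : Prop :=
  levy_process X /\
  forall t theta, 0 <= t ->
    \int[P]_w cos (theta * X t w) = expR (- (t * c * `|theta| `^ alpha)) /\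
    \int[P]_w sin (theta * X t w) = 0.

Definition uniform01 (eps : T -> R) : Prop :=
  measurable_fun setT eps /\
  forall B : set R, measurable B ->
    P (eps @^-1` B) = (@lebesgue_measure R) (B `&` `[0, 1]%classic).

(* centered Gaussian process on [0,1] with covariance K: every finite linear
   combination has characteristic function exp(-Var/2) *)
Definition centered_gaussian_process (G : R -> T -> R) (K : R -> R -> R) : Prop :=
  (forall s, 0 <= s <= 1 -> measurable_fun setT (G s)) /\
  forall (ss lam : seq R), size lam = size ss -> all (fun s => 0 <= s <= 1) ss ->
    \int[P]_w cos (\sum_(k < size ss) lam`_k * G ss`_k w)
      = expR (- (\sum_(k < size ss) \sum_(l < size ss)
                   lam`_k * lam`_l * K ss`_k ss`_l) / 2) /\
    \int[P]_w sin (\sum_(k < size ss) lam`_k * G ss`_k w) = 0.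

End ProbDefs.

Section ModelDefs.
Context {d : measure_display} {T : measurableType d} {R : realType}.

Definition particle (X : int -> R -> T -> R) (eps : T -> R) (a t : R) (w : T)
  (j : int) : R := X j t w + a * (j%:~R - eps w).

(* N_t[0,L] (fine: the a.s.-null event of an infinite count is sent to 0) *)
Definition countN (X : int -> R -> T -> R) (eps : T -> R) (a t L : R) (w : T) : R :=
  fine (\esum_(j in [set: int])
          (if 0 <= particle X eps a t w j <= L then 1 else 0)%:E).

(* continuous piecewise-linear interpolation of a counting function F whose
   jump points (in [0,oo)) form the set D: F is kept at the jump points and
   interpolated linearly between consecutive jump points (starting from 0). *)
Definition interp (D : set R) (F : R -> R) (L : R) : R :=
  let lo := sup ([set 0] `|` [set x | D x /\ 0 <= x <= L]) in
  let Hi := [set x | D x /\ L < x] in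
  let hi := inf Hi in
  if `[< D L \/ Hi = set0 >] then F L
  else F lo + (L - lo) / (hi - lo) * (F hi - F lo).

Definition hatZ (alpha a : R) (X : int -> R -> T -> R) (eps : T -> R)
  (t s : R) (w : T) : R :=
  let D := [set x | exists j, x = particle X eps a t w j /\ 0 <= x] in
  (interp D (fun L => countN X eps a t L w) (s * t `^ alpha^-1)
     - s * t `^ alpha^-1 / a) / t `^ (2 * alpha)^-1.

End ModelDefs.

Section FDefs.
Context {R : realType}.

Definition f_fun (alpha c a s : R) : R :=
  if s == 0 then 0 else
  4 * s / (a * pi) *
    \int[@lebesgue_measure R]_(u in `]0, +oo[%classic)
       (sin (u / 2) ^+ 2 / u ^+ 2 * (1 - expR (- (2 * c * (u / s) `^ alpha)))).

Definition cov_fun (alpha c a : R) (s r : R) : R :=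
  (f_fun alpha c a s + f_fun alpha c a r - f_fun alpha c a `|s - r|) / 2.

(* bounded continuous functionals on C[0,1] (sup norm), seen as functionals on
   R -> R depending only on the restriction to [0,1] *)
Definition bcont_C01 (phi : (R -> R) -> R) : Prop :=
  [/\ exists M : R, forall g : R -> R, `|phi g| <= M,
      forall g h : R -> R, (forall s, 0 <= s <= 1 -> g s = h s) -> phi g = phi h &
      forall g : R -> R, {within `[0, 1]%classic, continuous g} ->
        forall e, 0 < e -> exists2 del, 0 < del &
          forall h : R -> R, {within `[0, 1]%classic, continuous h} ->
            (forall s, 0 <= s <= 1 -> `|g s - h s| < del) ->
            `|phi g - phi h| < e].

End FDefs.

(* Main.v *)
Require Import Defs.
From HB Require Import structures.
From mathcomp Require Import all_boot all_order all_algebra.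
From mathcomp Require Import all_classical all_reals all_analysis.
From mathcomp Require Import measurable_realfun.
From mathcomp Require Import ring lra zify.
Import Order.TTheory GRing.Theory Num.Theory.
Import numFieldNormedType.Exports.
Set Implicit Arguments. Unset Strict Implicit. Unset Printing Implicit Defensive.
Local Open Scope classical_set_scope.
Local Open Scope ring_scope.

(** Freeze [eps = e]. The particles are then independent, and for intervals [I_i] the sum
    [sum_i l_i N(I_i) / sqrt tau], with [tau = t ^ (1/alpha)], is a sum of independent variables of size
    [O(1 / sqrt tau)]. Counting lattice points shows that, uniformly in [e], the mean number of particles in an
    interval of length [l] is [l / a + O(1)] and its variance is [E min(l, |X_0 - X_1|) / a + O(1)], which after
    scaling is [f^{alpha,c,a}] by the integral representation of [min]. This gives the Gaussian limit of the
    characteristic functions, and Chernoff's bound gives [P(|N(I) - l / a| >= y) = O(l ^ 2 / y ^ 4)], which is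
    enough to chain over dyadic levels. Linear interpolation between jumps commutes with subtracting the linear
    mean, so [hatZ] is uniformly close to the step function through its values on a fine dyadic grid.
    Finally a bounded continuous functional [phi] is the increasing limit of its Lipschitz regularizations for
    the sup distance. These also make sense on step functions, where they are Lipschitz functions of finitely
    many coordinates, so that the multivariate convergence bounds [liminf E phi(hatZ_t)] from below; the upper
    bound is the same statement for [- phi]. *)
(** * Expectations of bounded functions *)

(** Neither [phi] nor the path functional [hatZ] is known to be measurable, so [phi] of [hatZ] can
    only be compared with measurable minorants; this is why a one-sided bound is proved and then
    applied to [- phi]. Independence is exploited on finitely valued variables only. A linear
    combination of counts, restricted to finitely many labels, is a sum of step functions of single
    particles; its law is a list of masses and values, and the product formula for events is all
    that enters. The exponent 4 of the tail bound beats the number of cells: level [m] has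
    [2 * 2 ^ m] cells of length [2 ^ - m], hence total probability of order [2 ^ - m / y ^ 4], which
    remains summable for thresholds [y] that decrease geometrically at a slow rate. The chaining
    must stop where a cell has unscaled length about 1, since the tail bound does not improve for
    shorter intervals; below that scale the monotonicity of the count takes over. The path is
    compared with the grid first for a fixed grid level and [t] to infinity; only afterwards is the
    grid refined. *)

Section Expectation.
Context {d : measure_display} {T : measurableType d} {R : realType} (P : probability T R).
Implicit Types (f g : T -> R) (A B : set T).

(** Integrability under every probability, in a form that is stable under sums, products and
    composition, so that the rules of linearity below have uniform side conditions. *)
Definition bmeas f := measurable_fun setT f /\ exists M : R, forall w, `|f w| <= M.

Lemma probability_measure_setT : (P : {measure set T -> \bar R}) setT = 1%E.
Proof. exact: probability_setT. Qed.

Lemma bmeas_integrable f : bmeas f -> P.-integrable setT (EFin \o f).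
Proof.
move=> [mf [M fM]]; apply: measurable_bounded_integrable => //.
- by rewrite probability_measure_setT ltry.
- by exists M; split => [|x Mx w _]; [exact: num_real | apply: le_trans (fM w) (ltW Mx)].
Qed.

Lemma bmeas_meas f : bmeas f -> measurable_fun setT f.
Proof. by case. Qed.

Lemma bmeas_cst (c : R) : bmeas (fun=> c).
Proof. by split=> //; exists `|c|. Qed.

Lemma bmeasD f g : bmeas f -> bmeas g -> bmeas (fun w => f w + g w).
Proof.
move=> [mf [M fM]] [mg [N gN]]; split; first exact: measurable_funD.
by exists (M + N) => w; rewrite (le_trans (ler_normD _ _))// lerD.
Qed.

Lemma bmeasM f g : bmeas f -> bmeas g -> bmeas (fun w => f w * g w).
Proof.
move=> [mf [M fM]] [mg [N gN]]; split; first exact: measurable_funM.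
by exists (M * N) => w; rewrite normrM ler_pM.
Qed.

Lemma bmeasZ c f : bmeas f -> bmeas (fun w => c * f w).
Proof. by move=> bf; apply: bmeasM bf; apply: bmeas_cst. Qed.

Lemma bmeasN f : bmeas f -> bmeas (fun w => - f w).
Proof.
move=> [mf [M fM]]; split; first exact: measurableT_comp.
by exists M => w; rewrite normrN.
Qed.

Lemma bmeasB f g : bmeas f -> bmeas g -> bmeas (fun w => f w - g w).
Proof. by move=> bf bg; apply: bmeasD => //; apply: bmeasN. Qed.

Lemma bmeas_norm f : bmeas f -> bmeas (fun w => `|f w|).
Proof.
move=> [mf [M fM]]; split; first exact: measurableT_comp.
by exists M => w; rewrite normr_id.
Qed.

Lemma bmeas_comp (Psi : R -> R) f : measurable_fun setT Psi ->
  (exists M : R, forall x, `|Psi x| <= M) -> measurable_fun setT f -> bmeas (fun w => Psi (f w)).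
Proof.
move=> mP [M PM] mf; split; first exact: measurableT_comp mP mf.
by exists M => w; apply: PM.
Qed.

Lemma bmeas_indic A : measurable A -> bmeas (\1_A : T -> R).
Proof.
move=> mA; split; first exact: measurable_indic.
by exists 1 => w; rewrite indicE; case: (_ \in _); rewrite ?normr1 ?normr0 ?ler01.
Qed.

Lemma bmeas_sum (I : Type) (s : seq I) (F : I -> T -> R) :
  (forall i, bmeas (F i)) -> bmeas (fun w => \sum_(i <- s) F i w).
Proof.
move=> bF; elim: s => [|i s IH].
  by under eq_fun do rewrite big_nil; apply: bmeas_cst.
by under eq_fun do rewrite big_cons; apply: bmeasD.
Qed.

Lemma ERD f g : bmeas f -> bmeas g ->
  \int[P]_w (f w + g w) = \int[P]_w f w + \int[P]_w g w.
Proof. by move=> bf bg; apply: RintegralD => //; apply: bmeas_integrable. Qed.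

Lemma ERB f g : bmeas f -> bmeas g ->
  \int[P]_w (f w - g w) = \int[P]_w f w - \int[P]_w g w.
Proof. by move=> bf bg; apply: RintegralB => //; apply: bmeas_integrable. Qed.

Lemma ERZ c f : bmeas f -> \int[P]_w (c * f w) = c * \int[P]_w f w.
Proof. by move=> bf; apply: RintegralZl => //; apply: bmeas_integrable. Qed.

Lemma ER_cst (c : R) : \int[P]_w c = c.
Proof. by rewrite Rintegral_cst// probability_measure_setT /= mulr1. Qed.

Lemma ER_sum (I : Type) (s : seq I) (F : I -> T -> R) : (forall i, bmeas (F i)) ->
  \int[P]_w (\sum_(i <- s) F i w) = \sum_(i <- s) \int[P]_w F i w.
Proof.
move=> bF; elim: s => [|i s IH].
  by under eq_Rintegral do rewrite big_nil; rewrite ER_cst big_nil.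
under eq_Rintegral do rewrite big_cons.
by rewrite ERD// ?IH ?big_cons//; apply: bmeas_sum.
Qed.

Lemma ER_le f g : bmeas f -> bmeas g -> (forall w, f w <= g w) ->
  \int[P]_w f w <= \int[P]_w g w.
Proof. by move=> bf bg fg; apply: le_Rintegral => //; apply: bmeas_integrable. Qed.

Lemma ER_norm f : bmeas f -> `|\int[P]_w f w| <= \int[P]_w `|f w|.
Proof. by move=> bf; apply: le_normr_Rintegral => //; apply: bmeas_integrable. Qed.

Lemma eq_ER f g : (forall w, f w = g w) -> \int[P]_w f w = \int[P]_w g w.
Proof. by move=> fg; apply: eq_Rintegral => w _. Qed.

Definition Pr A : R := fine (P A).

Lemma EPr A : measurable A -> (Pr A)%:E = P A.
Proof. by move=> mA; rewrite /Pr fineK// fin_num_measure. Qed.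

Lemma ER_indic A : measurable A -> \int[P]_w \1_A w = Pr A.
Proof. by move=> mA; rewrite /Rintegral integral_indic// setIT. Qed.

Lemma Pr_ge0 A : 0 <= Pr A.
Proof. by rewrite /Pr fine_ge0. Qed.

Lemma Pr_le A B : measurable A -> measurable B -> A `<=` B -> Pr A <= Pr B.
Proof. by move=> mA mB AB; rewrite /Pr fine_le ?fin_num_measure//; apply: le_measure; rewrite ?inE. Qed.

Lemma PrT : Pr setT = 1.
Proof. by rewrite /Pr (probability_setT P). Qed.

Lemma Pr_le1 A : measurable A -> Pr A <= 1.
Proof. by move=> mA; rewrite -PrT; apply: Pr_le. Qed.

Lemma PrU A B : measurable A -> measurable B -> Pr (A `|` B) <= Pr A + Pr B.
Proof.
move=> mA mB; rewrite -lee_fin EFinD !EPr//; last exact: measurableU.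
exact: measureU2.
Qed.

Lemma Pr_bigU (I : Type) (s : seq I) (F : I -> set T) : (forall i, measurable (F i)) ->
  measurable (\big[setU/set0]_(i <- s) F i) /\
  Pr (\big[setU/set0]_(i <- s) F i) <= \sum_(i <- s) Pr (F i).
Proof.
move=> mF; elim: s => [|i s [m1 IH]]; first by rewrite !big_nil /Pr measure0.
rewrite !big_cons; split; first exact: measurableU.
by apply: (le_trans (PrU _ _)) => //; rewrite lerD2l.
Qed.

Lemma PrC A : measurable A -> Pr (~` A) = 1 - Pr A.
Proof. by move=> mA; rewrite /Pr probability_setC// fineB ?fin_num_measure. Qed.

(* [u], [v] and [f] below need not be measurable: the integral of a nonnegative function is a
   supremum over the simple functions below it. *)
Lemma le_integral_nonneg (u v : T -> \bar R) : (forall w, 0 <= u w)%E -> (forall w, u w <= v w)%E ->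
  (\int[P]_w u w <= \int[P]_w v w)%E.
Proof.
move=> u0 uv; rewrite !ge0_integralTE//; last by move=> w; apply: le_trans (uv w).
by apply: le_ereal_sup => _ [h hu <-]; exists h => // w; apply: le_trans (hu w) (uv w).
Qed.

Lemma bounded_parts_fin f : (exists M : R, forall w, `|f w| <= M) ->
  (\int[P]_w ((EFin \o f)^\+ w))%E \is a fin_num /\ (\int[P]_w ((EFin \o f)^\- w))%E \is a fin_num.
Proof.
move=> [M fM]; have M0 : 0 <= M by apply: le_trans (fM point).
have fin (u : T -> \bar R) : (forall w, 0 <= u w)%E -> (forall w, u w <= M%:E)%E -> (\int[P]_w u w)%E \is a fin_num.
  move=> u0 uM; rewrite ge0_fin_numE; last exact: integral_ge0.
  apply: (@le_lt_trans _ _ (\int[P]_w (cst M%:E w))%E); first exact: le_integral_nonneg.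
  by rewrite integral_cst// probability_measure_setT mule1 ltry.
split; apply: fin => w; rewrite ?funepos_ge0 ?funeneg_ge0//.
  by rewrite funeposE /= -EFin_max lee_fin ge_max M0 andbT; apply: le_trans (fM w); rewrite ler_norm.
by rewrite funenegE /= -EFin_max lee_fin ge_max M0 andbT; apply: le_trans (fM w); rewrite -normrN ler_norm.
Qed.

(** The integral is by definition the difference of the integrals of the two parts; both are finite
    here, and a change of sign swaps them. This is what lets the lower bound for [- phi] serve as an
    upper bound for [phi]. *)
Lemma ERN_nonmeas f : (exists M : R, forall w, `|f w| <= M) -> \int[P]_w (- f w) = - \int[P]_w f w.
Proof.
move=> /bounded_parts_fin[finp finn]; rewrite /Rintegral -fineN; congr fine.
rewrite -integralN; first by apply: eq_integral => w _; rewrite EFinN.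
by rewrite fin_num_adde_defl// fin_numN.
Qed.

Lemma ER_le_nonmeas g f : bmeas g -> (exists M : R, forall w, `|f w| <= M) ->
  (forall w, g w <= f w) -> \int[P]_w g w <= \int[P]_w f w.
Proof.
move=> bg /bounded_parts_fin[finp finn] gf; rewrite /Rintegral.
have le_pos : (\int[P]_w ((EFin \o g)^\+ w) <= \int[P]_w ((EFin \o f)^\+ w))%E.
  apply: le_integral_nonneg => w; first exact: funepos_ge0.
  by rewrite !funeposE /= -!EFin_max lee_fin ge_max !le_max gf lexx !orbT.
have le_neg : (\int[P]_w ((EFin \o f)^\- w) <= \int[P]_w ((EFin \o g)^\- w))%E.
  apply: le_integral_nonneg => w; first exact: funeneg_ge0.
  by rewrite !funenegE /= -!EFin_max lee_fin ge_max !le_max lerN2 gf lexx !orbT.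
have ig := integrable_fin_num measurableT (bmeas_integrable bg).
apply: fine_le.
- exact: ig.
- by rewrite integralE fin_numB finp finn.
rewrite (_ : (\int[P]_w (f w)%:E = \int[P]_w ((EFin \o f)^\+ w) - \int[P]_w ((EFin \o f)^\- w))%E); last by rewrite integralE.
rewrite (_ : (\int[P]_w (g w)%:E = \int[P]_w ((EFin \o g)^\+ w) - \int[P]_w ((EFin \o g)^\- w))%E); last by rewrite integralE.
exact: leeB.
Qed.

(** Dominated convergence with a constant bound. The exceptional set [N] is meant for shifts outside
    the unit interval and for configurations with infinitely many particles in a bounded
    interval. *)
Lemma ER_cvg (f_ : nat -> T -> R) f (M : R) (N : set T) :
  measurable N -> Pr N = 0 ->
  (forall n, measurable_fun setT (f_ n)) -> measurable_fun setT f ->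
  (forall n w, `|f_ n w| <= M) -> (forall w, ~ N w -> f_ ^~ w @ \oo --> f w) ->
  (fun n => \int[P]_w f_ n w) @ \oo --> \int[P]_w f w.
Proof.
move=> mN PN mf_ mf fM cf.
have [|||||intf _ cvg3] := @dominated_convergence _ _ _ P setT measurableT (fun n => EFin \o f_ n) (EFin \o f) (fun=> M%:E).
- by move=> n; apply/measurable_EFinP.
- exact/measurable_EFinP.
- exists N; split => //; first by apply: etrans (esym (EPr mN)) _; rewrite PN.
  move=> w /= nw; apply: contrapT => Nw; apply: nw => _.
  by apply: cvg_EFin; [apply: nearW | apply: cf].
- exact: (bmeas_integrable (bmeas_cst M)).
- by apply: aeW => w n _; rewrite lee_fin.
apply: fine_cvg; rewrite fineK//; exact: (integrable_fin_num measurableT intf).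
Qed.
End Expectation.

(** * Taylor bounds for sine, cosine and the exponential *)

Section Taylor.
Context {R : realType}.
Implicit Types x y : R.

(** The mean value theorem. Iterated, it yields the alternating Taylor bounds below: the derivative
    of each difference is the difference treated just before. *)
Lemma ge0_of_derive_ge0 (F F' : R -> R) : F 0 = 0 ->
  (forall x, is_derive x (1 : R) F (F' x)) -> (forall x, 0 <= x -> 0 <= F' x) ->
  forall x, 0 <= x -> 0 <= F x.
Proof.
move=> F0 dF F'0 x; rewrite le_eqVlt => /predU1P[<-|x0]; first by rewrite F0.
have cF : {within `[0, x], continuous F}.
  apply: derivable_within_continuous => y _.
  by have := dF y => dFy; apply: ex_derive.
have [c c0x] := @MVT R F F' 0 x x0 (fun y _ => dF y) cF.
rewrite F0 !subr0 => ->; rewrite mulr_ge0 ?(ltW x0)// F'0//.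
by move: c0x; rewrite in_itv /= => /andP[/ltW].
Qed.

Lemma sin_le_id x : 0 <= x -> sin x <= x.
Proof.
move=> x0; rewrite -subr_ge0.
apply: (@ge0_of_derive_ge0 (fun x => x - sin x) (fun x => 1 - cos x)) => //.
- by rewrite sin0 subr0.
Qed.

Lemma cos_ge_quad x : 0 <= x -> 1 - x ^+ 2 / 2 <= cos x.
Proof.
move=> x0; rewrite -subr_ge0.
apply: (@ge0_of_derive_ge0 (fun x => cos x - (1 - x ^+ 2 / 2)) (fun x => x - sin x)) => //.
- by rewrite cos0 expr0n /=; lra.
- move=> y; apply: is_derive_eq; rewrite /GRing.scale /=; lra.
- by move=> y y0; rewrite subr_ge0 sin_le_id.
Qed.

Lemma sin_ge_cubic x : 0 <= x -> x - x ^+ 3 / 6 <= sin x.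
Proof.
move=> x0; rewrite -subr_ge0.
apply: (@ge0_of_derive_ge0 (fun x => sin x - (x - x ^+ 3 / 6)) (fun x => cos x - (1 - x ^+ 2 / 2))) => //.
- by rewrite sin0 expr0n /=; lra.
- move=> y; apply: is_derive_eq; rewrite /GRing.scale /=; lra.
- by move=> y y0; rewrite subr_ge0 cos_ge_quad.
Qed.

Lemma cos_le_quartic x : 0 <= x -> cos x <= 1 - x ^+ 2 / 2 + x ^+ 4 / 24.
Proof.
move=> x0; rewrite -subr_ge0.
apply: (@ge0_of_derive_ge0 (fun x => 1 - x ^+ 2 / 2 + x ^+ 4 / 24 - cos x) (fun x => sin x - (x - x ^+ 3 / 6))) => //.
- by rewrite cos0 !expr0n /=; lra.
- move=> y; apply: is_derive_eq; rewrite /GRing.scale /=; lra.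
- by move=> y y0; rewrite subr_ge0 sin_ge_cubic.
Qed.

Lemma sin_approx x : `|sin x - x| <= `|x| ^+ 3.
Proof.
wlog x0 : x / 0 <= x => [H|].
  have [|/ltW x0] := leP 0 x; first exact: H.
  by have := H (- x); rewrite oppr_ge0 sinN normrN => /(_ x0); rewrite -opprD normrN.
rewrite (ger0_norm x0) ler_norml.
have := sin_le_id x0; have := sin_ge_cubic x0.
have : 0 <= x ^+ 3 by exact: exprn_ge0.
lra.
Qed.

Lemma cos_approx x : `|cos x - (1 - x ^+ 2 / 2)| <= x ^+ 4.
Proof.
wlog x0 : x / 0 <= x => [H|].
  have [|/ltW x0] := leP 0 x; first exact: H.
  have := H (- x); rewrite oppr_ge0 cosN sqrrN => /(_ x0).
  by rewrite (_ : (- x) ^+ 4 = x ^+ 4)//; ring.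
rewrite ler_norml.
have := cos_ge_quad x0; have := cos_le_quartic x0.
have : 0 <= x ^+ 4 by exact: exprn_ge0.
lra.
Qed.

(** The upper bound comes from [expR (- y) <= 1 / (1 + y)] and
    [(1 + y) (1 - y + y ^ 2) = 1 + y ^ 3]. *)
Lemma expRN_approx y : 0 <= y -> `|expR (- y) - (1 - y)| <= y ^+ 2.
Proof.
move=> y0; rewrite ler_norml; apply/andP; split.
  by have := expR_ge1Dx (- y); have := sqr_ge0 y; lra.
have e1 : expR (- y) <= (1 + y)^-1.
  by rewrite expRN lef_pV2 ?posrE ?expR_gt0//; [exact: expR_ge1Dx | lra].
rewrite lerBlDr (le_trans e1)//.
have y1 : 0 < 1 + y by lra.
rewrite -(@ler_pM2r _ (1 + y))// mulVf ?gt_eqF//.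
have : 0 <= y ^+ 3 by exact: exprn_ge0.
by nra.
Qed.

(** For negative [y] this is [expRN_approx]. For positive [y] the right side is multiplied by the
    cubic Taylor minorant of [expR (- y)]; the product exceeds 1 by
    [y ^ 2 (1 - y) (3 - y + y ^ 2) / 6], which is where [y <= 1] enters. *)
Lemma expR_le_quad y : `|y| <= 1 -> expR y <= 1 + y + y ^+ 2.
Proof.
move=> y1; have [y0|/ltW y0] := leP 0 y; last first.
  have := @expRN_approx (- y); rewrite oppr_ge0 opprK => /(_ y0).
  by rewrite ler_norml sqrrN => /andP[_]; lra.
rewrite ger0_norm// in y1.
have e2 x : 0 <= x -> expR (- x) <= 1 - x + x ^+ 2 / 2.
  move=> x0; rewrite -subr_ge0.
  apply: (@ge0_of_derive_ge0 (fun x => 1 - x + x ^+ 2 / 2 - expR (- x)) (fun x => expR (- x) - (1 - x))) => //.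
  - by rewrite oppr0 expR0 expr0n /=; lra.
  - move=> z; apply: is_derive_eq; rewrite /GRing.scale /=; lra.
  - by move=> z z0; rewrite subr_ge0 expR_ge1Dx.
have e3 : 1 - y + y ^+ 2 / 2 - y ^+ 3 / 6 <= expR (- y).
  rewrite -subr_ge0.
  apply: (@ge0_of_derive_ge0 (fun x => expR (- x) - (1 - x + x ^+ 2 / 2 - x ^+ 3 / 6)) (fun x => 1 - x + x ^+ 2 / 2 - expR (- x))) => //.
  - by rewrite oppr0 expR0 !expr0n /=; lra.
  - move=> z; apply: is_derive_eq; rewrite /GRing.scale /=; lra.
  - by move=> z z0; rewrite subr_ge0 e2.
rewrite -(@ler_pM2r _ (expR (- y))) ?expR_gt0// -expRD subrr expR0.
have q0 : 0 < 1 + y + y ^+ 2 by nra.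
apply: (@le_trans _ _ ((1 + y + y ^+ 2) * (1 - y + y ^+ 2 / 2 - y ^+ 3 / 6))); last by rewrite ler_pM2l.
rewrite -subr_ge0 (_ : _ - 1 = y ^+ 2 * (1 - y) * (3 - y + y ^+ 2) / 6); last by field.
rewrite divr_ge0// mulr_ge0//; last by nra.
by rewrite mulr_ge0 ?sqr_ge0//; lra.
Qed.

End Taylor.

(** * Sums of independent finitely valued variables *)

Section FiniteLaws.
Context {R : realType}.
Implicit Types (q : seq (R * R)) (qs : seq (seq (R * R))) (Psi : R -> R).

(* A finite law on the line is the list of its (mass, value) pairs. [EE qs Psi x] is the expectation of
   [Psi (x + S)], where [S] is the sum of independent variables with laws [qs]. *)
Fixpoint EE qs Psi (x : R) : R :=
  if qs is q :: qs' then \sum_(pc <- q) pc.1 * EE qs' Psi (x + pc.2) else Psi x.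

Definition is_law q := (forall pc, pc \in q -> 0 <= pc.1) /\ \sum_(pc <- q) pc.1 = 1.
Definition law_mean q := \sum_(pc <- q) pc.1 * pc.2.
Definition law_variance q := \sum_(pc <- q) pc.1 * (pc.2 - law_mean q) ^+ 2.

Lemma law_variance_ge0 q : is_law q -> 0 <= law_variance q.
Proof.
move=> [q0 _]; rewrite /law_variance big_seq; apply: sumr_ge0 => pc /q0 p0.
by rewrite mulr_ge0 ?sqr_ge0.
Qed.

Lemma EE_le qs Psi Psi' x : (forall q, q \in qs -> is_law q) ->
  (forall y, Psi y <= Psi' y) -> EE qs Psi x <= EE qs Psi' x.
Proof.
move=> + PP; elim: qs x => [|q qs IH] x hq /=; first exact: PP.
have [q0 _] := hq q (mem_head _ _).
rewrite big_seq [leRHS]big_seq; apply: ler_sum => pc pcq.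
rewrite ler_wpM2l ?q0//; apply: IH => q' q'q; apply: hq.
by rewrite in_cons q'q orbT.
Qed.

Lemma EEZ qs Psi c x : EE qs (fun y => c * Psi y) x = c * EE qs Psi x.
Proof.
elim: qs x => [|q qs IH] x //=; rewrite mulr_sumr; apply: eq_bigr => pc _.
by rewrite IH mulrCA.
Qed.

Lemma EE_expR qs th x : EE qs (fun y => expR (th * y)) x =
  expR (th * x) * \prod_(q <- qs) \sum_(pc <- q) pc.1 * expR (th * pc.2).
Proof.
elim: qs x => [|q qs IH] x /=; first by rewrite big_nil mulr1.
rewrite big_cons (mulrCA (expR (th * x))) mulr_suml; apply: eq_bigr => pc _.
by rewrite IH mulrDr expRD; ring.
Qed.

Lemma EE_cst qs c x : (forall q, q \in qs -> is_law q) -> EE qs (fun=> c) x = c.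
Proof.
elim: qs x => [|q qs IH] x hq //=.
have [_ q1] := hq q (mem_head _ _).
under eq_bigr => pc _.
  rewrite IH; first over.
  by move=> q' q'q; apply: hq; rewrite in_cons q'q orbT.
by rewrite -mulr_suml q1 mul1r.
Qed.

Lemma law_mean0 q : is_law q -> \sum_(pc <- q) pc.1 * (pc.2 - law_mean q) = 0.
Proof.
move=> [_ q1]; under eq_bigr do rewrite mulrBr.
by rewrite sumrB -mulr_suml q1 mul1r subrr.
Qed.

(** Expansion about the mean: the addition formula leaves the averages of the cosine and the sine of
    the deviation. The linear term has mean zero, the quadratic one gives [1 - v / 2]. Replacing the
    cosine, the sine and then [1 - v / 2] by the exponential costs at most [B * v] each, whence the
    3. *)
Lemma law_cos q (B x : R) : is_law q -> 0 <= B <= 1 -> (forall pc, pc \in q -> `|pc.2 - law_mean q| <= B) ->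
  `|\sum_(pc <- q) pc.1 * cos (x + pc.2) - cos (x + law_mean q) * expR (- (law_variance q / 2))|
    <= 3 * B * law_variance q.
Proof.
move=> lq /andP[B0 B1] qB; have [q0 q1] := lq; set m := law_mean q; set v := law_variance q.
have v0 : 0 <= v by exact: law_variance_ge0.
have vB : v <= B ^+ 2.
  rewrite -[leRHS]mul1r -q1 mulr_suml /v /law_variance big_seq [leRHS]big_seq.
  apply: ler_sum => pc pcq; rewrite ler_wpM2l ?q0//.
  by rewrite -[leLHS]real_normK ?num_real// ler_sqr ?nnegrE// qB.
pose C := \sum_(pc <- q) pc.1 * (cos (pc.2 - m) - (1 - (pc.2 - m) ^+ 2 / 2)).
pose S := \sum_(pc <- q) pc.1 * (sin (pc.2 - m) - (pc.2 - m)).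
have hC : `|C| <= B ^+ 2 * v.
  rewrite /C (le_trans (ler_norm_sum _ _ _))// /v /law_variance mulr_sumr big_seq [leRHS]big_seq.
  apply: ler_sum => pc pcq; rewrite normrM (ger0_norm (q0 _ pcq)) mulrCA ler_wpM2l ?q0//.
  apply: (le_trans (cos_approx _)); rewrite -/m (_ : 4 = 2 + 2)%N// exprD ler_wpM2r ?sqr_ge0//.
  by rewrite -[leLHS]real_normK ?num_real// ler_sqr ?nnegrE// qB.
have hS : `|S| <= B * v.
  rewrite /S (le_trans (ler_norm_sum _ _ _))// /v /law_variance mulr_sumr big_seq [leRHS]big_seq.
  apply: ler_sum => pc pcq; rewrite normrM (ger0_norm (q0 _ pcq)) mulrCA ler_wpM2l ?q0//.
  apply: (le_trans (sin_approx _)); rewrite -/m exprS -[(pc.2 - m) ^+ 2]ger0_norm ?sqr_ge0// normrX.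
  by rewrite ler_wpM2r ?exprn_ge0// qB.
have eS : \sum_(pc <- q) pc.1 * sin (pc.2 - m) = S.
  rewrite /S; under [RHS]eq_bigr do rewrite mulrBr.
  by rewrite sumrB law_mean0// subr0.
have eC : \sum_(pc <- q) pc.1 * cos (pc.2 - m) = C + (1 - v / 2).
  have -> : 1 - v / 2 = \sum_(pc <- q) (pc.1 - pc.1 * (pc.2 - m) ^+ 2 / 2).
    by rewrite sumrB q1 /v /law_variance mulr_suml.
  by rewrite /C -big_split /=; apply: eq_bigr => pc _; ring.
have -> : \sum_(pc <- q) pc.1 * cos (x + pc.2) = cos (x + m) * (C + (1 - v / 2)) - sin (x + m) * S.
  rewrite -eC -eS !mulr_sumr -sumrB; apply: eq_bigr => pc _.
  by rewrite (_ : x + pc.2 = (x + m) + (pc.2 - m)) ?cosD; ring.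
have hE : `|(1 - v / 2) - expR (- (v / 2))| <= B * v.
  rewrite distrC; apply: le_trans (expRN_approx _) _; first by lra.
  have : v <= B by rewrite (le_trans vB)// expr2 ler_piMr.
  nra.
have hC' : `|C| <= B * v.
  by rewrite (le_trans hC)// ler_wpM2r// expr2 ler_piMr.
rewrite (_ : _ - _ = cos (x + m) * C + cos (x + m) * ((1 - v / 2) - expR (- (v / 2))) - sin (x + m) * S); last by ring.
rewrite (le_trans (ler_normB _ _))// (_ : 3 * B * v = B * v + B * v + B * v); last by ring.
apply: lerD; last first.
  by rewrite normrM (le_trans _ hS)// ler_piMl// sin_max.
rewrite (le_trans (ler_normD _ _))// lerD//.
- by rewrite normrM (le_trans _ hC')// ler_piMl// cos_max.
- by rewrite normrM (le_trans _ hE)// ler_piMl// cos_max.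
Qed.

(* Lindeberg's replacement of the summands, one at a time. *)
Lemma EE_cos qs (B x : R) : 0 <= B <= 1 -> (forall q, q \in qs -> is_law q) ->
  (forall q pc, q \in qs -> pc \in q -> `|pc.2 - law_mean q| <= B) ->
  `|EE qs cos x - cos (x + \sum_(q <- qs) law_mean q) * expR (- (\sum_(q <- qs) law_variance q) / 2)|
    <= 3 * B * \sum_(q <- qs) law_variance q.
Proof.
move=> hB; elim: qs x => [|q qs IH] x hq hqB /=.
  by rewrite !big_nil addr0 oppr0 mul0r expR0 mulr1 mulr0 subrr normr0.
have lq := hq q (mem_head _ _); have [q0 q1] := lq.
rewrite !big_cons.
set m := law_mean q; set v := law_variance q; set M := \sum_(q <- qs) law_mean q; set V := \sum_(q <- qs) law_variance q.
have {}IH y : `|EE qs cos y - cos (y + M) * expR (- V / 2)| <= 3 * B * V.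
  apply: IH => q'; first by move=> q'q; apply: hq; rewrite in_cons q'q orbT.
  by move=> pc q'q; apply: hqB; rewrite in_cons q'q orbT.
have V0 : 0 <= V.
  rewrite /V big_seq; apply: sumr_ge0 => q' q'q; apply: law_variance_ge0; apply: hq.
  by rewrite in_cons q'q orbT.
have h1 := @law_cos q B (x + M) lq hB (hqB q ^~ (mem_head _ _)).
rewrite -/m -/v in h1.
(* The first sum replaces the remaining variables by their Gaussian factor for each value of the
   first one; the second term replaces the first variable, the mean [M] of the others being already
   part of the phase. *)
rewrite (_ : _ - _ = \sum_(pc <- q) pc.1 * (EE qs cos (x + pc.2) - cos (x + pc.2 + M) * expR (- V / 2))
   + expR (- V / 2) * (\sum_(pc <- q) pc.1 * cos (x + M + pc.2) - cos (x + M + m) * expR (- (v / 2)))).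
  rewrite (le_trans (ler_normD _ _))// [3 * B * _]mulrDr addrC lerD//.
    rewrite normrM (le_trans _ h1)// ler_piMl// ger0_norm ?expR_ge0// -[leRHS]expR0 ler_expR; lra.
  have -> : 3 * B * V = \sum_(pc <- q) pc.1 * (3 * B * V) by rewrite -mulr_suml q1 mul1r.
  apply: (le_trans (ler_norm_sum _ _ _)); rewrite big_seq [leRHS]big_seq.
  by apply: ler_sum => pc pcq; rewrite normrM (ger0_norm (q0 _ pcq)) ler_wpM2l ?q0.
have -> : x + (m + M) = x + M + m by ring.
have -> : expR (- (v + V) / 2) = expR (- V / 2) * expR (- (v / 2)) by rewrite -expRD; congr expR; lra.
have -> : \sum_(pc <- q) pc.1 * (EE qs cos (x + pc.2) - cos (x + pc.2 + M) * expR (- V / 2)) =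
    \sum_(pc <- q) pc.1 * EE qs cos (x + pc.2) - expR (- V / 2) * \sum_(pc <- q) pc.1 * cos (x + M + pc.2).
  by rewrite mulr_sumr -sumrB; apply: eq_bigr => pc _; rewrite (addrAC x M); ring.
ring.
Qed.

Definition bern (p : R) : seq (R * R) := [:: (p, 1); (1 - p, 0)].

Lemma bern_law p : 0 <= p <= 1 -> is_law (bern p).
Proof.
move=> /andP[p0 p1]; split=> [pc|]; last by rewrite !big_cons big_nil /=; lra.
by rewrite !inE => /orP[]/eqP-> /=; lra.
Qed.

(** Each factor is [1 + p (expR th - 1)], hence at most [expR (p (th + th ^ 2))] by [expR_le_quad].
    Both signs of [th] are covered, one for each tail. *)
Lemma EE_bern_expR (ps : seq R) th : (forall p, p \in ps -> 0 <= p <= 1) -> `|th| <= 1 ->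
  EE (map bern ps) (fun y => expR (th * y)) 0 <= expR ((th + th ^+ 2) * \sum_(p <- ps) p).
Proof.
move=> p01 th1; rewrite EE_expR mulr0 expR0 mul1r big_map.
rewrite mulr_sumr expR_sum big_seq [leRHS]big_seq; apply: ler_prod => p /p01/andP[p0 p1].
rewrite /bern !big_cons big_nil /= mulr1 mulr0 expR0 addr0 mulr1.
have := expR_le_quad th1; have := expR_gt0 th => h1 h2.
apply/andP; split; first by rewrite addr_ge0 ?mulr_ge0 ?(ltW h1)//; lra.
apply: (le_trans _ (expR_ge1Dx _)).
have : p * expR th <= p * (1 + th + th ^+ 2) by rewrite ler_wpM2l.
lra.
Qed.

(** Chernoff's bound with the exponentials of [th * s] and [- th * s]. The mean of the sum is known
    only up to 2; this turns [n0] into [n0 + 2] and adds at most [2 * th], which the constant 4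
    absorbs. *)
Lemma EE_bern_tail (ps : seq R) (n0 y th : R) : (forall p, p \in ps -> 0 <= p <= 1) ->
  0 <= th <= 1 -> 0 <= n0 -> `|\sum_(p <- ps) p - n0| <= 2 ->
  EE (map bern ps) (\1_[set s | n0 + y <= s]) 0 <= expR (4 + th ^+ 2 * (n0 + 2) - th * y) /\
  EE (map bern ps) (\1_[set s | s <= n0 - y]) 0 <= expR (4 + th ^+ 2 * (n0 + 2) - th * y).
Proof.
move=> p01 /andP[th0 th1] n00; rewrite ler_norml => /andP[s1 s2].
have lw q : q \in map bern ps -> is_law q.
  by move=> /mapP[p pp ->]; apply: bern_law; apply: p01.
set S := \sum_(p <- ps) p in s1 s2 *.
split.
  apply: (@le_trans _ _ (EE (map bern ps) (fun s => expR (- th * (n0 + y)) * expR (th * s)) 0)).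
    apply: EE_le => // s; rewrite indicE -expRD; case: (boolP (s \in _)); last by rewrite expR_ge0.
    rewrite inE /= => h; apply: (le_trans _ (expR_ge1Dx _)); rewrite lerDl; nra.
  rewrite EEZ; apply: (@le_trans _ _ (expR (- th * (n0 + y)) * expR ((th + th ^+ 2) * S))).
    by rewrite ler_wpM2l ?expR_ge0// EE_bern_expR// ger0_norm.
  rewrite -expRD ler_expR.
  have h1 : (th + th ^+ 2) * S <= (th + th ^+ 2) * (n0 + 2) by rewrite ler_wpM2l//; nra.
  nra.
apply: (@le_trans _ _ (EE (map bern ps) (fun s => expR (th * (n0 - y)) * expR (- th * s)) 0)).
  apply: EE_le => // s; rewrite indicE -expRD; case: (boolP (s \in _)); last by rewrite expR_ge0.
  rewrite inE /= => h; apply: (le_trans _ (expR_ge1Dx _)); rewrite lerDl; nra.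
rewrite EEZ; apply: (@le_trans _ _ (expR (th * (n0 - y)) * expR ((- th + (- th) ^+ 2) * S))).
  by rewrite ler_wpM2l ?expR_ge0// EE_bern_expR// normrN ger0_norm.
rewrite -expRD ler_expR sqrrN.
have h1 : th ^+ 2 * S <= th ^+ 2 * (n0 + 2) by rewrite ler_wpM2l ?sqr_ge0//; lra.
have h2 : th * (n0 - 2) <= th * S by rewrite ler_wpM2l//; lra.
nra.
Qed.

End FiniteLaws.

Section StepFunctions.
Context {R : realType}.
Implicit Types (h : R -> R) (bs : seq (set R * R)).

(* [bs] lists the level sets of the step function [h] with the values taken there. *)
Definition step_rep (K : R) h bs :=
  [/\ forall bc, bc \in bs -> measurable bc.1,
      forall bc, bc \in bs -> `|bc.2| <= K &
      forall (Psi : R -> R) y, Psi (h y) = \sum_(bc <- bs) \1_(bc.1) y * Psi bc.2].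

Lemma step_rep_meas K h bs : step_rep K h bs -> measurable_fun setT h.
Proof.
move=> [mb _ /(_ id) hh].
rewrite (_ : h = fun y => \sum_(bc <- bs) \1_(bc.1) y * bc.2); last exact/funext.
rewrite (_ : (fun y => _) = fun y => \sum_(i < size bs) \1_((nth (set0, 0) bs i).1) y * (nth (set0, 0) bs i).2); last first.
  by apply/funext => y; rewrite (big_nth (set0, 0)) big_mkord.
apply: measurable_sum => i; apply: measurable_funM => //.
by apply: measurable_indic; apply: mb; rewrite mem_nth.
Qed.

Lemma step_rep0 : step_rep 0 (fun=> 0) [:: (setT, 0)].
Proof.
split => [bc|bc|Psi y]; rewrite ?inE.
- by move=> /eqP->; exact: measurableT.
- by move=> /eqP-> /=; rewrite normr0.
- by rewrite big_cons big_nil indicT /= mul1r addr0.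
Qed.

Lemma step_rep_indic (l : R) (B : set R) : measurable B ->
  step_rep `|l| (fun y => l * \1_B y) [:: (B, l); (~` B, 0)].
Proof.
move=> mB; split => [bc|bc|Psi y]; rewrite ?inE.
- by move=> /orP[]/eqP-> //=; apply: measurableC.
- by move=> /orP[]/eqP-> //=; rewrite normr0.
- rewrite !big_cons big_nil /= !indicE in_setC; case: (y \in B) => /=.
    by rewrite mulr1 mul1r mul0r !addr0.
  by rewrite mulr0 mul0r mul1r add0r addr0.
Qed.

Lemma step_repD K K' h h' bs bs' : step_rep K h bs -> step_rep K' h' bs' ->
  step_rep (K + K') (fun y => h y + h' y) [seq (b.1 `&` b'.1, b.2 + b'.2) | b <- bs, b' <- bs'].
Proof.
move=> [mb kb hb] [mb' kb' hb']; split.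
- by move=> bc /allpairsP[[b b'] /= [bb bb' ->]] /=; apply: measurableI; [apply: mb | apply: mb'].
- move=> bc /allpairsP[[b b'] /= [bb bb' ->]] /=.
  by rewrite (le_trans (ler_normD _ _))// lerD// ?kb ?kb'.
- move=> Psi y; rewrite big_allpairs_dep /= (hb (fun z => Psi (z + h' y))).
  apply: eq_bigr => b _; rewrite (hb' (fun z => Psi (b.2 + z))) mulr_sumr.
  by apply: eq_bigr => b' _; rewrite indicI mulrA.
Qed.

Lemma step_rep_shift K h bs c : step_rep K h bs ->
  step_rep K (fun y => h (y + c)) [seq ((fun y => y + c) @^-1` b.1, b.2) | b <- bs].
Proof.
move=> [mb kb hb]; split.
- move=> bc /mapP[b bb ->] /=.
  rewrite -[X in measurable X]setTI; apply: measurable_funD => //.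
  exact: mb.
- by move=> bc /mapP[b bb ->] /=; apply: kb.
- move=> Psi y; rewrite (hb Psi (y + c)) big_map; apply: eq_bigr => b _.
  by rewrite !indicE.
Qed.

Lemma step_rep_sum (I : Type) (s : seq I) (l : I -> R) (B : I -> set R) : (forall i, measurable (B i)) ->
  exists bs, step_rep (\sum_(i <- s) `|l i|) (fun y => \sum_(i <- s) l i * \1_(B i) y) bs.
Proof.
move=> mB; elim: s => [|i s [bs IH]].
  exists [:: (setT, 0)]; rewrite big_nil.
  rewrite (_ : (fun y => _) = fun=> 0); first exact: step_rep0.
  by apply/funext => y; rewrite big_nil.
eexists; rewrite big_cons.
rewrite (_ : (fun y => _) = fun y => l i * \1_(B i) y + \sum_(i <- s) l i * \1_(B i) y).
  by apply: step_repD IH; apply: step_rep_indic.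
by apply/funext => y; rewrite big_cons.
Qed.

End StepFunctions.

(** * Expectations of sums of independent step functions *)

Section Independence.
Context {d : measure_display} {T : measurableType d} {R : realType} (P : probability T R).
Context {I : eqType} (Y : I -> T -> R) (mY : forall i, measurable_fun setT (Y i)).
Implicit Types (A : set T) (s : seq I) (B : I -> set R).

(** The distinguished event [A] is what makes inductions along [s] work: fixing the value of one
    variable is absorbed into [A]. *)
Definition indep_with A s := forall B, (forall i, measurable (B i)) ->
  Pr P (A `&` [set w | forall i, i \in s -> B i (Y i w)]) =
  Pr P A * \prod_(i <- s) Pr P (Y i @^-1` B i).

Lemma measurable_preimage i (B : set R) : measurable B -> measurable (Y i @^-1` B).
Proof. by move=> mB; rewrite -[X in measurable X]setTI; exact: mY. Qed.

Lemma indep_with_cons A s j (B : set R) : measurable B -> j \notin s -> indep_with A (j :: s) ->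
  indep_with (A `&` Y j @^-1` B) s /\ Pr P (A `&` Y j @^-1` B) = Pr P A * Pr P (Y j @^-1` B).
Proof.
move=> mB js H.
have main C : (forall i, measurable (C i)) ->
    Pr P ((A `&` Y j @^-1` B) `&` [set w | forall i, i \in s -> C i (Y i w)]) =
    Pr P A * Pr P (Y j @^-1` B) * \prod_(i <- s) Pr P (Y i @^-1` C i).
  move=> mC; pose C' i := if i == j then B else C i.
  have := H C'; rewrite big_cons /C' eqxx => H'.
  rewrite -mulrA (_ : \prod_(i <- s) Pr P (Y i @^-1` C i) = \prod_(i <- s) Pr P (Y i @^-1` (if i == j then B else C i))); last first.
    apply: eq_big_seq => i si; case: eqP => // ij; by rewrite -ij si in js.
  rewrite -H'; last by move=> i; case: eqP.
  congr (Pr P _); apply/seteqP; split => w /=.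
    move=> [[Aw Bw] h]; split => // i; rewrite in_cons => /orP[/eqP->|si]; first by rewrite eqxx.
    by case: eqP => [->//|_]; apply: h.
  move=> [Aw h]; split; first by split=> //; have := h j; rewrite eqxx mem_head; apply.
  move=> i si; have := h i; rewrite in_cons si orbT => /(_ isT).
  by case: eqP => // ij; rewrite -ij si in js.
have PrAB : Pr P (A `&` Y j @^-1` B) = Pr P A * Pr P (Y j @^-1` B).
  have := main (fun=> setT) (fun=> measurableT).
  rewrite (_ : [set w | _] = setT) ?setIT; last by apply/seteqP; split.
  by rewrite big1 ?mulr1// => i _; rewrite preimage_setT PrT.
by split=> // C mC; rewrite main// PrAB.
Qed.

Context (K : R) (h : I -> R -> R) (bs : I -> seq (set R * R)).
Hypothesis hrep : forall i, step_rep K (h i) (bs i).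

Definition discrete_law i : seq (R * R) := [seq (Pr P (Y i @^-1` bc.1), bc.2) | bc <- bs i].

Lemma sum_discrete_law i (Psi : R -> R) :
  \sum_(pc <- discrete_law i) pc.1 * Psi pc.2 = \int[P]_w Psi (h i (Y i w)).
Proof.
have [mb kb hb] := hrep i.
under [RHS]eq_ER do rewrite hb big_seq.
rewrite big_map big_seq.
(* Measurability of [bc.1] is known only for members of the list, whereas linearity over sums asks
   for it at every index; hence the value 0 elsewhere. *)
pose F (bc : set R * R) w := if bc \in bs i then \1_(bc.1) (Y i w) * Psi bc.2 else 0.
rewrite (@eq_ER _ _ _ P _ (fun w => \sum_(bc <- bs i) F bc w)); last first.
  by move=> w; rewrite -big_seq big_seq [RHS]big_seq; apply: eq_bigr => bc bb; rewrite /F bb.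
have bF bc : bmeas (F bc).
  rewrite /F; case: (boolP (bc \in bs i)) => bb; last exact: bmeas_cst.
  apply: bmeasM; last exact: bmeas_cst.
  by apply: (bmeas_indic (A := Y i @^-1` bc.1)); apply: measurable_preimage; apply: mb.
rewrite ER_sum// [RHS]big_seq; apply: eq_bigr => bc bb.
rewrite /F bb /= (@eq_ER _ _ _ P _ (fun w => Psi bc.2 * \1_(Y i @^-1` bc.1) w)); last by move=> w; rewrite mulrC.
have mbc : measurable (Y i @^-1` bc.1) by apply: measurable_preimage; apply: mb.
rewrite ERZ; last exact: bmeas_indic.
by rewrite ER_indic// mulrC.
Qed.

Lemma discrete_law_is_law i : is_law (discrete_law i).
Proof.
split; first by move=> pc /mapP[bc _ ->] /=; exact: Pr_ge0.
under eq_bigr do rewrite -[_.1]mulr1.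
by rewrite (sum_discrete_law i (fun=> 1)) ER_cst.
Qed.

Lemma discrete_law_mean i : law_mean (discrete_law i) = \int[P]_w h i (Y i w).
Proof. exact: (sum_discrete_law i id). Qed.

Lemma discrete_law_variance i :
  law_variance (discrete_law i) = \int[P]_w (h i (Y i w) - \int[P]_w h i (Y i w)) ^+ 2.
Proof. by rewrite /law_variance discrete_law_mean (sum_discrete_law i (fun y => (y - _) ^+ 2)). Qed.

(** The representation of the constant 1 shows that the indicators of the level sets sum to 1, so
    [h i y] is a weighted mean of the listed values. *)
Lemma step_bound i y : `|h i y| <= K.
Proof.
have [mb kb hb] := hrep i.
have K0 (bc : set R * R) : bc \in bs i -> 0 <= K by move=> /kb; apply: le_trans.
have e1 := hb (fun=> 1) y.
rewrite (hb id) (le_trans (ler_norm_sum _ _ _))// -[leRHS]mulr1 e1 mulr_sumr big_seq [leRHS]big_seq.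
apply: ler_sum => bc bb; rewrite mulr1 normrM ger0_norm ?indicE// mulrC ler_wpM2r//.
exact: kb.
Qed.

Lemma discrete_law_dev i pc : pc \in discrete_law i -> `|pc.2 - law_mean (discrete_law i)| <= 2 * K.
Proof.
move=> /mapP[bc bb ->] /=; rewrite (le_trans (ler_normB _ _))// mulr2n mulrDl mul1r lerD//.
  by have [_ kb _] := hrep i; exact: kb.
have mh : measurable_fun setT (fun w => h i (Y i w)).
  by apply: measurableT_comp (mY i); exact: step_rep_meas (hrep i).
have bh : bmeas (fun w => h i (Y i w)) by split=> //; exists K => w; exact: step_bound.
rewrite discrete_law_mean (le_trans (ER_norm _ bh))// -[leRHS](ER_cst P).
apply: ER_le; [exact: bmeas_norm|exact: bmeas_cst|by move=> w; exact: step_bound].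
Qed.

Lemma measurable_step_sum s : measurable_fun setT (fun w => \sum_(j <- s) h j (Y j w)).
Proof.
elim: s => [|j s IH].
  by under eq_fun do rewrite big_nil; exact: measurable_cst.
under eq_fun do rewrite big_cons; apply: measurable_funD => //.
by apply: measurableT_comp (mY j); exact: step_rep_meas (hrep j).
Qed.

(** Induction on [s]: the integral is split according to the level set that contains the first
    variable. On each piece [A] shrinks by that preimage, which by [indep_with_cons] is again
    independent of the rest, and [x] moves by the value taken. *)
Lemma indep_EE (Psi : R -> R) A s x : measurable_fun setT Psi -> (exists M : R, forall y, `|Psi y| <= M) ->
  uniq s -> measurable A -> indep_with A s ->
  \int[P]_w (\1_A w * Psi (x + \sum_(j <- s) h j (Y j w))) =
  Pr P A * EE (map discrete_law s) Psi x.
Proof.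
move=> mPsi bPsi; elim: s A x => [|j s IH] A x us mA iA /=.
  under eq_ER do rewrite big_nil addr0 mulrC.
  by rewrite ERZ ?ER_indic 1?mulrC//; exact: bmeas_indic.
move: us => /= /andP[js us].
have [mb kb hb] := hrep j.
have mA' (bc : set R * R) : bc \in bs j -> measurable (A `&` Y j @^-1` bc.1).
  by move=> bb; apply: measurableI => //; apply: measurable_preimage; apply: mb.
pose F (bc : set R * R) w := if bc \in bs j then
  \1_(A `&` Y j @^-1` bc.1) w * Psi (x + bc.2 + \sum_(j <- s) h j (Y j w)) else 0.
rewrite (@eq_ER _ _ _ P _ (fun w => \sum_(bc <- bs j) F bc w)); last first.
  move=> w; rewrite big_cons addrA (hb (fun z => Psi (x + z + _))) mulr_sumr.
  apply: eq_big_seq => bc bb; rewrite /F bb mulrA; congr (_ * _).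
  by rewrite indicI; congr (_ * _); rewrite !indicE.
have bF bc : bmeas (F bc).
  rewrite /F; case: (boolP (bc \in bs j)) => bb; last exact: bmeas_cst.
  apply: bmeasM; first by apply: bmeas_indic; exact: mA'.
  apply: bmeas_comp => //; apply: measurable_funD => //; exact: measurable_step_sum.
rewrite ER_sum// mulr_sumr big_map; apply: eq_big_seq => bc bb.
rewrite /F bb /=.
have [i1 i2] := indep_with_cons (mb _ bb) js iA.
by rewrite IH//; [rewrite i2 mulrA | exact: mA'].
Qed.

End Independence.

(** * Randomly shifted lattices *)

Section IntegerWindow.

(** The integers from [- n] to [n - 1], listed so that passing to [n.+1] adds exactly two labels;
    sums over all particles are limits along these windows. *)
Fixpoint int_window (n : nat) : seq int :=
  if n is m.+1 then Posz m :: Negz m :: int_window m else [::].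

Lemma mem_int_window n j :
  (j \in int_window n) = match j with Posz k => (k < n)%N | Negz k => (k < n)%N end.
Proof.
elim: n => [|n IH]; first by case: j.
rewrite /= !in_cons IH; case: j {IH} => k; lia.
Qed.

Lemma int_window_uniq n : uniq (int_window n).
Proof. by elim: n => [|n IH] //=; rewrite in_cons negb_or !mem_int_window !ltnn. Qed.

End IntegerWindow.

Section MovingLattice.
Context {d : measure_display} {T : measurableType d} {R : realType} (P : probability T R).
Context (Y : int -> T -> R) (mY : forall j, measurable_fun setT (Y j)) (eps : T -> R) (a : R).
Hypothesis a0 : 0 < a.
Hypothesis epsU : uniform01 P eps.
Hypothesis indY : forall (B : set R) (s : seq int), measurable B -> uniq s ->
  indep_with P Y (eps @^-1` B) s.
Context {I : Type} (s : seq I) (l u v : I -> R).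

Definition step_comb (y : R) : R := \sum_(i <- s) l i * \1_(`]u i, v i]%classic) y.

Definition window_sum (m : nat) (e : R) (w : T) : R :=
  \sum_(j <- int_window m) step_comb (Y j w + a * (j%:~R - e)).

Lemma step_comb_left_cst y : exists2 del, 0 < del &
  forall z, y - del < z < y -> step_comb z = step_comb y.
Proof.
have ind i : exists2 del, 0 < del &
    forall z, y - del < z < y -> \1_(`]u i, v i]%classic) z = \1_(`]u i, v i]%classic) y :> R.
  have [yu|uy] := leP y (u i).
    exists 1 => // z /andP[_ zy]; rewrite !indicE !memNset//= in_itv /=.
      by rewrite ltNge yu.
    by rewrite ltNge (le_trans (ltW zy) yu).
  have [yv|vy] := leP y (v i).
    exists (y - u i); first by lra.
    move=> z /andP[z1 z2]; rewrite !indicE !mem_set//= in_itv /=.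
      by rewrite uy yv.
    by apply/andP; split; lra.
  exists (y - v i); first by lra.
  move=> z /andP[z1 z2]; rewrite !indicE !memNset//= in_itv /=; apply/negP; rewrite negb_and -!ltNge.
    by rewrite vy orbT.
  by apply/orP; right; lra.
rewrite /step_comb; elim: s => [|i s' [del d0 IH]].
  by exists 1 => // z _; rewrite !big_nil.
have [del' d0' hi] := ind i; exists (Num.min del del'); first by rewrite lt_min d0.
move=> z /andP[z1 z2]; rewrite !big_cons IH ?hi//.
  by rewrite z2 andbT (le_lt_trans _ z1)// lerB// ge_min lexx orbT.
by rewrite z2 andbT (le_lt_trans _ z1)// lerB// ge_min lexx.
Qed.

(** An increase of [e] moves every particle to the left, and indicators of []u, v]] are constant
    immediately to the left of each point. The window being finite, one [del] works for all its
    particles. *)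
Lemma window_sum_right_cst m e w : exists2 del, 0 < del &
  forall e', e < e' < e + del -> window_sum m e' w = window_sum m e w.
Proof.
rewrite /window_sum; elim: (int_window m) => [|j js [del d0 IH]].
  by exists 1 => // e' _; rewrite !big_nil.
have [del' d0' hj] := step_comb_left_cst (Y j w + a * (j%:~R - e)).
exists (Num.min del (del' / a)); first by rewrite lt_min d0 divr_gt0.
move=> e' /andP[e1]; rewrite -ltrBlDl lt_min => /andP[e2 e3].
rewrite !big_cons IH; last by rewrite e1 -ltrBlDl.
rewrite (hj (Y j w + a * (j%:~R - e')))//.
rewrite ltr_pdivlMr// in e3.
have e4 : e * a < e' * a by rewrite ltr_pM2r.
apply/andP; split; lra.
Qed.

Lemma measurable_step_comb : measurable_fun setT step_comb.
Proof.
have [bs hbs] := @step_rep_sum R I s l (fun i => `]u i, v i]%classic) (fun i => measurable_itv _).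
exact: step_rep_meas hbs.
Qed.

Lemma measurable_window_sum m (e : T -> R) : measurable_fun setT e ->
  measurable_fun setT (fun w => window_sum m (e w) w).
Proof.
move=> me; rewrite /window_sum; elim: (int_window m) => [|j js IH].
  by under eq_fun do rewrite big_nil; exact: measurable_cst.
under eq_fun do rewrite big_cons; apply: measurable_funD => //.
apply: measurableT_comp; first exact: measurable_step_comb.
apply: measurable_funD => //; apply: measurable_funM => //.
exact: measurable_funB.
Qed.

Context (K : R) (bs : seq (set R * R)).
Hypothesis hrep : step_rep K step_comb bs.

Definition frozen_law (e : R) (j : int) : seq (R * R) :=
  discrete_law P Y (fun j => [seq ((fun y => y + a * (j%:~R - e)) @^-1` b.1, b.2) | b <- bs]) j.

Lemma frozen_rep e j : step_rep K (fun y => step_comb (y + a * (j%:~R - e)))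
  [seq ((fun y => y + a * (j%:~R - e)) @^-1` b.1, b.2) | b <- bs].
Proof. exact: step_rep_shift hrep. Qed.

Lemma indic_cell (n k : nat) (x : R) :
  \1_(`[k%:R / n.+1%:R, k.+1%:R / n.+1%:R[%classic) x =
  ((0 <= x) && (k == Num.truncn (n.+1%:R * x)))%:R :> R.
Proof.
have n0 : 0 < n.+1%:R :> R by rewrite ltr0n.
rewrite indicE; congr (_%:R); congr nat_of_bool; apply/idP/idP.
  rewrite inE /= in_itv /= => /andP[h1 h2].
  have x0 : 0 <= x by apply: le_trans h1; rewrite divr_ge0.
  rewrite x0 eq_sym truncn_eq ?mulr_ge0//.
  by move: h1 h2; rewrite ler_pdivrMr// ltr_pdivlMr// => h1 h2; rewrite mulrC h1 h2.
move=> /andP[x0]; rewrite eq_sym truncn_eq ?mulr_ge0// => /andP[h1 h2].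
by rewrite inE /= in_itv /= ler_pdivrMr// ltr_pdivlMr// mulrC h1.
Qed.

(** Only the cell with index [truncn (n.+1 x)] can contain [x]. In this way a function of a rounded
    variable becomes a finite sum over indicators of events. *)
Lemma sum_cells (n N : nat) (x : R) (F : nat -> R) :
  \sum_(k < N) \1_(`[k%:R / n.+1%:R, k.+1%:R / n.+1%:R[%classic) x * F k =
  if (0 <= x) && (Num.truncn (n.+1%:R * x) < N)%N then F (Num.truncn (n.+1%:R * x)) else 0.
Proof.
under eq_bigr do rewrite indic_cell.
case: ifP => [/andP[x0 tN]|h].
  rewrite (bigD1 (Ordinal tN)) //= x0 eqxx mul1r big1 ?addr0// => k kN.
  case: eqP => e; last by rewrite mul0r.
  by move: kN; rewrite -(inj_eq val_inj) /= e eqxx.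
rewrite big1// => k _; case: eqP => e; rewrite ?andbF ?mul0r//.
by case: (leP 0 x) h => //= x0; rewrite ?mul0r// -e ltn_ord.
Qed.

Lemma eps_unit_interval : Pr P (eps @^-1` (~` `[0, 1]%classic)) = 0.
Proof.
have [me h] := epsU.
by rewrite /Pr h ?setICl ?measure0//; apply: measurableC.
Qed.

(* [eps] is rounded up to a multiple of [1/n], which makes it independent of a frozen value and may push it
   beyond [1]; since the counts of half-open intervals [(u, v]] are right-continuous in [eps], they are
   eventually unchanged. *)
Lemma transfer_eps (Psi : R -> R) (lo hi : R) (m : nat) :
  measurable_fun setT Psi -> (exists M : R, forall y, `|Psi y| <= M) ->
  (forall e, 0 <= e <= 2 -> lo <= EE (map (frozen_law e) (int_window m)) Psi 0 <= hi) ->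
  lo <= \int[P]_w Psi (window_sum m (eps w) w) <= hi.
Proof.
move=> mPsi [M PM] H; have [me unif] := epsU.
pose cell n k := `[k%:R / n.+1%:R, k.+1%:R / n.+1%:R[%classic : set R.
(* On each cell the shift is frozen at the right end. The last of the [n.+2] cells is there for
   [eps = 1], and its right end [n.+2 / n.+1] is at most 2, which explains the range of [e] in the
   hypothesis. *)
pose g n w := \sum_(k < n.+2) \1_(cell n k) (eps w) * Psi (window_sum m (k.+1%:R / n.+1%:R) w).
have mcell n k : measurable (eps @^-1` cell n k).
  by rewrite -[X in measurable X]setTI; apply: me => //; exact: measurable_itv.
have bPsiS e : bmeas (fun w => Psi (window_sum m e w)).
  by apply: bmeas_comp => //; [exists M | exact: (@measurable_window_sum m (fun=> e))].
have bcell n k : bmeas (fun w => \1_(cell n k) (eps w) : R) by exact: (bmeas_indic (mcell n k)).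
have Eg n : lo <= \int[P]_w g n w <= hi.
  have -> : \int[P]_w g n w = \sum_(k < n.+2) Pr P (eps @^-1` cell n k) *
      EE (map (frozen_law (k.+1%:R / n.+1%:R)) (int_window m)) Psi 0.
    rewrite /g ER_sum; last by move=> k; exact: bmeasM.
    apply: eq_bigr => k _.
    have := @indep_EE _ _ _ P _ Y mY K (fun j y => step_comb (y + a * (j%:~R - k.+1%:R / n.+1%:R))) _
      (fun j => frozen_rep (k.+1%:R / n.+1%:R) j) Psi (eps @^-1` cell n k) (int_window m) 0 mPsi
      (ex_intro _ M PM) (int_window_uniq m) (mcell n k).
    move=> <-; last by apply: indY; [exact: measurable_itv | exact: int_window_uniq].
    by apply: eq_ER => w; rewrite add0r.
  have sum1 : \sum_(k < n.+2) Pr P (eps @^-1` cell n k) = 1.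
    under eq_bigr do rewrite -ER_indic//.
    rewrite -ER_sum; last by move=> k; exact: bmeas_indic.
    have -> : \int[P]_w (\sum_(k < n.+2) \1_(eps @^-1` cell n k) w) =
        \int[P]_w \1_(eps @^-1` `[0, n.+2%:R / n.+1%:R[%classic) w.
      apply: eq_ER => w; have := @sum_cells n n.+2 (eps w) (fun=> 1).
      under eq_bigr do rewrite mulr1.
      move=> ->; rewrite indicE; case: ifP => h; symmetry.
        case/andP: h => e0; rewrite truncn_lt_nat ?mulr_ge0// => h.
        by rewrite mem_set//= in_itv /= e0 ltr_pdivlMr// mulrC.
      rewrite memNset//= in_itv /= => /andP[e0]; rewrite ltr_pdivlMr// mulrC => h2.
      by move: h; rewrite e0 truncn_lt_nat ?mulr_ge0// h2.
    rewrite ER_indic; last by rewrite -[X in measurable X]setTI; apply: me => //; exact: measurable_itv.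
    rewrite /Pr unif; last exact: measurable_itv.
    rewrite (_ : _ `&` _ = `[0, 1]%classic).
      by rewrite lebesgue_measure_itv /= lte_fin ltr01 oppr0 adde0.
    apply/seteqP; split => x /=; first by case.
    rewrite !in_itv /= => /andP[x0 x1]; rewrite x0 x1; split => //=.
    rewrite (le_lt_trans x1)// ltr_pdivlMr// mul1r ltr_nat//.
  have eb (k : 'I_n.+2) : 0 <= (k.+1%:R / n.+1%:R : R) <= 2.
    rewrite divr_ge0//= ler_pdivrMr ?ltr0n// -natrM ler_nat.
    by have := ltn_ord k; lia.
  have cst_sum (c : R) : c = \sum_(k < n.+2) Pr P (eps @^-1` cell n k) * c by rewrite -mulr_suml sum1 mul1r.
  rewrite [lo]cst_sum [hi]cst_sum; apply/andP; split; apply: ler_sum => k _;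
    by rewrite ler_wpM2l ?Pr_ge0//; case/andP: (H _ (eb k)).
have gcvg : (fun n => \int[P]_w g n w) @ \oo --> \int[P]_w Psi (window_sum m (eps w) w).
  apply: (@ER_cvg _ _ _ P _ _ M (eps @^-1` (~` `[0, 1]%classic))).
  - by rewrite -[X in measurable X]setTI; apply: me => //; apply: measurableC.
  - exact: eps_unit_interval.
  - by move=> n; apply: (@bmeas_meas _ _ R); apply: bmeas_sum => k; exact: bmeasM.
  - by apply: measurableT_comp => //; exact: measurable_window_sum.
  - move=> n w; rewrite /g (@sum_cells n n.+2 (eps w) (fun k => Psi (window_sum m (k.+1%:R / n.+1%:R) w))).
    by case: ifP => _ //; rewrite normr0 (le_trans _ (PM 0)).
  - move=> w /= /contrapT; rewrite in_itv /= => /andP[e0 e1].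
    have [del d0 hS] := window_sum_right_cst m (eps w) w.
    apply: cvg_near_cst.
    have : \forall n \near \oo, n.+1%:R^-1 < del.
      near=> n; rewrite invf_plt ?posrE ?ltr0n//.
      have : del^-1 < n%:R by near: n; exact: nbhs_infty_gtr.
      by move=> /lt_le_trans; apply; rewrite ler_nat.
    apply: filterS => n ndel.
    have n0 : 0 < n.+1%:R :> R by rewrite ltr0n.
    rewrite /g (@sum_cells n n.+2 (eps w) (fun k => Psi (window_sum m (k.+1%:R / n.+1%:R) w))) e0 /=.
    have /andP[t1 t2] := @truncn_itv R (n.+1%:R * eps w) (mulr_ge0 (ltW n0) e0).
    set k := Num.truncn _ in t1 t2 *.
    have kn : (k < n.+2)%N.
      rewrite -(@ltr_nat R) (le_lt_trans t1)// (le_lt_trans (y := n.+1%:R))// ?ltr_nat//.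
      by rewrite ler_piMr// ltW.
    rewrite kn hS//; apply/andP; split.
      by rewrite ltr_pdivlMr// mulrC.
    rewrite ltr_pdivrMr// -natr1.
    have : 1 < del * n.+1%:R by rewrite -ltr_pdivrMr// mul1r.
    nra.
apply/andP; split.
  by apply: (cvgr_to_ge gcvg); apply: nearW => n; case/andP: (Eg n).
by apply: (cvgr_to_le gcvg); apply: nearW => n; case/andP: (Eg n).
Unshelve. all: end_near. Qed.

End MovingLattice.

(** * Convergence of characteristic functions *)

Section TrigPolynomials.
Context {R : realType}.
Implicit Types (f g : seq R -> R) (xs ys : seq R) (qs : seq (seq (R * R))).

(* A term [(c, lam, x0)] stands for [c cos (x0 + lam . xs)]. *)
Definition trig_poly (L : seq (R * (nat -> R) * R)) xs : R :=
  \sum_(t <- L) t.1.1 * cos (t.2 + \sum_(i < size xs) t.1.2 i * xs`_i).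

Definition is_trig (m : nat) f := exists L, forall xs, size xs = m -> f xs = trig_poly L xs.

Lemma is_trig_ext m f g : (forall xs, size xs = m -> f xs = g xs) -> is_trig m g -> is_trig m f.
Proof. by move=> fg [L hL]; exists L => xs sx; rewrite fg// hL. Qed.

Lemma is_trig_cst m (c : R) : is_trig m (fun=> c).
Proof.
exists [:: (c, fun=> 0, 0)] => xs _; rewrite /trig_poly big_cons big_nil /= big1 ?addr0 ?cos0 ?mulr1//.
by move=> i _; rewrite mul0r.
Qed.

Lemma is_trigD m f g : is_trig m f -> is_trig m g -> is_trig m (fun xs => f xs + g xs).
Proof.
by move=> [L hL] [L' hL']; exists (L ++ L') => xs sx; rewrite hL// hL'// /trig_poly big_cat.
Qed.

(** The product of two cosines is half the sum of the cosines of the sum and of the difference of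
    their arguments, so each pair of terms yields two. *)
Lemma is_trigM m f g : is_trig m f -> is_trig m g -> is_trig m (fun xs => f xs * g xs).
Proof.
move=> [L hL] [L' hL'].
exists (flatten [seq flatten [seq [:: (t.1.1 * t'.1.1 / 2, fun i => t.1.2 i + t'.1.2 i, t.2 + t'.2);
    (t.1.1 * t'.1.1 / 2, fun i => t.1.2 i - t'.1.2 i, t.2 - t'.2)] | t' <- L'] | t <- L]).
move=> xs sx; rewrite hL// hL'// /trig_poly big_flatten /= big_map mulr_suml; apply: eq_bigr => t _.
rewrite big_flatten /= big_map mulr_sumr; apply: eq_bigr => t' _.
rewrite !big_cons big_nil /= addr0.
have -> : \sum_(i < size xs) (t.1.2 i + t'.1.2 i) * xs`_i =
    \sum_(i < size xs) t.1.2 i * xs`_i + \sum_(i < size xs) t'.1.2 i * xs`_i.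
  by rewrite -big_split; apply: eq_bigr => i _; rewrite mulrDl.
have -> : \sum_(i < size xs) (t.1.2 i - t'.1.2 i) * xs`_i =
    \sum_(i < size xs) t.1.2 i * xs`_i - \sum_(i < size xs) t'.1.2 i * xs`_i.
  by rewrite -sumrB; apply: eq_bigr => i _; rewrite mulrBl.
set A := \sum_(i < _) t.1.2 i * _; set B := \sum_(i < _) t'.1.2 i * _.
rewrite (_ : t.2 + t'.2 + (A + B) = (t.2 + A) + (t'.2 + B)); last by ring.
rewrite (_ : t.2 - t'.2 + (A - B) = (t.2 + A) - (t'.2 + B)); last by ring.
by rewrite (cosD (t.2 + A)) (cosB (t.2 + A)); field.
Qed.

Lemma is_trig_sin m i (r : R) : (i < m)%N -> is_trig m (fun xs => sin (xs`_i / r)).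
Proof.
move=> im; exists [:: (1, fun k => (k == i)%:R / r, - (pi / 2))] => xs sx.
rewrite /trig_poly big_cons big_nil /= addr0 mul1r sx addrC.
rewrite (bigD1 (Ordinal im)) //= eqxx big1 ?addr0.
  by rewrite cosBpihalf mul1r mulrC.
by move=> k; rewrite -(inj_eq val_inj) /= => /negPf->; rewrite !mul0r.
Qed.

Lemma is_trig_behead m f : is_trig m f -> is_trig m.+1 (fun xs => f (behead xs)).
Proof.
move=> [L hL]; exists [seq (t.1.1, fun i => if i is j.+1 then t.1.2 j else 0, t.2) | t <- L].
move=> [|x xs]//= [sx]; rewrite hL// /trig_poly big_map; apply: eq_bigr => t _ /=.
by rewrite big_ord_recl /= mul0r add0r.
Qed.

(** With [p = rescaled_sin r x] one has [r (2 p - 1) = r sin (x / r)], close to [x] for large [r],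
    while [p] always is a legitimate success probability for Bernstein's operator. *)
Definition rescaled_sin (r x : R) : R := (1 + sin (x / r)) / 2.

Lemma rescaled_sin_itv r x : 0 <= rescaled_sin r x <= 1.
Proof. by rewrite /rescaled_sin; have := sin_geN1 (x / r); have := sin_le1 (x / r); lra. Qed.

(* Bernstein's operator in the variables [rescaled_sin r x], applied coordinate by coordinate. *)
Fixpoint bernstein_sin (n : nat) (r : R) xs g : R :=
  if xs is x :: xs' then
    EE (nseq n (bern (rescaled_sin r x))) (fun s => bernstein_sin n r xs' (fun zs => g (r * (2 * s / n%:R - 1) :: zs))) 0
  else g [::].

Lemma nseq_bern_law n r x q : q \in nseq n (bern (rescaled_sin r x)) -> is_law q.
Proof. by rewrite mem_nseq => /andP[_ /eqP->]; apply: bern_law; exact: rescaled_sin_itv. Qed.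

(** Expanding the Bernoulli expectations produces a polynomial in the variables [rescaled_sin]. The
    outer induction runs over coordinates, the inner one over the [k] remaining trials of the first
    coordinate. *)
Lemma bernstein_sin_trig n r m g : is_trig m (fun xs => bernstein_sin n r xs g).
Proof.
elim: m g => [|m IH] g.
  by apply: is_trig_ext (is_trig_cst _ (g [::])) => -[].
pose Psi s xs := bernstein_sin n r xs (fun zs => g (r * (2 * s / n%:R - 1) :: zs)).
suff H k s : is_trig m.+1 (fun xs => EE (nseq k (bern (rescaled_sin r xs`_0))) (fun s => Psi s (behead xs)) s).
  by apply: is_trig_ext (H n 0) => -[].
elim: k s => [|k IHk] s /=.
  by apply: (@is_trig_behead m (Psi s)); exact: IH.
have tp : is_trig m.+1 (fun xs => rescaled_sin r xs`_0).
  apply: (@is_trig_ext _ _ (fun xs => 1 / 2 * 1 + 1 / 2 * sin (xs`_0 / r))).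
    by move=> xs _; rewrite /rescaled_sin; field.
  apply: is_trigD; first exact: is_trig_cst.
  by apply: is_trigM; [exact: is_trig_cst | exact: is_trig_sin].
apply: (@is_trig_ext _ _ (fun xs => rescaled_sin r xs`_0 * EE (nseq k (bern (rescaled_sin r xs`_0))) (fun s => Psi s (behead xs)) (s + 1)
   + (1 + (-1) * rescaled_sin r xs`_0) * EE (nseq k (bern (rescaled_sin r xs`_0))) (fun s => Psi s (behead xs)) (s + 0))).
  by move=> xs _; rewrite /bern !big_cons big_nil /= addr0 mulN1r.
apply: is_trigD; apply: is_trigM => //.
by apply: is_trigD; [exact: is_trig_cst | apply: is_trigM => //; exact: is_trig_cst].
Qed.

Lemma EE_bound qs (Psi : R -> R) x M : (forall q, q \in qs -> is_law q) ->
  (forall y, `|Psi y| <= M) -> `|EE qs Psi x| <= M.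
Proof.
move=> lq PM; rewrite ler_norml -{1}(EE_cst (- M) x lq) -{2}(EE_cst M x lq).
by apply/andP; split; apply: EE_le => // y; have := PM y; rewrite ler_norml => /andP[].
Qed.

Lemma bernstein_sin_bound n r xs g M : (forall xs, `|g xs| <= M) -> `|bernstein_sin n r xs g| <= M.
Proof.
elim: xs g => [|x xs IH] g gM //=; apply: EE_bound; first exact: nseq_bern_law.
by move=> s; apply: IH.
Qed.

Lemma EE_sqr qs c x : (forall q, q \in qs -> is_law q) ->
  EE qs (fun s => (s - c) ^+ 2) x = (x + \sum_(q <- qs) law_mean q - c) ^+ 2 + \sum_(q <- qs) law_variance q.
Proof.
elim: qs x => [|q qs IH] x lq /=; first by rewrite !big_nil !addr0.
have lqs q' : q' \in qs -> is_law q' by move=> q'q; apply: lq; rewrite in_cons q'q orbT.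
have lq0 := lq q (mem_head _ _); have [q0 q1] := lq0; have := law_mean0 lq0.
rewrite !big_cons; set m := law_mean q; set M := \sum_(q <- qs) law_mean q; set V := \sum_(q <- qs) law_variance q => mean0.
under eq_bigr do rewrite IH// -/M -/V.
have -> : \sum_(pc <- q) pc.1 * ((x + pc.2 + M - c) ^+ 2 + V) =
  \sum_(pc <- q) pc.1 * (pc.2 - m) ^+ 2 + 2 * (x + m + M - c) * (\sum_(pc <- q) pc.1 * (pc.2 - m))
   + ((x + m + M - c) ^+ 2 + V) * \sum_(pc <- q) pc.1.
  by rewrite !mulr_sumr -!big_split /=; apply: eq_bigr => pc _; ring.
by rewrite mean0 q1 /law_variance -/m; ring.
Qed.

Lemma EE_add qs (Psi Psi' : R -> R) x : EE qs (fun s => Psi s + Psi' s) x = EE qs Psi x + EE qs Psi' x.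
Proof.
elim: qs x => [|q qs IH] x //=; rewrite -big_split /=; apply: eq_bigr => pc _.
by rewrite IH mulrDr.
Qed.

(** Chebyshev's inequality in the form [|z| <= del + z ^ 2 / del]; the variance of [s / n] is at
    most [1 / n <= del ^ 2]. *)
Lemma EE_bern_dev n p (del : R) : 0 <= p <= 1 -> 0 < del -> (0 < n)%N -> del^-1 ^+ 2 <= n%:R ->
  EE (nseq n (bern p)) (fun s => `|s / n%:R - p|) 0 <= 2 * del.
Proof.
move=> p01 del0 n0 ndel.
have n0' : 0 < n%:R :> R by rewrite ltr0n.
have lq q : q \in nseq n (bern p) -> is_law q.
  by rewrite mem_nseq => /andP[_ /eqP->]; exact: bern_law.
have md : law_mean (bern p) = p by rewrite /law_mean !big_cons big_nil /=; ring.
have vd : law_variance (bern p) = p * (1 - p) by rewrite /law_variance md !big_cons big_nil /=; ring.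
apply: (@le_trans _ _ (EE (nseq n (bern p)) (fun s => del + (del * n%:R ^+ 2)^-1 * (s - n%:R * p) ^+ 2) 0)).
  apply: EE_le => // s.
  have -> : (del * n%:R ^+ 2)^-1 * (s - n%:R * p) ^+ 2 = `|s / n%:R - p| ^+ 2 / del.
    by rewrite real_normK ?num_real//; field; rewrite !gt_eqF.
  set z := `|_|; have z0 : 0 <= z by exact: normr_ge0.
  rewrite -(ler_pM2r del0) mulrDl divfK ?gt_eqF//; nra.
rewrite EE_add EE_cst// EEZ EE_sqr// !big_nseq !iter_addr !addr0 md vd add0r (mulr_natl p n) subrr expr0n /= add0r.
rewrite -(mulr_natl (p * (1 - p)) n) (_ : 2 * del = del + del); last by ring.
rewrite lerD2l.
have p4 : p * (1 - p) <= 1 by nra.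
rewrite mulrC ler_pdivrMr ?mulr_gt0 ?exprn_gt0//.
apply: (@le_trans _ _ (n%:R * 1)); first by rewrite ler_wpM2l// ltW.
have : 1 <= del ^+ 2 * n%:R.
  by rewrite exprVn -[X in X <= _]mul1r -ler_pdivlMr ?invr_gt0 ?exprn_gt0// invrK mulrC in ndel.
rewrite mulr1 expr2 => h; rewrite (_ : del * (del * n%:R ^+ 2) = (del * del * n%:R) * n%:R); last by ring.
by rewrite ler_peMl// ltW.
Qed.

Definition lipschitz_seq (K : R) g := forall xs ys, size xs = size ys ->
  `|g xs - g ys| <= K * \sum_(i < size xs) `|xs`_i - ys`_i|.

(** One coordinate at a time: replacing the random argument by its mean [r sin (x / r)] costs
    [2 K r] times the mean deviation of [s / n] from [p], that is [4 K r del]. *)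
Lemma bernstein_sin_approx n r xs g K del : 0 <= K -> lipschitz_seq K g -> 0 < r -> 0 < del ->
  (0 < n)%N -> del^-1 ^+ 2 <= n%:R ->
  `|bernstein_sin n r xs g - g [seq r * sin (x / r) | x <- xs]| <= (size xs)%:R * (4 * K * r * del).
Proof.
move=> K0 + r0 del0 n0 nd; elim: xs g => [|x xs IH] g lg /=; first by rewrite subrr normr0 mul0r.
set p := rescaled_sin r x; have p01 := rescaled_sin_itv r x.
set ys := [seq r * sin (x / r) | x <- xs] in IH *.
have lq q : q \in nseq n (bern p) -> is_law q by exact: nseq_bern_law.
set A := EE _ _ _.
have -> : A - g (r * sin (x / r) :: ys) =
   EE (nseq n (bern p)) (fun s => bernstein_sin n r xs (fun zs => g (r * (2 * s / n%:R - 1) :: zs)) + - g (r * sin (x / r) :: ys)) 0.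
  by rewrite EE_add EE_cst.
have bd s : `|bernstein_sin n r xs (fun zs => g (r * (2 * s / n%:R - 1) :: zs)) + - g (r * sin (x / r) :: ys)|
    <= (size xs)%:R * (4 * K * r * del) + (2 * K * r) * `|s / n%:R - p|.
  set c := r * _.
  rewrite (_ : _ + - _ = (bernstein_sin n r xs (fun zs => g (c :: zs)) - g (c :: ys)) + (g (c :: ys) - g (r * sin (x / r) :: ys))); last by ring.
  rewrite (le_trans (ler_normD _ _))// lerD//.
    apply: IH => us vs suv; have := lg (c :: us) (c :: vs); rewrite /= suv => /(_ erefl).
    by rewrite big_ord_recl /= subrr normr0 add0r.
  apply: (le_trans (lg _ _ _)) => //=; rewrite big_ord_recl /= big1 ?addr0; last by move=> i _; rewrite subrr normr0.
  rewrite (_ : c - _ = 2 * r * (s / n%:R - p)); last by rewrite /c /p /rescaled_sin; field; rewrite !gt_eqF// ltr0n.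
  have r2 : 0 <= 2 * r by lra.
  rewrite normrM (ger0_norm r2).
  rewrite (_ : K * (2 * r * _) = 2 * K * r * `|s / n%:R - p|); [exact: lexx | ring].
have H : EE (nseq n (bern p)) (fun s => (size xs)%:R * (4 * K * r * del) + (2 * K * r) * `|s / n%:R - p|) 0 <= (size xs).+1%:R * (4 * K * r * del).
  have sz (c : R) : (size xs).+1%:R * c = (size xs)%:R * c + c by rewrite -(natr1 (size xs)) mulrDl mul1r.
  rewrite EE_add EE_cst// EEZ sz lerD2l.
  have := EE_bern_dev p01 del0 n0 nd.
  have : 0 <= 2 * K * r by rewrite !mulr_ge0// ltW.
  by rewrite -/p => h1 h2; have := ler_wpM2l h1 h2; lra.
rewrite ler_norml; apply/andP; split.
  rewrite lerNl -[leLHS]mulN1r -EEZ; apply: le_trans H; apply: EE_le => // s; rewrite mulN1r.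
  by apply: le_trans (bd s); rewrite -normrN ler_norm.
by apply: le_trans H; apply: EE_le => // s; apply: le_trans (bd s); rewrite ler_norm.
Qed.

(** The approximation is good only on the box of size [B], but since Bernstein's operator averages
    values of [g], the bound [M] is inherited everywhere; outside the box tightness then
    suffices. *)
Lemma trig_approx m g K M B eta : 0 <= K -> lipschitz_seq K g -> (forall xs, `|g xs| <= M) -> 0 < B -> 0 < eta ->
  exists L, forall xs, size xs = m -> `|trig_poly L xs| <= M /\
    ((forall i, (i < m)%N -> `|xs`_i| <= B) -> `|g xs - trig_poly L xs| <= eta).
Proof.
move=> K0 lg gM B0 eta0.
have mr0 : 0 < m%:R + 1 :> R by rewrite ltr_wpDl.
have K1 : 0 < K + 1 by lra.
(* On the box, [r sin (x / r)] differs from [x] by at most [B ^ 3 / r ^ 2 <= B ^ 3 / r]; this [r]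
   makes the resulting error at most [eta / 2]. The choice of [del] below makes the error of
   Bernstein's operator at most [eta / 2]. *)
pose r := 1 + 2 * (K + 1) * (m%:R + 1) * B ^+ 3 / eta.
have r1 : 1 <= r by rewrite /r lerDl divr_ge0 ?ltW// !mulr_gt0 ?exprn_gt0.
have r0 : 0 < r by lra.
pose del := eta / (8 * (K + 1) * (m%:R + 1) * r).
have del0 : 0 < del by rewrite /del divr_gt0// !mulr_gt0.
pose n := (Num.truncn (del^-1 ^+ 2)).+1.
have nd : del^-1 ^+ 2 <= n%:R by apply: ltW; exact: truncnS_gt.
have [L hL] := @bernstein_sin_trig n r m g.
exists L => xs sx; rewrite -hL//; split; first exact: bernstein_sin_bound.
move=> xB; set ys := [seq r * sin (x / r) | x <- xs].
have sy : size ys = m by rewrite size_map.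
rewrite (_ : g xs - _ = (g xs - g ys) - (bernstein_sin n r xs g - g ys)); last by ring.
rewrite (le_trans (ler_normB _ _))// (_ : eta = eta / 2 + eta / 2); last by field.
rewrite lerD//.
  apply: (le_trans (lg _ _ _)); rewrite ?sx ?sy//.
  apply: (@le_trans _ _ (K * (m%:R * (B ^+ 3 / r)))).
    rewrite ler_wpM2l//; apply: (@le_trans _ _ (\sum_(i < m) B ^+ 3 / r)); last by rewrite sumr_const card_ord mulr_natl.
    apply: ler_sum => i _; rewrite (nth_map 0) ?sx//.
    have := sin_approx (xs`_i / r); rewrite distrC.
    rewrite (_ : xs`_i - _ = r * (xs`_i / r - sin (xs`_i / r))); last by field; rewrite gt_eqF.
    move=> h; rewrite normrM (ger0_norm (ltW r0)); apply: (@le_trans _ _ (r * `|xs`_i / r| ^+ 3)); first by rewrite ler_pM2l.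
    rewrite normrM normfV (ger0_norm (ltW r0)) exprMn exprVn.
    have h3 : `|xs`_i| ^+ 3 <= B ^+ 3 by rewrite lerXn2r ?nnegrE ?(ltW B0)// xB.
    have h4 : 0 < r ^- 3 * r by rewrite mulr_gt0// invr_gt0 exprn_gt0.
    rewrite mulrCA (mulrC r).
    apply: ler_pM => //; first exact: ltW.
    rewrite (_ : r ^- 3 * r = r^-1 * r^-1); last by field; rewrite gt_eqF.
    have rV0 : 0 <= r^-1 by rewrite invr_ge0 ltW.
    by rewrite ler_piMr// invf_le1.
  rewrite mulrA mulrA ler_pdivrMr// /r.
  have e1 : (m%:R + 1) * (K + 1) * B ^+ 3 <= eta / 2 * (2 * (K + 1) * (m%:R + 1) * B ^+ 3 / eta).
    by rewrite le_eqVlt; apply/orP; left; apply/eqP; field; rewrite gt_eqF.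
  have B3 : 0 <= B ^+ 3 by rewrite exprn_ge0 ?ltW.
  have m0 : 0 <= m%:R :> R by [].
  have e2 : K * m%:R * B ^+ 3 <= (m%:R + 1) * (K + 1) * B ^+ 3.
    by rewrite ler_wpM2r//; nra.
  lra.
have := bernstein_sin_approx xs K0 lg r0 del0 (ltn0Sn _) nd; rewrite sx => /le_trans; apply.
rewrite /del (_ : m%:R * _ = (eta / 2) * (m%:R / (m%:R + 1) * (K / (K + 1)))); last by field; rewrite !gt_eqF.
have eta2 : 0 <= eta / 2 by lra.
have q1 : 0 <= (m%:R / (m%:R + 1) : R) <= 1 by rewrite divr_ge0 ?(ltW mr0)//= ler_pdivrMr// mul1r lerDl.
have q2 : 0 <= K / (K + 1) <= 1 by rewrite divr_ge0 ?(ltW K1)//= ler_pdivrMr// mul1r lerDl.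
case/andP: q1 => q10 q11; case/andP: q2 => q20 q21.
by rewrite ler_piMr// mulr_ile1.
Qed.

End TrigPolynomials.

(** * From characteristic functions to Lipschitz functionals *)

Section Levy.
Context {R : realType}.

Lemma tight_one {d : measure_display} {T : measurableType d} (P : probability T R) (V : T -> R) (del : R) :
  measurable_fun setT V -> 0 < del ->
  exists K : R, 0 < K /\ Pr P [set w | K < `|V w|] <= del.
Proof.
move=> mV d0.
pose A n := [set w | n%:R < `|V w|].
have mA n : measurable (A n).
  rewrite (_ : A n = setT `&` (fun w => `|V w|) @^-1` `]n%:R, +oo[%classic); last first.
    by apply/seteqP; split => w /=; rewrite in_itv /= andbT // => -[].
  by apply: measurableT_comp.
have cvg0 : (fun n => \int[P]_w \1_(A n) w) @ \oo --> \int[P]_w (0 : R).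
  apply: (@ER_cvg _ _ _ P _ _ 1 set0) => //.
  - by rewrite /Pr measure0.
  - by move=> n; exact: measurable_indic.
  - by move=> n w; rewrite indicE; case: (_ \in _); rewrite ?normr1 ?normr0.
  - move=> w _; apply: cvg_near_cst.
    have : \forall n \near \oo, `|V w| <= n%:R by exact: nbhs_infty_ger.
    by apply: filterS => n h; rewrite indicE memNset//= /A /=; apply/negP; rewrite -leNgt.
rewrite ER_cst in cvg0.
have /= := cvgr_lt _ cvg0 _ d0.
move=> [N _ /(_ N.+1 (leqnSn _))] /=.
rewrite ER_indic// => h; exists N.+1%:R; split => //; exact: ltW.
Qed.

(** A Lipschitz function of a list is a pointwise limit of trigonometric polynomials, namely of
    those that approximate it within [1 / n.+1] on the box of size [n.+1]. *)
Lemma lipschitz_seq_measurable {d : measure_display} {T : measurableType d} (P : probability T R)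
  (m : nat) (V : nat -> T -> R) (g : seq R -> R) (K M : R) :
  (forall i, measurable_fun setT (V i)) -> 0 <= K -> lipschitz_seq K g -> (forall xs, `|g xs| <= M) ->
  bmeas (fun w => g (mkseq (V ^~ w) m)).
Proof.
move=> mV K0 lg gM; split; last by exists M.
have H (n : nat) := @trig_approx R m g K M n.+1%:R n.+1%:R^-1 K0 lg gM.
have H' (n : nat) : {L | forall xs, size xs = m -> `|trig_poly L xs| <= M /\
    ((forall i, (i < m)%N -> `|xs`_i| <= n.+1%:R) -> `|g xs - trig_poly L xs| <= n.+1%:R^-1)}.
  by apply: cid; apply: H; rewrite ?invr_gt0 ltr0n.
pose f n w := trig_poly (sval (H' n)) (mkseq (V ^~ w) m).
apply: (measurable_fun_cvg (h:=f)) => //.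
  move=> n; rewrite /f /trig_poly; elim: (sval _) => [|t L IH].
    by under eq_fun do rewrite big_nil; exact: measurable_cst.
  under eq_fun do rewrite big_cons; apply: measurable_funD => //.
  apply: measurable_funM => //; apply: measurableT_comp; first by apply: continuous_measurable_fun; exact: continuous_cos.
  apply: measurable_funD => //.
  rewrite (_ : (fun w => _) = fun w => \sum_(i < m) t.1.2 i * V i w); last first.
    by apply/funext => w; rewrite size_mkseq; apply: eq_bigr => i _; rewrite nth_mkseq.
  by apply: measurable_sum => i; exact: measurable_funM.
move=> w _; set xs := mkseq (V ^~ w) m; apply/cvgrPdist_le => e e0.
near=> n.
have [_ h] := svalP (H' n) xs (size_mkseq _ _).
apply: (le_trans (h _)).
  move=> i im.
  apply: (@le_trans _ _ (\sum_(i < m) `|xs`_i|)); first by rewrite (bigD1 (Ordinal im)) //= lerDl sumr_ge0.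
  apply: (@le_trans _ _ n%:R); last by rewrite ler_nat.
  by near: n; exact: nbhs_infty_ger.
rewrite invf_ple ?posrE ?ltr0n//.
apply: (@le_trans _ _ n%:R); last by rewrite ler_nat.
by near: n; exact: nbhs_infty_ger.
Unshelve. all: end_near. Qed.

Context {d : measure_display} {T : measurableType d} (P : probability T R).
Context {d' : measure_display} {T' : measurableType d'} (P' : probability T' R).
Context {U : Type} (F : set_system U) {FF : Filter F}.
Context (m : nat) (V : U -> nat -> T -> R) (V' : nat -> T' -> R).
Hypothesis mV : forall u i, measurable_fun setT (V u i).
Hypothesis mV' : forall i, measurable_fun setT (V' i).
(** Cosines with an arbitrary phase [x0] carry the real and the imaginary part of the characteristic
    function at once. *)
Hypothesis cfV : forall (x0 : R) (lam : nat -> R),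
  (fun u => \int[P]_w cos (x0 + \sum_(i < m) lam i * V u i w)) @ F -->
  \int[P']_w cos (x0 + \sum_(i < m) lam i * V' i w).
Hypothesis tightV : forall i (del : R), (i < m)%N -> 0 < del ->
  exists K : R, \forall u \near F, Pr P [set w | K < `|V u i w|] <= del.

Lemma bmeas_trig_term {d0 : measure_display} {T0 : measurableType d0} (W : nat -> T0 -> R) x0 (lam : nat -> R) :
  (forall i, measurable_fun setT (W i)) -> bmeas (fun w => cos (x0 + \sum_(i < m) lam i * W i w)).
Proof.
move=> mW; apply: bmeas_comp.
- by apply: continuous_measurable_fun; exact: continuous_cos.
- by exists 1 => x; exact: cos_max.
- apply: measurable_funD => //; apply: measurable_sum => i; exact: measurable_funM.
Qed.

Lemma ER_trig_poly {d0 : measure_display} {T0 : measurableType d0} (P0 : probability T0 R) (W : nat -> T0 -> R) L :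
  (forall i, measurable_fun setT (W i)) ->
  bmeas (fun w => trig_poly L (mkseq (W ^~ w) m)) /\
  \int[P0]_w trig_poly L (mkseq (W ^~ w) m) =
  \sum_(t <- L) t.1.1 * \int[P0]_w cos (t.2 + \sum_(i < m) t.1.2 i * W i w).
Proof.
move=> mW.
have E : (fun w => trig_poly L (mkseq (W ^~ w) m)) =
    fun w => \sum_(t <- L) t.1.1 * cos (t.2 + \sum_(i < m) t.1.2 i * W i w).
  apply/funext => w; rewrite /trig_poly; apply: eq_bigr => t _; rewrite size_mkseq.
  by congr (_ * cos (_ + _)); apply: eq_bigr => i _; rewrite nth_mkseq.
have bt (t : R * (nat -> R) * R) : bmeas (fun w => t.1.1 * cos (t.2 + \sum_(i < m) t.1.2 i * W i w)).
  by apply: bmeasZ; exact: bmeas_trig_term.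
split; first by rewrite E; exact: bmeas_sum.
under eq_ER do rewrite (congr1 (@^~ _) E).
rewrite ER_sum//; apply: eq_bigr => t _; rewrite ERZ//; exact: bmeas_trig_term.
Qed.

Lemma ER_close {d0 : measure_display} {T0 : measurableType d0} (P0 : probability T0 R) (W : nat -> T0 -> R)
   (f g : T0 -> R) (M K eta del : R) : (forall i, measurable_fun setT (W i)) ->
  bmeas f -> bmeas g -> (forall w, `|f w| <= M) -> (forall w, `|g w| <= M) -> 0 <= eta ->
  (forall w, (forall i, (i < m)%N -> `|W i w| <= K) -> `|f w - g w| <= eta) ->
  (forall i, (i < m)%N -> Pr P0 [set w | K < `|W i w|] <= del) ->
  `|\int[P0]_w f w - \int[P0]_w g w| <= eta + 2 * M * (m%:R * del).
Proof.
move=> mW bf bg fM gM eta0 fg hdel.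
have M0 : 0 <= M by apply: le_trans (fM point).
pose A i := [set w | K < `|W i w|].
have mA i : measurable (A i).
  rewrite (_ : A i = setT `&` (fun w => `|W i w|) @^-1` `]K, +oo[%classic); last first.
    by apply/seteqP; split => w /=; rewrite in_itv /= andbT // => -[].
  by apply: measurableT_comp.
have bA i : bmeas (fun w => \1_(A i) w : R) by exact: bmeas_indic.
rewrite -ERB// (le_trans (ER_norm _ (bmeasB bf bg)))//.
apply: (@le_trans _ _ (\int[P0]_w (eta + 2 * M * \sum_(i < m) \1_(A i) w))).
  apply: ER_le; first exact: bmeas_norm (bmeasB bf bg).
    by apply: bmeasD; [exact: bmeas_cst | apply: bmeasZ; apply: bmeas_sum].
  move=> w; have [h|] := pselect (forall i, (i < m)%N -> `|W i w| <= K).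
    rewrite (le_trans (fg _ h))// lerDl mulr_ge0 ?mulr_ge0// sumr_ge0//.
  move=> /existsNP[i /not_implyP[im /negP]]; rewrite -ltNge => KW.
  apply: (@le_trans _ _ (2 * M)).
    by rewrite (le_trans (ler_normB _ _))// (_ : 2 * M = M + M) ?lerD//; ring.
  rewrite -[leLHS]add0r lerD// ler_peMr ?mulr_ge0// (bigD1 (Ordinal im)) //= indicE mem_set//=.
  by rewrite lerDl sumr_ge0.
rewrite ERD ?ER_cst; last 2 first.
- exact: bmeas_cst.
- by apply: bmeasZ; apply: bmeas_sum.
rewrite lerD2l ERZ; last by apply: bmeas_sum.
rewrite ler_wpM2l ?mulr_ge0// ER_sum//.
apply: (@le_trans _ _ (\sum_(i < m) del)); last by rewrite sumr_const card_ord mulr_natl.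
by apply: ler_sum => i _; rewrite ER_indic// hdel.
Qed.

Lemma uniform_tight (del : R) : 0 < del -> exists K : R, 0 < K /\
  (forall i, (i < m)%N -> Pr P' [set w | K < `|V' i w|] <= del) /\
  (\forall u \near F, forall i, (i < m)%N -> Pr P [set w | K < `|V u i w|] <= del).
Proof.
move=> d0.
have mono (d1 : measure_display) (T1 : measurableType d1) (P1 : probability T1 R) (W : T1 -> R) (K K' : R) :
   measurable_fun setT W -> K <= K' -> Pr P1 [set w | K' < `|W w|] <= Pr P1 [set w | K < `|W w|].
  move=> mW KK'.
  have mA k : measurable [set w | k < `|W w|].
    rewrite (_ : [set w | k < `|W w|] = setT `&` (fun w => `|W w|) @^-1` `]k, +oo[%classic); last first.
      by apply/seteqP; split => w /=; rewrite in_itv /= andbT // => -[].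
    by apply: measurableT_comp.
  by apply: Pr_le => // w /=; exact: le_lt_trans.
suff H n : (n <= m)%N -> exists K : R, 0 < K /\
  (forall i, (i < n)%N -> Pr P' [set w | K < `|V' i w|] <= del) /\
  (\forall u \near F, forall i, (i < n)%N -> Pr P [set w | K < `|V u i w|] <= del) by exact: (H m).
elim: n => [|n IH] nm; first by exists 1; split => //; split => //; apply: nearW.
have [K [K0 [h1 h2]]] := IH (ltnW nm).
have [K1 hK1] := tightV nm d0.
have [K2 [K20 hK2]] := tight_one P' (mV' n) d0.
exists (Num.max K (Num.max K1 K2)); split; first by rewrite lt_max K0.
split.
  move=> i; rewrite ltnS leq_eqVlt => /orP[/eqP->|iltn].
    by apply: le_trans hK2; apply: mono => //; rewrite !le_max lexx !orbT.
  by apply: le_trans (h1 i iltn); apply: mono => //; rewrite !le_max lexx.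
near=> u; move=> i; rewrite ltnS leq_eqVlt => /orP[/eqP->|iltn].
  have : Pr P [set w | K1 < `|V u n w|] <= del by near: u.
  by apply: le_trans; apply: mono => //; rewrite !le_max lexx !orbT.
have h : forall i, (i < n)%N -> Pr P [set w | K < `|V u i w|] <= del by near: u.
by apply: le_trans (h i iltn); apply: mono => //; rewrite !le_max lexx.
Unshelve. all: end_near. Qed.

(** Levy's continuity theorem for Lipschitz test functions. The five parts of [e] are two for
    replacing [g] by a trigonometric polynomial under each of the two laws, on the box and off it,
    and one for the convergence of the expectations of that polynomial. *)
Lemma cf_cvg_lipschitz (g : seq R -> R) (K M : R) : 0 <= K -> lipschitz_seq K g -> (forall xs, `|g xs| <= M) ->
  (fun u => \int[P]_w g (mkseq (V u ^~ w) m)) @ F --> \int[P']_w g (mkseq (V' ^~ w) m).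
Proof.
move=> K0 lg gM; apply/cvgrPdist_le => e e0.
have M0 : 0 <= M by apply: le_trans (gM [::]).
pose eta := e / 5; have eta0 : 0 < eta by rewrite /eta; lra.
pose del := eta / (2 * (M + 1) * (m%:R + 1)).
have m1 : 0 < m%:R + 1 :> R by rewrite ltr_wpDl.
have M1 : 0 < M + 1 by lra.
have del0 : 0 < del by rewrite /del divr_gt0// !mulr_gt0.
have hdel : 2 * M * (m%:R * del) <= eta.
  rewrite /del (_ : 2 * M * _ = eta * (M / (M + 1) * (m%:R / (m%:R + 1)))); last by field; rewrite !gt_eqF.
  have q1 : 0 <= m%:R / (m%:R + 1) :> R by rewrite divr_ge0 ?(ltW m1).
  have q1' : m%:R / (m%:R + 1) <= 1 :> R by rewrite ler_pdivrMr// mul1r lerDl.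
  have q2 : 0 <= M / (M + 1) by rewrite divr_ge0 ?(ltW M1).
  have q2' : M / (M + 1) <= 1 by rewrite ler_pdivrMr// mul1r lerDl.
  by rewrite ler_piMr ?(ltW eta0)// mulr_ile1.
have [B [B0 [tV' tV]]] := uniform_tight del0.
have [L hL] := @trig_approx R m g K M B eta K0 lg gM B0 eta0.
have LM (d0 : measure_display) (T0 : measurableType d0) (P0 : probability T0 R) (W : nat -> T0 -> R) :
    (forall i, measurable_fun setT (W i)) ->
    (forall i, (i < m)%N -> Pr P0 [set w | B < `|W i w|] <= del) ->
    `|\int[P0]_w g (mkseq (W ^~ w) m) - \int[P0]_w trig_poly L (mkseq (W ^~ w) m)| <= eta + eta.
  move=> mW hW; have [bL _] := ER_trig_poly P0 L mW.
  apply: le_trans (_ : eta + 2 * M * (m%:R * del) <= _); last by rewrite lerD2l.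
  apply: (@ER_close _ _ P0 W _ _ M B eta del mW) => //.
  - exact: (lipschitz_seq_measurable P0 m mW K0 lg gM).
  - by move=> w; case: (hL (mkseq (W ^~ w) m) (size_mkseq _ _)).
  - exact: ltW.
  - move=> w hw; case: (hL (mkseq (W ^~ w) m) (size_mkseq _ _)) => _; apply => i im.
    by rewrite nth_mkseq// hw.
have cL : (fun u => \int[P]_w trig_poly L (mkseq (V u ^~ w) m)) @ F --> \int[P']_w trig_poly L (mkseq (V' ^~ w) m).
  rewrite (ER_trig_poly P' L mV').2.
  rewrite (_ : (fun u => _) = fun u => \sum_(t <- L) t.1.1 * \int[P]_w cos (t.2 + \sum_(i < m) t.1.2 i * V u i w)); last first.
    by apply/funext => u; rewrite (ER_trig_poly P L (mV u)).2.
  elim: L {hL LM} => [|t L IH].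
    rewrite big_nil; under eq_fun do rewrite big_nil; exact: cvg_cst.
  rewrite big_cons; under eq_fun do rewrite big_cons.
  apply: cvgD => //; apply: cvgMr; exact: cfV.
move/cvgrPdist_le : cL => /(_ _ eta0) cL'.
near=> u.
have h1 : `|\int[P']_w trig_poly L (mkseq (V' ^~ w) m) - \int[P]_w trig_poly L (mkseq (V u ^~ w) m)| <= eta by near: u.
have h2 : forall i, (i < m)%N -> Pr P [set w | B < `|V u i w|] <= del by near: u.
have h3 := LM _ _ P (V u) (mV u) h2.
have h4 := LM _ _ P' V' mV' tV'.
move: h1 h3 h4; rewrite !ler_norml /eta => /andP[? ?] /andP[? ?] /andP[? ?]; apply/andP; split; lra.
Unshelve. all: end_near. Qed.

End Levy.

(** * Characteristic functions determine the law *)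

Section SameLaw.
Context {R : realType} {d : measure_display} {T : measurableType d} (P : probability T R).
Context (V V' : T -> R) (mV : measurable_fun setT V) (mV' : measurable_fun setT V').
Hypothesis cosV : forall th, \int[P]_w cos (th * V w) = \int[P]_w cos (th * V' w).
Hypothesis sinV : forall th, \int[P]_w sin (th * V w) = \int[P]_w sin (th * V' w).

(** The convergence theorem is applied to the constant sequence [V] with limit [V'], and limits are
    unique. *)
Lemma same_cf_lipschitz (g : seq R -> R) (K M : R) : 0 <= K -> lipschitz_seq K g -> (forall xs, `|g xs| <= M) ->
  \int[P]_w g [:: V w] = \int[P]_w g [:: V' w].
Proof.
move=> K0 lg gM.
have mcos : measurable_fun setT (@cos R) by apply: continuous_measurable_fun; exact: continuous_cos.
have msin : measurable_fun setT (@sin R) by apply: continuous_measurable_fun; exact: continuous_sin.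
have split_cos (W : T -> R) : measurable_fun setT W -> forall x0 (lam : nat -> R),
    \int[P]_w cos (x0 + \sum_(i < 1) lam i * W w) =
    cos x0 * \int[P]_w cos (lam 0%N * W w) - sin x0 * \int[P]_w sin (lam 0%N * W w).
  move=> mW x0 lam; have mlW : measurable_fun setT (fun w => lam 0%N * W w) by exact: measurable_funM.
  have bc : bmeas (fun w => cos (lam 0%N * W w)).
    by apply: (bmeas_comp mcos) => //; exists 1 => x; exact: cos_max.
  have bs : bmeas (fun w => sin (lam 0%N * W w)).
    by apply: (bmeas_comp msin) => //; exists 1 => x; exact: sin_max.
  rewrite -!ERZ// -ERB; [|exact: bmeasZ|exact: bmeasZ].
  by apply: eq_ER => w; rewrite big_ord1 cosD.
have H := @cf_cvg_lipschitz R _ _ P _ _ P nat \oo _ 1 (fun _ _ => V) (fun=> V') (fun _ _ => mV) (fun=> mV') _ _ g K M K0 lg gM.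
have : (fun=> \int[P]_w g (mkseq (fun=> V w) 1)) @ \oo --> \int[P]_w g (mkseq (fun=> V' w) 1).
  apply: H => [x0 lam|i del _ del0].
    rewrite !split_cos// cosV sinV; exact: cvg_cst.
  by have [K' [_ h]] := tight_one P mV del0; exists K'; apply: nearW.
by move=> /cvg_lim <- //; rewrite lim_cst.
Qed.

Lemma Pr_preimage_ray (W : T -> R) (v : R) : measurable_fun setT W ->
  (fun n : nat => \int[P]_w Num.min 1 (Num.max 0 (1 - n%:R * (nth 0 [:: W w] 0 - v)))) @ \oo --> Pr P (W @^-1` `]-oo, v]%classic).
Proof.
move=> mW; rewrite -ER_indic; last by rewrite -[X in measurable X]setTI; apply: mW => //; exact: measurable_itv.
have cl (x : R) : 0 <= Num.min 1 (Num.max 0 x) <= 1.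
  by rewrite le_min ge_min ler01 le_max lexx lexx.
apply: (@ER_cvg _ _ _ P _ _ 1 set0) => //.
- by rewrite /Pr measure0.
- move=> n; apply: measurable_minr => //; apply: measurable_maxr => //.
  apply: measurable_funB => //; apply: measurable_funM => //; exact: measurable_funB.
- apply: measurable_indic; rewrite -[X in measurable X]setTI; apply: mW => //; exact: measurable_itv.
- by move=> n w; rewrite ger0_norm; case/andP: (cl (1 - n%:R * ([:: W w]`_0 - v))).
- move=> w _ /=; apply: cvg_near_cst; have [Wv|vW] := leP (W w) v.
    apply: nearW => n; rewrite indicE mem_set /= ?in_itv//=.
    have nW : n%:R * (W w - v) <= 0 by rewrite mulr_ge0_le0// subr_le0.
    rewrite max_r; last by lra.
    by rewrite min_l//; lra.
  have vW' : 0 < W w - v by rewrite subr_gt0.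
  have : \forall n \near \oo, (W w - v)^-1 <= n%:R by exact: nbhs_infty_ger.
  apply: filterS => n hn; rewrite indicE memNset /= ?in_itv /=; last by rewrite leNgt vW.
  rewrite max_l ?min_r//; rewrite subr_le0.
  by rewrite -ler_pdivrMr// div1r.
Qed.

Lemma clamp_lipschitz (x y : R) : `|Num.min 1 (Num.max 0 x) - Num.min 1 (Num.max 0 y)| <= `|x - y|.
Proof.
have clampE (z : R) : (z <= 0 /\ Num.min 1 (Num.max 0 z) = 0) \/
    (0 <= z <= 1 /\ Num.min 1 (Num.max 0 z) = z) \/ (1 <= z /\ Num.min 1 (Num.max 0 z) = 1).
  have [z0|z0] := leP z 0; first by left; rewrite min_r.
  have [z1|z1] := leP z 1; first by right; left; rewrite ?(ltW z0) ?min_r.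
  by right; right; rewrite ?(ltW z1) ?min_l ?(ltW z1).
have := ler_norm (x - y); have := ler_norm (y - x); rewrite (distrC y x) => h1 h2.
have h0 := normr_ge0 (x - y); rewrite ler_norml.
by case: (clampE x) => [[? ->]|[[? ->]|[? ->]]]; case: (clampE y) => [[? ->]|[[? ->]|[? ->]]]; lra.
Qed.

Lemma same_cf_ray v : Pr P (V @^-1` `]-oo, v]%classic) = Pr P (V' @^-1` `]-oo, v]%classic).
Proof.
have c1 := @Pr_preimage_ray V v mV; have c2 := @Pr_preimage_ray V' v mV'.
suff E : (fun n : nat => \int[P]_w Num.min 1 (Num.max 0 (1 - n%:R * (nth 0 [:: V w] 0 - v)))) =
    (fun n : nat => \int[P]_w Num.min 1 (Num.max 0 (1 - n%:R * (nth 0 [:: V' w] 0 - v)))).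
  by rewrite E in c1; apply: cvg_unique c1 c2.
apply/funext => n.
apply: (@same_cf_lipschitz (fun xs => Num.min 1 (Num.max 0 (1 - n%:R * (xs`_0 - v)))) n%:R 1) => //.
  move=> xs ys sxy; apply: (le_trans (clamp_lipschitz _ _)).
  rewrite (_ : _ - _ = n%:R * (ys`_0 - xs`_0)); last by ring.
  rewrite normrM ger0_norm// ler_wpM2l// distrC.
  case: xs ys sxy => [|x xs] [|y ys] //= _; first by rewrite big_ord0 subrr normr0.
  by rewrite big_ord_recl /= lerDl sumr_ge0.
move=> xs; rewrite ger0_norm; first by rewrite ge_min lexx.
by rewrite le_min ler01 le_max lexx.
Qed.

Lemma same_cf_itv u v : Pr P (V @^-1` `]u, v]%classic) = Pr P (V' @^-1` `]u, v]%classic).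
Proof.
have mray (W : T -> R) x : measurable_fun setT W -> measurable (W @^-1` `]-oo, x]%classic).
  by move=> mW; rewrite -[X in measurable X]setTI; apply: mW => //; exact: measurable_itv.
have mitv (W : T -> R) x y : measurable_fun setT W -> measurable (W @^-1` `]x, y]%classic).
  by move=> mW; rewrite -[X in measurable X]setTI; apply: mW => //; exact: measurable_itv.
have [uv|vu] := leP u v; last first.
  rewrite (_ : `]u, v]%classic = set0) ?preimage_set0//.
  by apply/seteqP; split => x //=; rewrite in_itv /= => /andP[h1 h2]; have := lt_le_trans h1 h2; rewrite ltNge (ltW vu).
have H (W : T -> R) : measurable_fun setT W -> Pr P (W @^-1` `]u, v]%classic) =
    Pr P (W @^-1` `]-oo, v]%classic) - Pr P (W @^-1` `]-oo, u]%classic).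
  move=> mW; rewrite -!ER_indic; [|exact: mray|exact: mray|exact: mitv].
  rewrite -ERB; [|by apply: bmeas_indic; exact: mray|by apply: bmeas_indic; exact: mray].
  apply: eq_ER => w; rewrite !indicE.
  have E (A : set R) : (w \in W @^-1` A) = (W w \in A) by apply/idP/idP => /set_mem h; apply/mem_set.
  have E' (i : interval R) : (W w \in [set` i]) = (W w \in i) by apply/idP/idP => [/set_mem|h] //; apply/mem_set.
  rewrite !E !E' !in_itv /=; have [Wu|uW] := leP (W w) u.
    by rewrite (le_trans Wu uv) /= subrr.
  by rewrite /= subr0.
by rewrite !H// !same_cf_ray.
Qed.

End SameLaw.

(** * Mean and variance of the number of particles in an interval *)

Section LatticeCount.
Context {R : realType}.
Implicit Types (x y : R) (n m : nat).

Lemma sum_window (F : int -> R) m : \sum_(j <- int_window m) F j = \sum_(i < m.*2) F (i%:Z - m%:Z).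
Proof.
elim: m F => [|m IH] F; first by rewrite big_ord0 big_nil.
rewrite /= !big_cons IH doubleS big_ord_recl big_ord_recr /=.
rewrite (_ : 0%:Z - m.+1%:Z = Negz m); last by rewrite NegzE; lia.
rewrite (_ : (bump 0 m.*2)%:Z - m.+1%:Z = Posz m); last by rewrite /bump; lia.
rewrite addrCA; congr (_ + _); rewrite addrC; congr (_ + _).
by apply: eq_bigr => i _; congr F; rewrite /bump /=; lia.
Qed.

Definition count_le n y : R := \sum_(i < n) ((i%:R <= y)%R%:R : R).

Lemma count_le_ub n y : -1 <= y -> count_le n y <= y + 1.
Proof.
elim: n => [|n IH] y1; first by rewrite /count_le big_ord0; lra.
rewrite /count_le big_ord_recr /=; case: (leP n%:R y) => ny; last by rewrite addr0; exact: IH.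
rewrite lerD2r; apply: le_trans ny.
rewrite -[leRHS]mulr1 -[n in leRHS]card_ord mulr_natl -sumr_const; apply: ler_sum => i _.
by rewrite lern1 leq_b1.
Qed.

Lemma count_le_lb n y : y <= n%:R -> y <= count_le n y.
Proof.
elim: n => [|n IH]; first by rewrite /count_le big_ord0.
rewrite /count_le big_ord_recr /= => yn; case: (leP n%:R y) => ny; last by rewrite addr0; apply: IH; exact: ltW.
apply: (le_trans yn); rewrite -natr1 lerD2r.
rewrite -[leLHS]mulr1 -[n in leLHS]card_ord mulr_natl -sumr_const; apply: ler_sum => i _.
by rewrite (le_trans _ ny)// ler_nat ltnW.
Qed.

Definition count_itv n x y : R := \sum_(i < n) (((x < i%:R)%R && (i%:R <= y)%R)%:R : R).

Lemma count_itv_ub n x y : x <= y -> count_itv n x y <= y - x + 1.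
Proof.
elim: n x y => [|n IH] x y xy; first by rewrite /count_itv big_ord0; lra.
rewrite /count_itv big_ord_recl /=.
have E : \sum_(i < n) ((x < (bump 0 i)%:R)%R && ((bump 0 i)%:R <= y)%R)%:R = count_itv n (x - 1) (y - 1).
  by apply: eq_bigr => i _; rewrite /bump /= add1n -natr1 ltrBlDr lerBrDr.
rewrite E; case: (boolP ((x < 0) && (0 <= y))) => [/andP[x0 y0]|_]; last first.
  by rewrite add0r; apply: le_trans (IH _ _ _) _; lra.
rewrite addrC lerD2r; apply: (@le_trans _ _ (count_le n (y - 1))).
  by apply: ler_sum => i _; case: (_ < _) => //=; case: (_ <= _).
by apply: (le_trans (count_le_ub _ _)); lra.
Qed.

Lemma count_itv_lb n x y : -1 <= x -> x <= y -> y <= n%:R -> y - x - 1 <= count_itv n x y.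
Proof.
move=> x1 xy yn.
have -> : count_itv n x y = count_le n y - count_le n x.
  rewrite /count_itv /count_le -sumrB; apply: eq_bigr => i _.
  have [ix|xi] := leP i%:R x; first by rewrite (le_trans ix xy) /= subrr.
  by rewrite /= subr0.
by have := count_le_lb yn; have := @count_le_ub n _ x1; lra.
Qed.

Definition count_window m x y : R := \sum_(j <- int_window m) (((x < j%:~R)%R && (j%:~R <= y)%R)%:R : R).

Lemma count_windowE m x y : count_window m x y = count_itv m.*2 (x + m%:R) (y + m%:R).
Proof.
rewrite /count_window sum_window; apply: eq_bigr => i _.
by rewrite rmorphB /= ltrBrDr lerBlDr.
Qed.

Lemma count_window_ge0 m x y : 0 <= count_window m x y.
Proof. by apply: sumr_ge0 => j _. Qed.

Lemma count_window_ub m x y : count_window m x y <= Num.max 0 (y - x) + 1.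
Proof.
rewrite count_windowE; have [xy|yx] := leP x y.
  apply: (le_trans (count_itv_ub _ _)); first by rewrite lerD2r.
  by rewrite lerD2r le_max; apply/orP; right; lra.
rewrite /count_itv big1; first by rewrite addr_ge0// le_max lexx.
move=> i _; case: (ltP (x + m%:R) i%:R) => //= h1; rewrite leNgt (lt_trans _ h1)//.
by rewrite ltrD2r.
Qed.

(** Unlike the upper bound, this one needs the window to cover the interval. For intervals with
    random ends this can fail, which is the difficulty in [random_count]. *)
Lemma count_window_lb m x y : - m%:R <= x -> y <= m%:R -> Num.max 0 (y - x) - 1 <= count_window m x y.
Proof.
move=> mx ym; rewrite /Num.max; case: ifP => h; last first.
  by apply: le_trans (count_window_ge0 _ _ _); lra.
rewrite count_windowE; apply: le_trans (count_itv_lb _ _ _); try lra.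
by rewrite -addnn natrD; lra.
Qed.

End LatticeCount.

(** * Expected number of lattice points in a random interval *)

Section IntervalSums.
Context {R : realType} {d : measure_display} {T : measurableType d} (P : probability T R).
Context (a : R) (a0 : 0 < a).

(** The count differs from the length by at most 1 as long as the ends lie in the window. When they
    do not, the count may fall short by [l / a], but by the choice of [del] this has probability at
    most [1 / (l / a + 1)], so the mean loses at most 1 more. The threshold [m0] does not depend on
    [e]. *)
Lemma random_count (LO HI : T -> R) (l : R) (C : nat -> R -> T -> R) :
  measurable_fun setT LO -> measurable_fun setT HI -> 0 <= l -> (forall w, HI w - LO w <= l) ->
  (forall m e, bmeas (C m e)) ->
  (forall m e w, C m e w = count_window m (LO w / a + e) (HI w / a + e)) ->
  exists m0, forall m e, (m0 <= m)%N -> 0 <= e <= 2 ->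
    `|\int[P]_w C m e w - (\int[P]_w Num.max 0 (HI w - LO w)) / a| <= 2.
Proof.
move=> mL mH l0 HL bC CE.
have la0 : 0 <= l / a by rewrite divr_ge0// ltW.
pose del := 1 / (2 * (l / a + 1)).
have del0 : 0 < del by rewrite /del divr_gt0// mulr_gt0//; lra.
have [K [K0 hK]] := tight_one P mL del0; have [K' [K'0 hK']] := tight_one P mH del0.
pose A := [set w | K < `|LO w|]; pose B := [set w | K' < `|HI w|].
have mabs (W : T -> R) k : measurable_fun setT W -> measurable [set w | k < `|W w|].
  move=> mW; rewrite (_ : [set w | k < `|W w|] = setT `&` (fun w => `|W w|) @^-1` `]k, +oo[%classic); last first.
    by apply/seteqP; split => w /=; rewrite in_itv /= andbT // => -[].
  by apply: measurableT_comp.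
have mA : measurable A by exact: mabs.
have mB : measurable B by exact: mabs.
pose D w := Num.max 0 (HI w - LO w).
have D0 w : 0 <= D w by rewrite /D le_max lexx.
have Dl w : D w <= l by rewrite /D ge_max l0 HL.
have bD : bmeas D.
  split; first by apply: measurable_maxr => //; exact: measurable_funB.
  by exists l => w; rewrite ger0_norm.
have ED : (\int[P]_w D w) / a = \int[P]_w (a^-1 * D w) by rewrite ERZ// mulrC.
(* The summand 2 leaves room for the shift [e <= 2]. *)
exists (Num.truncn (K / a + K' / a + 2)).+1 => m e m0m /andP[e0 e2].
have mK : K / a + K' / a + 2 <= m%:R.
  by apply: ltW; apply: (lt_le_trans (truncnS_gt _)); rewrite ler_nat.
have maxE w : Num.max 0 (HI w / a + e - (LO w / a + e)) = a^-1 * D w.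
  rewrite /D (_ : HI w / a + e - (LO w / a + e) = a^-1 * (HI w - LO w)); last by ring.
  by rewrite [RHS]maxr_pMr ?mulr0// invr_ge0 ltW.
have Ka : 0 < K / a by rewrite divr_gt0.
have Ka' : 0 < K' / a by rewrite divr_gt0.
rewrite -/D ED -ERB//; last exact: bmeasZ.
rewrite ler_norml; apply/andP; split.
  have bE : bmeas (fun w => -1 + - (l / a + 1) * (\1_A w + \1_B w)).
    apply: bmeasD; first exact: bmeas_cst.
    by apply: bmeasZ; apply: bmeasD; apply: bmeas_indic.
  apply: (@le_trans _ _ (\int[P]_w (-1 + - (l / a + 1) * (\1_A w + \1_B w)))).
    rewrite ERD; [|exact: bmeas_cst|by apply: bmeasZ; apply: bmeasD; apply: bmeas_indic].
    rewrite ER_cst ERZ; last by apply: bmeasD; apply: bmeas_indic.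
    rewrite ERD ?ER_indic//; [|exact: bmeas_indic|exact: bmeas_indic].
    have h : (l / a + 1) * (Pr P A + Pr P B) <= (l / a + 1) * (2 * del).
      by rewrite ler_wpM2l ?addr_ge0//; have := hK; have := hK'; rewrite -/A -/B; lra.
    have lp : l / a + 1 != 0 by rewrite gt_eqF//; lra.
    have h2 : (l / a + 1) * (2 * del) = 1 by rewrite /del; move: (l / a + 1) lp => X X0; field.
    lra.
  apply: ER_le => //; first by apply: bmeasB => //; exact: bmeasZ.
  move=> w; rewrite CE -maxE.
  have [/andP[wA wB]|] := boolP ((w \notin A) && (w \notin B)).
    rewrite !indicE (negPf wA) (negPf wB) /= addr0 mulr0 addr0.
    have hA : `|LO w| <= K by rewrite leNgt; apply/negP => h; move/negP: wA; apply; apply/mem_set.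
    have hB : `|HI w| <= K' by rewrite leNgt; apply/negP => h; move/negP: wB; apply; apply/mem_set.
    move: hA hB; rewrite !ler_norml => /andP[hA1 hA2] /andP[hB1 hB2].
    have i1 : - (K / a) <= LO w / a by rewrite -mulNr ler_pM2r// invr_gt0.
    have i2 : HI w / a <= K' / a by rewrite ler_pM2r// invr_gt0.
    have := @count_window_lb R m (LO w / a + e) (HI w / a + e).
    by move=> h; have := h ltac:(lra) ltac:(lra); lra.
  rewrite negb_and !negbK => AB.
  have s1 : 1 <= \1_A w + \1_B w :> R.
    by rewrite !indicE; case/orP: AB => ->; rewrite ?lerDl ?lerDr.
  have c0 := @count_window_ge0 R m (LO w / a + e) (HI w / a + e).
  rewrite maxE.
  have h1 : a^-1 * D w <= l / a by rewrite mulrC ler_pM2r ?invr_gt0.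
  have h2 : (l / a + 1) * 1 <= (l / a + 1) * (\1_A w + \1_B w) by rewrite ler_wpM2l ?addr_ge0.
  lra.
apply: (@le_trans _ _ (\int[P]_w 1)); last by rewrite ER_cst; lra.
apply: ER_le; [by apply: bmeasB => //; exact: bmeasZ|exact: bmeas_cst|].
move=> w; rewrite CE -maxE.
by have := @count_window_ub R m (LO w / a + e) (HI w / a + e); lra.
Qed.

Context (Y : int -> T -> R) (mY : forall j, measurable_fun setT (Y j)).
Hypothesis lawY : forall j u v, Pr P (Y j @^-1` `]u, v]%classic) = Pr P (Y 0 @^-1` `]u, v]%classic).
Hypothesis indY01 : forall A B : set R, measurable A -> measurable B ->
  Pr P (Y 0 @^-1` A `&` Y 1 @^-1` B) = Pr P (Y 0 @^-1` A) * Pr P (Y 1 @^-1` B).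

Definition site_prob (e u v : R) (j : int) : R :=
  Pr P ((fun w => Y j w + a * (j%:~R - e)) @^-1` `]u, v]%classic).

Lemma site_probE e u v j : site_prob e u v j =
  Pr P (Y 0 @^-1` `]u - a * (j%:~R - e), v - a * (j%:~R - e)]%classic).
Proof.
rewrite -(lawY j) /site_prob; congr (Pr P _); apply/seteqP; split => w /=;
  by rewrite !in_itv /= ltrBlDr lerBrDr.
Qed.

Lemma site_prob_itv e u v j : 0 <= site_prob e u v j <= 1.
Proof.
rewrite /site_prob Pr_ge0 Pr_le1//.
rewrite -[X in measurable X]setTI; apply: (measurable_funD (mY j) (measurable_cst _)) => //.
Qed.

Let mpre j (A : set R) : measurable A -> measurable (Y j @^-1` A).
Proof. by move=> mA; rewrite -[X in measurable X]setTI; exact: mY. Qed.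

Lemma shift_itvE (y u v e : R) (j : int) :
  (y \in `]u - a * (j%:~R - e), v - a * (j%:~R - e)]%classic) =
  (((u - y) / a + e < j%:~R) && (j%:~R <= (v - y) / a + e)).
Proof.
apply/idP/idP.
  rewrite inE /= in_itv /= => /andP[h1 h2].
  rewrite -ltrBrDr ltr_pdivrMr// -lerBlDr ler_pdivlMr// (mulrC (j%:~R - e)).
  by apply/andP; split; lra.
rewrite -ltrBrDr ltr_pdivrMr// -lerBlDr ler_pdivlMr// (mulrC (j%:~R - e)) => /andP[h1 h2].
by rewrite inE /= in_itv /=; apply/andP; split; lra.
Qed.

(** All particles having one law, the sum over labels is the mean number of lattice shifts that
    bring the single point [Y 0] into the interval. *)
Lemma sum_site_prob (u v : R) : u <= v -> exists m0, forall m e, (m0 <= m)%N -> 0 <= e <= 2 ->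
  `|\sum_(j <- int_window m) site_prob e u v j - (v - u) / a| <= 2.
Proof.
move=> uv.
pose C m e w : R := \sum_(j <- int_window m) \1_(Y 0 @^-1` `]u - a * (j%:~R - e), v - a * (j%:~R - e)]%classic) w.
have bI e (j : int) : bmeas (\1_(Y 0 @^-1` `]u - a * (j%:~R - e), v - a * (j%:~R - e)]%classic) : T -> R).
  by apply: bmeas_indic; apply: mpre; exact: measurable_itv.
have [] := @random_count (fun w => u - Y 0 w) (fun w => v - Y 0 w) (v - u) C.
- exact: measurable_funB.
- exact: measurable_funB.
- by rewrite subr_ge0.
- by move=> w; lra.
- by move=> m e; apply: bmeas_sum => j; exact: bI.
- move=> m e w; rewrite /C /count_window; apply: eq_bigr => j _.
  rewrite indicE (_ : (w \in _) = (Y 0 w \in `]u - a * (j%:~R - e), v - a * (j%:~R - e)]%classic)).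
    by rewrite shift_itvE.
  by apply/idP/idP => /set_mem h; apply/mem_set.
move=> m0 H; exists m0 => m e mm0 e02; have := H m e mm0 e02.
rewrite /C ER_sum//.
rewrite (@eq_ER _ _ _ P _ (fun=> v - u)); last by move=> w; rewrite max_r; lra.
rewrite ER_cst; congr (`|_ - _| <= _); apply: eq_bigr => j _.
rewrite ER_indic; last by apply: mpre; exact: measurable_itv.
by rewrite site_probE.
Qed.

(** The square is the probability that two independent copies, [Y 0] and [Y 1], both hit the
    interval under the same lattice shift. Such shifts form the intersection of two random
    intervals, which is shorter than [v - u] by the distance of the copies. *)
Lemma sum_site_prob_sqr (u v : R) : u <= v -> exists m0, forall m e, (m0 <= m)%N -> 0 <= e <= 2 ->
  `|\sum_(j <- int_window m) site_prob e u v j ^+ 2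
     - (\int[P]_w Num.max 0 (v - u - `|Y 0 w - Y 1 w|)) / a| <= 2.
Proof.
move=> uv.
pose I e (j : int) : set R := `]u - a * (j%:~R - e), v - a * (j%:~R - e)]%classic.
pose C m e w : R := \sum_(j <- int_window m) \1_(Y 0 @^-1` I e j `&` Y 1 @^-1` I e j) w.
have mI e j : measurable (Y 0 @^-1` I e j `&` Y 1 @^-1` I e j).
  by apply: measurableI; apply: mpre; exact: measurable_itv.
have [] := @random_count (fun w => Num.max (u - Y 0 w) (u - Y 1 w)) (fun w => Num.min (v - Y 0 w) (v - Y 1 w)) (v - u) C.
- by apply: measurable_maxr; exact: measurable_funB.
- by apply: measurable_minr; exact: measurable_funB.
- by rewrite subr_ge0.
- move=> w; have : Num.min (v - Y 0 w) (v - Y 1 w) <= v - Y 0 w by rewrite ge_min lexx.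
  have : u - Y 0 w <= Num.max (u - Y 0 w) (u - Y 1 w) by rewrite le_max lexx.
  lra.
- by move=> m e; apply: bmeas_sum => j; exact: bmeas_indic.
- move=> m e w; rewrite /C /count_window; apply: eq_bigr => j _.
  rewrite indicI /= !indicE.
  have E k : (w \in Y k @^-1` I e j) = (Y k w \in I e j) by apply/idP/idP => /set_mem h; apply/mem_set.
  rewrite !E /I !shift_itvE -natrM mulnb; congr (nat_of_bool _)%:R.
  rewrite maxr_pMl ?minr_pMl ?invr_ge0 ?(ltW a0)//.
  by rewrite -!ltrBrDr -!lerBlDr gt_max le_min andbACA.
move=> m0 H; exists m0 => m e mm0 e02; have := H m e mm0 e02.
rewrite /C ER_sum//; last by move=> j; exact: bmeas_indic.
rewrite (@eq_ER _ _ _ P (fun w => Num.max 0 (Num.min _ _ - _)) (fun w => Num.max 0 (v - u - `|Y 0 w - Y 1 w|))); last first.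
  move=> w; congr (Num.max 0 _); have [h|h] := leP (Y 0 w) (Y 1 w).
    rewrite min_r ?max_l; try lra.
    by rewrite ler0_norm; lra.
  rewrite min_l ?max_r; try lra.
  by rewrite gtr0_norm; lra.
congr (`|_ - _| <= _); apply: eq_bigr => j _.
rewrite ER_indic// indY01; [|exact: measurable_itv|exact: measurable_itv].
by rewrite site_probE expr2 {2}/I (lawY 1).
Qed.

Lemma sum_site_variance (u v : R) : u <= v -> exists m0, forall m e, (m0 <= m)%N -> 0 <= e <= 2 ->
  `|\sum_(j <- int_window m) (site_prob e u v j - site_prob e u v j ^+ 2)
     - (\int[P]_w Num.min (v - u) `|Y 0 w - Y 1 w|) / a| <= 4.
Proof.
move=> uv; have [m1 H1] := sum_site_prob uv; have [m2 H2] := sum_site_prob_sqr uv.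
exists (maxn m1 m2) => m e; rewrite geq_max => /andP[mm1 mm2] e02.
have := H1 m e mm1 e02; have := H2 m e mm2 e02; rewrite sumrB.
have -> : \int[P]_w Num.max 0 (v - u - `|Y 0 w - Y 1 w|) = (v - u) - \int[P]_w Num.min (v - u) `|Y 0 w - Y 1 w|.
  have bm : bmeas (fun w => Num.min (v - u) `|Y 0 w - Y 1 w|).
    split; first by apply: measurable_minr => //; apply: measurableT_comp => //; exact: measurable_funB.
    exists (v - u) => w; rewrite ger0_norm; first by rewrite ge_min lexx.
    by rewrite le_min subr_ge0 uv normr_ge0.
  rewrite -[X in _ = X - _](ER_cst P) -ERB//; last exact: bmeas_cst.
  apply: eq_ER => w; have [h|h] := leP (v - u) `|Y 0 w - Y 1 w|.
    by rewrite max_l ?subrr// subr_le0.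
  by rewrite max_r// subr_ge0 ltW.
rewrite mulrBl !ler_norml => /andP[? ?] /andP[? ?]; apply/andP; split; lra.
Qed.

End IntervalSums.

(** * The integral formula for the variance *)

Section OneMinusCosIntegral.
Context {R : realType}.
Notation mu := (@lebesgue_measure R).
Local Notation pos := (`]0%R, +oo[%classic : set R).

Lemma integral_indic_mul {d : measure_display} {T : measurableType d} (nu : {measure set T -> \bar R})
   (D : set T) (f : T -> R) :
  (\int[nu]_x (\1_D x * f x)%:E = \int[nu]_(x in D) (f x)%:E)%E.
Proof.
rewrite [RHS]integral_mkcond; apply: eq_integral => x _.
by rewrite patchE indicE; case: ifP => _; rewrite ?mul1r ?mul0r.
Qed.

Lemma cvgy_le_inv (f : R -> R) (C : R) : (forall t, 0 < t -> `|f t| <= C / t) -> f x @[x --> +oo] --> (0 : R).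
Proof.
move=> fC; apply/cvgrPdist_le => e e0; near=> t.
have t0 : 0 < t by near: t; exact: nbhs_pinfty_gt.
have Ct : C / e <= t by near: t; apply: nbhs_pinfty_ge; exact: num_real.
by rewrite sub0r normrN (le_trans (fC _ t0))// ler_pdivrMr// mulrC -ler_pdivrMr.
Unshelve. all: end_near. Qed.

Lemma expRN_le_inv (y : R) : 0 < y -> expR (- y) <= 1 / y.
Proof.
move=> y0; rewrite expRN div1r lef_pV2 ?posrE ?expR_gt0//.
by apply: le_trans (expR_ge1Dx _); lra.
Qed.

Lemma expRN_le_inv2 (y : R) : 0 < y -> expR (- y) <= 2 / y ^+ 2.
Proof.
move=> y0; rewrite expRN -[leRHS]invrK lef_pV2 ?posrE ?expR_gt0 ?invr_gt0 ?divr_gt0 ?exprn_gt0//.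
have := @expR_ge1Dxn R y 1 (ltW y0); rewrite invf_div => h; apply: le_trans h.
by rewrite (_ : 2`!%:R = 2)//; lra.
Qed.

Lemma continuous_within_cy (f : R -> R) (x : R) : continuous f -> {within `[x, +oo[, continuous f}.
Proof. by move=> cf; apply: continuous_subspaceT. Qed.

(** Writes [u ^ - 2] as a Laplace transform, to be inserted in the integral of
    [(1 - cos) / u ^ 2]. *)
Lemma integral_id_expRN (u : R) : 0 < u ->
  (\int[mu]_(t in pos) (t * expR (- (u * t)))%:E = (u `^ (-2))%:E)%E.
Proof.
move=> u0.
pose F (t : R) : R := - (t / u + 1 / u ^+ 2) * expR (- (u * t)).
have dF (t : R) : is_derive t 1 F (t * expR (- (u * t))).
  by apply: is_derive_eq; rewrite /GRing.scale /=; field; rewrite gt_eqF.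
rewrite integral_itv_obnd_cbnd; last first.
  apply/measurable_EFinP/measurable_funM => //; apply: measurableT_comp => //.
  by apply: measurableT_comp => //; exact: measurable_funM.
have cg : continuous (fun t : R => t * expR (- (u * t))).
  move=> t; apply: cvgM; first exact: cvg_id.
  apply: continuous_comp; last exact: continuous_expR.
  by apply: cvgN; apply: cvgM; [exact: cvg_cst | exact: cvg_id].
rewrite (@ge0_continuous_FTC2y _ _ F 0 0).
- rewrite -EFinB /F mulr0 oppr0 expR0 mul0r add0r mulr1 add0r opprK div1r.
  by rewrite powRN (powR_mulrn 2) ?(ltW u0).
- by move=> t t0; rewrite mulr_ge0 ?expR_ge0.
- exact: continuous_within_cy.
- apply: (@cvgy_le_inv _ (3 / u ^+ 3)) => t t0.
  have ut : 0 < u * t by rewrite mulr_gt0.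
  have h1 := expRN_le_inv ut; have h2 := expRN_le_inv2 ut.
  have p1 : 0 < t / u by rewrite divr_gt0.
  have p2 : 0 < 1 / u ^+ 2 by rewrite divr_gt0 ?exprn_gt0.
  have p3 : 0 <= t / u + 1 / u ^+ 2 by lra.
  rewrite /F normrM normrN (ger0_norm p3) ger0_norm ?expR_ge0//.
  rewrite mulrDl; apply: (@le_trans _ _ (t / u * (2 / (u * t) ^+ 2) + 1 / u ^+ 2 * (1 / (u * t)))).
    by rewrite lerD// ler_wpM2l// ltW.
  rewrite le_eqVlt; apply/orP; left; apply/eqP; field.
  by rewrite !gt_eqF.
- by move=> t _; have := dF t => h; apply: ex_derive.
- apply: cvg_at_right_filter; apply: differentiable_continuous; apply/derivable1_diffP.
  by have := dF 0 => h; apply: ex_derive.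
- by move=> t _; rewrite derive1E; have := dF t => h; apply: derive_val.
Qed.

Lemma integral_cos_expRN (th k : R) : 0 < th ->
  (\int[mu]_(u in pos) ((1 - cos (k * u)) * expR (- (u * th)))%:E = (k ^+ 2 / (th * (th ^+ 2 + k ^+ 2)))%:E)%E.
Proof.
move=> th0; have tk0 : 0 < th ^+ 2 + k ^+ 2 by rewrite ltr_wpDr ?sqr_ge0 ?exprn_gt0.
pose F (u : R) : R := expR (- (u * th)) * (- (1 / th) + (th * cos (k * u) - k * sin (k * u)) / (th ^+ 2 + k ^+ 2)).
have dF (u : R) : is_derive u 1 F ((1 - cos (k * u)) * expR (- (u * th))).
  by apply: is_derive_eq; rewrite /GRing.scale /=; field; rewrite !gt_eqF.
have cg : continuous (fun u : R => (1 - cos (k * u)) * expR (- (u * th))).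
  move=> u; apply: cvgM.
    apply: cvgB; first exact: cvg_cst.
    apply: continuous_comp; last exact: continuous_cos.
    by apply: cvgM; [exact: cvg_cst | exact: cvg_id].
  apply: continuous_comp; last exact: continuous_expR.
  by apply: cvgN; apply: cvgM; [exact: cvg_id | exact: cvg_cst].
rewrite integral_itv_obnd_cbnd; last first.
  by apply/measurable_EFinP; apply: measurable_funTS; exact: continuous_measurable_fun.
rewrite (@ge0_continuous_FTC2y _ _ F 0 0).
- rewrite -EFinB /F mul0r oppr0 expR0 !mulr0 cos0 sin0 mulr0 subr0 mulr1 mul1r sub0r.
  by congr (_%:E); field; rewrite !gt_eqF.
- by move=> u u0; rewrite mulr_ge0 ?expR_ge0// subr_ge0 cos_le1.
- exact: continuous_within_cy.
- apply: (@cvgy_le_inv _ ((1 / th + (th + `|k|) / (th ^+ 2 + k ^+ 2)) / th)) => u u0.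
  have ut : 0 < u * th by rewrite mulr_gt0.
  rewrite normrM ger0_norm ?expR_ge0//.
  rewrite (_ : _ / th / u = 1 / (u * th) * (1 / th + (th + `|k|) / (th ^+ 2 + k ^+ 2))); last by field; rewrite !gt_eqF.
  apply: ler_pM; rewrite ?expR_ge0//; first exact: expRN_le_inv.
  rewrite (le_trans (ler_normD _ _))// lerD//.
    by rewrite normrN ger0_norm// divr_ge0// ltW.
  rewrite normrM normfV (gtr0_norm tk0) ler_pM2r ?invr_gt0//.
  rewrite (le_trans (ler_normB _ _))// lerD// normrM.
    by rewrite (gtr0_norm th0) ler_piMr ?(ltW th0)// cos_max.
  by rewrite ler_piMr// sin_max.
- by move=> u _; have := dF u => h; apply: ex_derive.
- apply: cvg_at_right_filter; apply: differentiable_continuous; apply/derivable1_diffP.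
  by have := dF 0 => h; apply: ex_derive.
- by move=> u _; rewrite derive1E; have := dF u => h; apply: derive_val.
Qed.

Lemma integral_cauchy (k : R) : 0 < k ->
  (\int[mu]_(t in pos) (k ^+ 2 / (t ^+ 2 + k ^+ 2))%:E = (k * (pi / 2))%:E)%E.
Proof.
move=> k0.
have tk (t : R) : 0 < t ^+ 2 + k ^+ 2 by rewrite ltr_wpDl ?sqr_ge0 ?exprn_gt0.
pose F (t : R) : R := k * atan (k^-1 * t).
have dF (t : R) : is_derive t 1 F (k ^+ 2 / (t ^+ 2 + k ^+ 2)).
  apply: is_derive_eq; rewrite /GRing.scale /=; field; rewrite !gt_eqF//.
have cg : continuous (fun t : R => k ^+ 2 / (t ^+ 2 + k ^+ 2)).
  move=> t; apply: cvgM; first exact: cvg_cst.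
  apply: cvgV; first by rewrite gt_eqF.
  by apply: cvgD; [exact: exprn_continuous | exact: cvg_cst].
rewrite integral_itv_obnd_cbnd; last first.
  by apply/measurable_EFinP; apply: measurable_funTS; exact: continuous_measurable_fun.
rewrite (@ge0_continuous_FTC2y _ _ F 0 (k * (pi / 2))).
- by rewrite -EFinB /F mulr0 atan0 mulr0 subr0.
- by move=> t t0; rewrite divr_ge0 ?sqr_ge0 ?(ltW (tk t)).
- exact: continuous_within_cy.
- apply: cvgMr; apply: (@cvg_comp _ _ _ (fun t => k^-1 * t) atan _ +oo%R); last exact: cvgy_atan.
  by apply: gt0_cvgMry; rewrite ?invr_gt0//; exact: cvg_id.
- by move=> t _; have := dF t => h; apply: ex_derive.
- apply: cvg_at_right_filter; apply: differentiable_continuous; apply/derivable1_diffP.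
  by have := dF 0 => h; apply: ex_derive.
- by move=> t _; rewrite derive1E; have := dF t => h; apply: derive_val.
Qed.

(** After insertion of the Laplace transform, Tonelli's theorem allows one to integrate over [u]
    first, and the integral of [k ^ 2 / (t ^ 2 + k ^ 2)] remains. Every integrand is nonnegative. *)
Lemma integral_one_minus_cos_gt0 (k : R) : 0 < k ->
  (\int[mu]_(u in pos) ((1 - cos (k * u)) * u `^ (-2))%:E = (k * (pi / 2))%:E)%E.
Proof.
move=> k0.
pose h (z : R * R) : \bar R := (\1_pos z.1 * (\1_pos z.2 * ((1 - cos (k * z.1)) * (z.2 * expR (- (z.1 * z.2))))))%:E.
have mh : measurable_fun setT h.
  apply/measurable_EFinP; apply: measurable_funM; first exact: measurableT_comp.
  apply: measurable_funM; first exact: measurableT_comp.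
  apply: measurable_funM.
    apply: measurable_funB => //; apply: measurableT_comp.
      by apply: continuous_measurable_fun; exact: continuous_cos.
    exact: measurable_funM.
  apply: measurable_funM => //; apply: measurableT_comp => //; apply: measurableT_comp => //.
  exact: measurable_funM.
have h0 z : (0 <= h z)%E.
  rewrite /h lee_fin mulr_ge0//; rewrite [X in _ <= X * _]indicE.
  case: (boolP (z.2 \in _)) => [|_]; last by rewrite mul0r.
  rewrite inE /= in_itv /= andbT => z2; rewrite mul1r; apply: mulr_ge0; first by rewrite subr_ge0 cos_le1.
  by apply: mulr_ge0; [exact: ltW | exact: expR_ge0].
have := @fubini_tonelli _ _ _ _ R mu mu h mh h0.
rewrite (_ : (\int[mu]_x \int[mu]_y h (x, y) = \int[mu]_(u in pos) ((1 - cos (k * u)) * u `^ (-2))%:E)%E); last first.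
  rewrite -integral_indic_mul; apply: eq_integral => u _; rewrite /h /=.
  rewrite indicE; case: (boolP (u \in _)) => [|_]; last first.
    by rewrite mul0r; under eq_integral do rewrite mul0r; rewrite integral0.
  rewrite inE /= in_itv /= andbT => u0; rewrite mul1r.
  under eq_integral do rewrite mul1r.
  rewrite integral_indic_mul; under eq_integral do rewrite EFinM.
  rewrite ge0_integralZl_EFin ?subr_ge0 ?cos_le1//.
  - by rewrite integral_id_expRN// -EFinM.
  - by move=> t; rewrite /= in_itv /= andbT => t0; rewrite lee_fin mulr_ge0 ?expR_ge0 ?(ltW t0).
  - apply/measurable_EFinP; apply: measurable_funM => //; apply: measurableT_comp => //.
    by apply: measurableT_comp => //; exact: measurable_funM.
move=> ->; rewrite -integral_cauchy// -[RHS]integral_indic_mul; apply: eq_integral => t _; rewrite /h /=.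
rewrite [in RHS]indicE; case: (boolP (t \in _)) => [tp|tn]; last first.
  rewrite mul0r; under eq_integral do rewrite [\1_pos t]indicE (negPf tn) mul0r mulr0; exact: integral0.
have t0 : 0 < t by move: tp; rewrite inE /= in_itv /= andbT.
under eq_integral do rewrite [\1_pos t]indicE tp mul1r.
rewrite integral_indic_mul mul1r.
under eq_integral do rewrite mulrCA EFinM.
rewrite ge0_integralZl_EFin ?(ltW t0)//.
- by rewrite integral_cos_expRN// -EFinM; congr (_%:E); field; rewrite !gt_eqF// ltr_wpDl ?sqr_ge0 ?exprn_gt0.
- apply/measurable_EFinP; apply: measurable_funTS; apply: measurable_funM.
    apply: measurable_funB => //; apply: measurableT_comp.
      by apply: continuous_measurable_fun; exact: continuous_cos.
    exact: measurable_funM.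
  by apply: measurableT_comp => //; apply: measurableT_comp => //; exact: measurable_funM.
Qed.

Lemma integral_one_minus_cos (k : R) :
  (\int[mu]_(u in pos) ((1 - cos (k * u)) * u `^ (-2))%:E = (`|k| * (pi / 2))%:E)%E.
Proof.
have [->|k0] := eqVneq k 0.
  rewrite normr0 mul0r integral0_eq// => u _.
  by rewrite mul0r cos0 subrr mul0r.
have ck u : cos (k * u) = cos (`|k| * u).
  by have [_|_] := ger0P k => //; rewrite mulNr cosN.
under eq_integral do rewrite ck.
by apply: integral_one_minus_cos_gt0; rewrite normr_gt0.
Qed.

Lemma integrable_one_minus_cos (k : R) :
  mu.-integrable pos (EFin \o (fun u : R => (1 - cos (k * u)) * u `^ (-2))).
Proof.
apply/integrableP; split.
  apply/measurable_EFinP; apply: measurable_funTS; apply: measurable_funM; last exact: measurable_powR.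
  apply: measurable_funB => //; apply: measurableT_comp.
    by apply: continuous_measurable_fun; exact: continuous_cos.
  exact: measurable_funM.
rewrite (_ : (\int[mu]_(x in pos) `|_| = \int[mu]_(u in pos) ((1 - cos (k * u)) * u `^ (-2))%:E)%E).
  by rewrite integral_one_minus_cos ltry.
apply: eq_integral => u _ /=; rewrite ger0_norm//.
by rewrite mulr_ge0 ?powR_ge0// subr_ge0 cos_le1.
Qed.

Lemma Rintegral_one_minus_cos (k : R) :
  \int[mu]_(u in pos) ((1 - cos (k * u)) * u `^ (-2)) = `|k| * (pi / 2).
Proof. by rewrite /Rintegral integral_one_minus_cos. Qed.

(** The product formula for cosines reduces the integral to those of [1 - cos] at the frequencies 1,
    [k], [1 + k] and [1 - k]; the minimum is [1 + |k| - (|1 + k| + |1 - k|) / 2]. *)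
Lemma integral_cos_product (k : R) :
  (\int[mu]_(u in pos) ((1 - cos u) * (1 - cos (k * u)) * u `^ (-2))%:E = (Num.min 1 `|k| * (pi / 2))%:E)%E.
Proof.
pose g k (u : R) : R := (1 - cos (k * u)) * u `^ (-2).
have ig k' : mu.-integrable pos (EFin \o g k') by exact: integrable_one_minus_cos.
have igZ k' : mu.-integrable pos (EFin \o (fun u => 1 / 2 * g k' u)).
  have := @integrableZl _ _ _ mu pos (measurable_itv _) (1 / 2) _ (ig k').
  by under [X in _ -> mu.-integrable _ X]eq_fun do rewrite /= EFinM.
have i1 : mu.-integrable pos (EFin \o (fun u => g 1 u + g k u)).
  rewrite (_ : EFin \o _ = ((EFin \o g 1%R) \+ (EFin \o g k))%E); last exact/funext.
  by apply: integrableD => //; exact: measurable_itv.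
have i2 : mu.-integrable pos (EFin \o (fun u => 1 / 2 * g (1 + k) u + 1 / 2 * g (1 - k) u)).
  rewrite (_ : EFin \o _ = ((EFin \o (fun u => (1 / 2 * g (1 + k) u)%R)) \+ (EFin \o (fun u => (1 / 2 * g (1 - k) u)%R)))%E); last exact/funext.
  by apply: integrableD => //; exact: measurable_itv.
have i3 : mu.-integrable pos (EFin \o (fun u => g 1 u + g k u - (1 / 2 * g (1 + k) u + 1 / 2 * g (1 - k) u))).
  rewrite (_ : EFin \o _ = ((EFin \o (fun u => (g 1 u + g k u)%R)) \- (EFin \o (fun u => (1 / 2 * g (1 + k) u + 1 / 2 * g (1 - k) u)%R)))%E); last exact/funext.
  by apply: integrableB => //; exact: measurable_itv.
have E (u : R) : (1 - cos u) * (1 - cos (k * u)) * u `^ (-2) =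
    g 1 u + g k u - (1 / 2 * g (1 + k) u + 1 / 2 * g (1 - k) u).
  have e1 : (1 + k) * u = u + k * u by ring.
  have e2 : (1 - k) * u = u - k * u by ring.
  by rewrite /g e1 e2 (mul1r u) cosD cosB; field.
under eq_integral do rewrite E.
rewrite -(@fineK _ (\int[mu]_(u in pos) _)%E); last by apply: integrable_fin_num => //; exact: measurable_itv.
congr (_%:E).
rewrite (_ : fine _ = \int[mu]_(u in pos) (g 1 u + g k u - (1 / 2 * g (1 + k) u + 1 / 2 * g (1 - k) u)))//.
rewrite RintegralB// !RintegralD// !RintegralZl// !Rintegral_one_minus_cos normr1.
have -> : Num.min 1 `|k| = 1 + `|k| - (1 / 2 * `|1 + k| + 1 / 2 * `|1 - k|).
  have [k1|k1] := leP 1 `|k|.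
    have [k0|k0] := leP 0 k; [rewrite (ger0_norm k0) in k1 *|rewrite (ltr0_norm k0) in k1 *].
      by rewrite ger0_norm ?ler0_norm; lra.
    by rewrite ler0_norm ?ger0_norm; lra.
  move: k1; rewrite ltr_norml => /andP[k1 k2].
  have -> : `|1 + k| = 1 + k by rewrite ger0_norm//; lra.
  have -> : `|1 - k| = 1 - k by rewrite ger0_norm//; lra.
  lra.
ring.
Qed.

(** [integral_cos_product] at [k = D / s] represents the minimum; after exchanging the integrals the
    expectation acts only on [cos (u / s * D)] and yields the exponential. The factor [2^-1] in [h]
    turns [1 - cos u] into the [sin (u / 2) ^ 2] of [f_fun]. *)
Lemma f_funE {d : measure_display} {T : measurableType d} (P : probability T R) (D : T -> R) (alpha c a s : R) :
  measurable_fun setT D ->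
  (forall th, 0 <= th -> \int[P]_w cos (th * D w) = expR (- (2 * c * th `^ alpha))) ->
  0 < a -> 0 < s -> a * f_fun alpha c a s = \int[P]_w Num.min s `|D w|.
Proof.
move=> mD cfD a0 s0.
have mcos : measurable_fun setT (@cos R) by apply: continuous_measurable_fun; exact: continuous_cos.
have bcos th : bmeas (fun w => cos (th * D w)).
  by apply: bmeas_comp => //; [exists 1 => x; exact: cos_max | exact: measurable_funM].
pose h (z : R * T) : \bar R := (\1_pos z.1 * (2^-1 * ((1 - cos z.1) * (1 - cos (z.1 / s * D z.2)) * z.1 `^ (-2))))%:E.
have mh : measurable_fun setT h.
  apply/measurable_EFinP; apply: measurable_funM; first exact: measurableT_comp.
  apply: measurable_funM => //; apply: measurable_funM; last exact: (measurableT_comp (measurable_powR (-2)) measurable_fst).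
  apply: measurable_funM; apply: measurable_funB => //; apply: measurableT_comp => //.
  apply: measurable_funM; first exact: measurable_funM.
  exact: measurableT_comp.
have h0 z : (0 <= h z)%E.
  rewrite /h lee_fin mulr_ge0// mulr_ge0// mulr_ge0 ?powR_ge0// mulr_ge0// subr_ge0 cos_le1//.
have fub := @fubini_tonelli _ _ _ _ R mu P h mh h0.
have L : (\int[mu]_u \int[P]_w h (u, w) = \int[mu]_(u in pos)
   (sin (u / 2) ^+ 2 / u ^+ 2 * (1 - expR (- (2 * c * (u / s) `^ alpha))))%:E)%E.
  rewrite -integral_indic_mul; apply: eq_integral => u _; rewrite /h /=.
  rewrite indicE; case: (boolP (u \in _)) => [|_]; last first.
    by rewrite mul0r; under eq_integral do rewrite mul0r; rewrite integral0.
  rewrite inE /= in_itv /= andbT => u0; rewrite [in RHS]mul1r.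
  have us0 : 0 <= u / s by rewrite divr_ge0 ?ltW.
  under eq_integral do rewrite mul1r.
  set F := (X in (\int[P]_x (X x)%:E)%E).
  have bF : bmeas F.
    rewrite /F; apply: bmeasZ; apply: bmeasM; last exact: bmeas_cst.
    by apply: bmeasZ; apply: bmeasB; [exact: bmeas_cst | exact: bcos].
  rewrite -(@fineK _ (\int[P]_x (F x)%:E)%E); last exact: (integrable_fin_num measurableT (bmeas_integrable P bF)).
  congr (_%:E); rewrite -/(Rintegral P setT F).
  rewrite (@eq_ER _ _ _ P F (fun w => (2^-1 * (1 - cos u) * u `^ (-2)) * (1 - cos (u / s * D w)))); last first.
    by move=> w; rewrite /F; ring.
  rewrite ERZ; last by apply: bmeasB; [exact: bmeas_cst | exact: bcos].
  rewrite ERB ?ER_cst ?cfD//; [|exact: bmeas_cst].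
  rewrite powRN (powR_mulrn 2) ?(ltW u0)//; congr (_ * _).
  have -> : cos u = 1 - 2 * sin (u / 2) ^+ 2.
    have -> : cos u = cos ((u / 2) *+ 2) by congr cos; rewrite mulr2n; field.
    by rewrite cos_mulr2n sin2cos2; ring.
  by field; rewrite gt_eqF.
have r w : (\int[mu]_u h (u, w) = ((pi / 4) / s * Num.min s `|D w|)%:E)%E.
  rewrite /h /= integral_indic_mul; under eq_integral do rewrite EFinM mulrAC.
  have E u : u / s * D w = D w / s * u by ring.
  under eq_integral do rewrite E (mulrAC (1 - cos _)).
  rewrite ge0_integralZl_EFin//.
  - rewrite integral_cos_product -EFinM; congr (_%:E).
    rewrite normrM normfV (gtr0_norm s0).
    have -> : Num.min s `|D w| = s * Num.min 1 (`|D w| / s).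
      by rewrite minr_pMr ?(ltW s0)// mulr1 mulrC divfK ?gt_eqF.
    by field; rewrite gt_eqF.
  - by move=> u _; rewrite lee_fin mulr_ge0 ?powR_ge0// mulr_ge0// subr_ge0 cos_le1.
  - apply/measurable_EFinP; apply: measurable_funTS; apply: measurable_funM; last exact: measurable_powR.
    apply: measurable_funM; apply: measurable_funB => //; apply: measurableT_comp => //; exact: measurable_funM.
have s_neq0 : (s == 0) = false by rewrite gt_eqF.
have bm : bmeas (fun w => Num.min s `|D w|).
  split; first by apply: measurable_minr => //; exact: measurableT_comp.
  exists s => w; rewrite ger0_norm; first by rewrite ge_min lexx.
  by rewrite le_min (ltW s0) normr_ge0.
rewrite /f_fun s_neq0; set I := \int[P]_w _.
have -> : \int[mu]_(u in pos) (sin (u / 2) ^+ 2 / u ^+ 2 * (1 - expR (- (2 * c * (u / s) `^ alpha)))) = (pi / 4) / s * I.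
  rewrite {1}/Rintegral -L fub -(ERZ _ _ bm); congr fine.
  by apply: eq_integral => w _; exact: r.
have := pi_gt0 R; move: (@pi R) => p p0.
by field; rewrite !gt_eqF.
Qed.

End OneMinusCosIntegral.

(** * Counting particles *)

Section LevelSets.
Context {R : realType} {d : measure_display} {T : measurableType d}.

Lemma measurable_ge_set (f : T -> R) (c : R) : measurable_fun setT f -> measurable [set w | c <= f w].
Proof.
move=> mf; rewrite (_ : [set w | c <= f w] = setT `&` f @^-1` `[c, +oo[%classic).
  by apply: mf => //; exact: measurable_itv.
by apply/seteqP; split => w /=; rewrite in_itv /= andbT // => -[].
Qed.

Lemma measurable_le_set (f : T -> R) (c : R) : measurable_fun setT f -> measurable [set w | f w <= c].
Proof.
move=> mf; rewrite (_ : [set w | f w <= c] = setT `&` f @^-1` `]-oo, c]%classic).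
  by apply: mf => //; exact: measurable_itv.
by apply/seteqP; split => w /=; rewrite in_itv /= // => -[].
Qed.

End LevelSets.

Section Counting.
Context {R : realType} {d : measure_display} {T : measurableType d} (P : probability T R).
Context (a : R) (a0 : 0 < a).
Context (Y : int -> T -> R) (mY : forall j, measurable_fun setT (Y j)) (eps : T -> R).
Hypothesis epsU : uniform01 P eps.
Hypothesis indY : forall (B : set R) (s : seq int), measurable B -> uniq s ->
  indep_with P Y (eps @^-1` B) s.
Hypothesis lawY : forall j u v, Pr P (Y j @^-1` `]u, v]%classic) = Pr P (Y 0 @^-1` `]u, v]%classic).

Lemma indep_pair (A B : set R) : measurable A -> measurable B ->
  Pr P (Y 0 @^-1` A `&` Y 1 @^-1` B) = Pr P (Y 0 @^-1` A) * Pr P (Y 1 @^-1` B).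
Proof.
move=> mA mB; have := @indY setT [:: 0; 1] measurableT isT (fun j => if j == 0 then A else B).
rewrite !big_cons big_nil /= mulr1 preimage_setT PrT mul1r setTI => <-; last by move=> j; case: eqP.
congr (Pr P _); apply/seteqP; split => w /=.
  by move=> [Aw Bw] j; rewrite !inE => /orP[]/eqP->.
by move=> h; split; [have := h 0; apply | have := h 1; apply]; rewrite !inE eqxx ?orbT.
Qed.

Definition site (j : int) (w : T) : R := Y j w + a * (j%:~R - eps w).

Definition window_count (m : nat) (u v : R) (w : T) : R :=
  \sum_(j <- int_window m) \1_(`]u, v]%classic) (site j w).

Let meps : measurable_fun setT eps. Proof. by case: epsU. Qed.

Lemma measurable_site j : measurable_fun setT (site j).
Proof.
apply: measurable_funD => //; apply: measurable_funM => //.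
exact: measurable_funB.
Qed.

Lemma measurable_window_count m u v : measurable_fun setT (window_count m u v).
Proof.
rewrite /window_count; elim: (int_window m) => [|j js IH].
  by under eq_fun do rewrite big_nil; exact: measurable_cst.
under eq_fun do rewrite big_cons; apply: measurable_funD => //.
by apply: measurableT_comp; [exact: measurable_indic (measurable_itv _) | exact: measurable_site].
Qed.

Lemma window_sumE (I : Type) (s : seq I) (l u v : I -> R) m w :
  window_sum Y a s l u v m (eps w) w = \sum_(i <- s) l i * window_count m (u i) (v i) w.
Proof.
rewrite /window_sum /step_comb exchange_big /=; apply: eq_bigr => i _.
by rewrite mulr_sumr.
Qed.

(** 48 is 2 for the two tails times the [4!] of [expRN_le_inv4]; [6 + 1 / a] bounds the part
    [4 + th ^ 2 (n0 + 2)] of the Chernoff exponent. *)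
Definition tail_const : R := 48 * expR (6 + 1 / a).

Lemma expRN_le_inv4 (x : R) : 0 < x -> expR (- x) <= 24 / x ^+ 4.
Proof.
move=> x0; rewrite expRN -[leRHS]invrK lef_pV2 ?posrE ?expR_gt0 ?invr_gt0 ?divr_gt0 ?exprn_gt0//.
have := @expR_ge1Dxn R x 3 (ltW x0); rewrite invf_div => h; apply: le_trans h.
by rewrite (_ : 4`!%:R = 24)//; lra.
Qed.

Lemma window_count_tail (u v y : R) : u <= v -> 0 < y ->
  exists m0, forall m, (m0 <= m)%N ->
    Pr P [set w | y <= `|window_count m u v w - (v - u) / a|] <= tail_const * Num.max (v - u) 1 ^+ 2 / y ^+ 4.
Proof.
move=> uv y0.
have l0 : 0 <= (v - u) / a by rewrite divr_ge0 ?subr_ge0// ltW.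
set n0 := (v - u) / a in l0 *.
set A := Num.max (v - u) 1.
have A1 : 1 <= A by rewrite /A le_max lexx orbT.
have A0 : 0 < A by exact: lt_le_trans A1.
have sA0 : 0 < Num.sqrt A by rewrite sqrtr_gt0.
have sA1 : 1 <= Num.sqrt A by rewrite -[leLHS]sqrtr1 ler_wsqrtr.
(* With this parameter [th ^ 2 * n0] stays bounded and the decay is the exponential of
   [- y / sqrt A], which is then weakened to [24 A ^ 2 / y ^ 4]. Taking [A >= 1] keeps [th <= 1]. *)
pose th := (Num.sqrt A)^-1.
have th01 : 0 <= th <= 1 by rewrite /th invr_ge0 (ltW sA0) /= invf_le1.
have thA : th ^+ 2 = A^-1 by rewrite /th exprVn sqr_sqrtr// ltW.
have [m0 Hm0] := sum_site_prob a0 mY lawY uv.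
exists m0 => m mm0.
pose B := `]u, v]%classic : set R.
have mB : measurable B by exact: measurable_itv.
pose bs := [:: (B, 1); (~` B, 0)] : seq (set R * R).
have Ecomb : step_comb [:: tt] (fun=> 1) (fun=> u) (fun=> v) = (fun y => 1 * \1_B y).
  by apply/funext => z; rewrite /step_comb big_seq1.
have hrep : step_rep `|1| (step_comb [:: tt] (fun=> 1) (fun=> u) (fun=> v)) bs.
  by rewrite Ecomb; exact: step_rep_indic.
have flE e j : frozen_law P Y a bs e j = bern (site_prob P a Y e u v j).
  rewrite /frozen_law /discrete_law /bs /bern /=; congr [:: _; (_, 0)].
  rewrite -PrC; first by congr (Pr P _).
  rewrite -[X in measurable X]setTI; apply: (measurable_funD (mY j) (measurable_cst _)) => //.
have tails e : 0 <= e <= 2 ->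
    EE (map (frozen_law P Y a bs e) (int_window m)) (\1_[set s | n0 + y <= s]) 0 <= expR (4 + th ^+ 2 * (n0 + 2) - th * y) /\
    EE (map (frozen_law P Y a bs e) (int_window m)) (\1_[set s | s <= n0 - y]) 0 <= expR (4 + th ^+ 2 * (n0 + 2) - th * y).
  move=> e02; rewrite (eq_map (flE e)) map_comp.
  apply: EE_bern_tail => //.
    by move=> p /mapP[j _ ->]; exact: site_prob_itv.
  by rewrite big_map; exact: Hm0.
set bd := expR _ in tails.
have bd0 : 0 <= bd by exact: expR_ge0.
have Psib (S : set R) : exists M : R, forall z, `|(\1_S z : R)| <= M.
  by exists 1 => z; rewrite indicE; case: (_ \in _); rewrite ?normr1 ?normr0.
have m1 : measurable [set s : R | n0 + y <= s].
  by rewrite (_ : [set s : R | n0 + y <= s] = `[n0 + y, +oo[%classic) //; apply/seteqP; split => z /=; rewrite in_itv /= andbT.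
have m2 : measurable [set s : R | s <= n0 - y].
  by rewrite (_ : [set s : R | s <= n0 - y] = `]-oo, n0 - y]%classic) //; apply/seteqP; split => z /=; rewrite in_itv.
have EEge0 e (S : set R) : 0 <= e <= 2 -> 0 <= EE (map (frozen_law P Y a bs e) (int_window m)) (\1_S) 0.
  move=> e02.
  have lw q : q \in map (frozen_law P Y a bs e) (int_window m) -> is_law q.
    by move=> /mapP[j _ ->]; rewrite flE; apply: bern_law; exact: site_prob_itv.
  by rewrite -[leLHS](EE_cst 0 0 lw); apply: EE_le.
have wsE w : window_sum Y a [:: tt] (fun=> 1) (fun=> u) (fun=> v) m (eps w) w = window_count m u v w.
  by rewrite window_sumE big_seq1 mul1r.
have t1 : Pr P [set w | n0 + y <= window_count m u v w] <= bd.
  have := @transfer_eps _ _ _ P Y mY eps a a0 epsU indY _ [:: tt] (fun=> 1) (fun=> u) (fun=> v) _ bs hrep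
    (\1_[set s | n0 + y <= s]) 0 bd m (measurable_indic m1) (Psib _).
  have H e : 0 <= e <= 2 -> 0 <= EE (map (frozen_law P Y a bs e) (int_window m)) (\1_[set s | n0 + y <= s]) 0 <= bd.
    by move=> e02; rewrite EEge0//=; case: (tails e e02).
  move=> /(_ H) /andP[_]; rewrite (@eq_ER _ _ _ P _ (\1_[set w | n0 + y <= window_count m u v w])).
    by rewrite ER_indic//; (apply: measurable_ge_set || apply: measurable_le_set); exact: measurable_window_count.
  by move=> w; rewrite wsE !indicE; congr (_%:R); apply/idP/idP => /set_mem h; apply/mem_set.
have t2 : Pr P [set w | window_count m u v w <= n0 - y] <= bd.
  have := @transfer_eps _ _ _ P Y mY eps a a0 epsU indY _ [:: tt] (fun=> 1) (fun=> u) (fun=> v) _ bs hrep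
    (\1_[set s | s <= n0 - y]) 0 bd m (measurable_indic m2) (Psib _).
  have H e : 0 <= e <= 2 -> 0 <= EE (map (frozen_law P Y a bs e) (int_window m)) (\1_[set s | s <= n0 - y]) 0 <= bd.
    by move=> e02; rewrite EEge0//=; case: (tails e e02).
  move=> /(_ H) /andP[_]; rewrite (@eq_ER _ _ _ P _ (\1_[set w | window_count m u v w <= n0 - y])).
    by rewrite ER_indic//; (apply: measurable_ge_set || apply: measurable_le_set); exact: measurable_window_count.
  by move=> w; rewrite wsE !indicE; congr (_%:R); apply/idP/idP => /set_mem h; apply/mem_set.
have mm1 : measurable [set w | n0 + y <= window_count m u v w].
  by apply: measurable_ge_set; exact: measurable_window_count.
have mm2 : measurable [set w | window_count m u v w <= n0 - y].
  by apply: measurable_le_set; exact: measurable_window_count.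
rewrite (_ : [set w | y <= _] = [set w | n0 + y <= window_count m u v w] `|` [set w | window_count m u v w <= n0 - y]); last first.
  apply/seteqP; split => w /=; rewrite ler_normr.
    by move=> /orP[h|h]; [left|right]; lra.
  by move=> [h|h]; apply/orP; [left|right]; lra.
apply: (le_trans (PrU P mm1 mm2)).
apply: (@le_trans _ _ (2 * bd)); first by lra.
have b1 : bd <= expR (6 + 1 / a) * expR (- (th * y)).
  rewrite /bd -expRD ler_expR thA.
  suff : A^-1 * (n0 + 2) <= 1 / a + 2 by lra.
  rewrite mulrDr; apply: lerD.
    by rewrite /n0 mulrA ler_pM2r ?invr_gt0// mulrC ler_pdivrMr// mul1r /A le_max lexx.
  by rewrite ler_piMl// invf_le1.
have thy : 0 < th * y by rewrite mulr_gt0// invr_gt0.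
have b2 := expRN_le_inv4 thy.
rewrite /tail_const (_ : _ * A ^+ 2 / y ^+ 4 = 2 * (expR (6 + 1 / a) * (24 / (th * y) ^+ 4))).
  by rewrite ler_pM2l// (le_trans b1)// ler_pM2l ?expR_gt0.
rewrite exprMn (_ : th ^+ 4 = A^-1 ^+ 2); last by rewrite -thA -exprM.
by field; rewrite !gt_eqF.
Qed.

(** Infinitely many particles in []- k, k]], written with the finite windows so that the event is
    visibly a countable combination of measurable ones. *)
Definition crowded (k : nat) : set T := [set w | forall n : nat, exists m, n%:R <= window_count m (- k%:R) k%:R w].

Lemma window_countS m u v w : window_count m.+1 u v w =
  \1_(`]u, v]%classic) (site (Posz m) w) + (\1_(`]u, v]%classic) (site (Negz m) w) + window_count m u v w).
Proof. by rewrite /window_count /= !big_cons. Qed.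

Lemma window_count_mono m n u v w : (m <= n)%N -> window_count m u v w <= window_count n u v w.
Proof.
move=> /subnK <-; elim: (n - m)%N => [|k IH] //=; rewrite addSn window_countS.
by apply: (le_trans IH); rewrite addrA lerDr addr_ge0.
Qed.

(** For a fixed interval the tail bound holds with the same constant for all large windows, hence
    also for the union over windows, since counts increase with the window. Then [n] tends to
    infinity. *)
Lemma crowded_null k : measurable (crowded k) /\ Pr P (crowded k) = 0.
Proof.
pose A (n m : nat) := [set w | n%:R <= window_count m (- k%:R) k%:R w].
have mA n m : measurable (A n m).
  by apply: measurable_ge_set; exact: measurable_window_count.
pose U n := \bigcup_m A n m.
have mU n : measurable (U n) by exact: bigcupT_measurable.
have E : crowded k = \bigcap_n U n.
  apply/seteqP; split => w /=; first by move=> h n _; have [m hm] := h n; exists m.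
  by move=> h n; have [m _ hm] := h n I; exists m.
have mC : measurable (crowded k) by rewrite E; exact: bigcapT_measurable.
split=> //.
have kk : - k%:R <= k%:R :> R by have := ler0n R k; lra.
set L : R := (k%:R - - k%:R) / a.
have L0 : 0 <= L by rewrite divr_ge0 ?subr_ge0// ltW.
pose C := tail_const * Num.max (k%:R - - k%:R) 1 ^+ 2.
have C0 : 0 <= C by rewrite /C mulr_ge0 ?sqr_ge0// /tail_const mulr_ge0 ?expR_ge0.
have PU n : 0 < n%:R - L -> Pr P (U n) <= C / (n%:R - L) ^+ 4.
  move=> nL; have [m0 H] := window_count_tail kk nL.
  have cv : (fun m => \int[P]_w \1_(A n m) w) @ \oo --> \int[P]_w \1_(U n) w.
    apply: (@ER_cvg _ _ _ P _ _ 1 set0) => //.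
    - by rewrite /Pr measure0.
    - by move=> m; exact: measurable_indic.
    - by move=> m w; rewrite indicE; case: (_ \in _); rewrite ?normr1 ?normr0.
    - move=> w _; apply: cvg_near_cst; have [[m1 _ h1]|h] := pselect (U n w).
        near=> m; have m1m : (m1 <= m)%N by near: m; exact: nbhs_infty_ge.
        rewrite !indicE !mem_set//; first by exists m1.
        by rewrite /A /=; apply: le_trans h1 _; exact: window_count_mono.
      apply: nearW => m; rewrite !indicE !memNset// => h'; apply: h; by exists m.
  rewrite -ER_indic//; apply: (cvgr_to_le cv); exists m0 => // m /= mm0.
  rewrite ER_indic//; apply: le_trans (H m mm0); apply: Pr_le => //.
    apply: measurable_ge_set; apply: measurableT_comp => //; apply: measurable_funB => //.
    exact: measurable_window_count.
  by move=> w /= hw; rewrite -/L; apply: le_trans (ler_norm _); rewrite lerD2r.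
apply/eqP; rewrite eq_le Pr_ge0 andbT; apply/ler_addgt0Pr => e e0; rewrite add0r.
pose n := (Num.truncn (L + 1 + C / e)).+1.
have nb : L + 1 + C / e <= n%:R by apply: ltW; exact: truncnS_gt.
have Ce : 0 <= C / e by rewrite divr_ge0// ltW.
have z1 : 1 <= n%:R - L by lra.
apply: (@le_trans _ _ (Pr P (U n))).
  apply: Pr_le => // w; rewrite E => h; exact: h.
apply: (le_trans (PU n _)); first by lra.
rewrite ler_pdivrMr ?exprn_gt0//; last by lra.
apply: (@le_trans _ _ (e * (n%:R - L))).
  by rewrite mulrC -ler_pdivrMr//; lra.
rewrite ler_pM2l// exprS ler_peMr//; first by lra.
by rewrite exprn_ege1.
Unshelve. all: end_near. Qed.

Definition degenerate : set T := \bigcup_k crowded k.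

Lemma degenerate_null : measurable degenerate /\ Pr P degenerate = 0.
Proof.
have mD : measurable degenerate by apply: bigcupT_measurable => k; case: (crowded_null k).
split => //; rewrite /Pr.
have : P.-negligible degenerate.
  apply: negligible_bigcup => k; have [mk Pk] := crowded_null k.
  apply/negligibleP => //; apply: etrans (esym (EPr P mk)) _; by rewrite Pk.
by move/negligibleP => -> //.
Qed.

(** Otherwise every window misses some particle of []- k, k]], and enlarging the window to include
    it raises the count by at least 1 each time, so that the counts are unbounded. *)
Lemma locally_finite w (k : nat) : ~ degenerate w ->
  exists M, forall j, j \notin int_window M -> ~ (- k%:R < site j w <= k%:R).
Proof.
move=> nd; apply: contrapT => H; apply: nd; exists k => // n.
elim: n => [|n [m IH]].
  by exists 0%N; rewrite /window_count big_nil.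
have /existsNP[j /not_implyP[jm /contrapT jI]] : ~ forall j, j \notin int_window m -> ~ (- k%:R < site j w <= k%:R).
  by move=> h; apply: H; exists m.
(* [int_window q.+1] is the first window that contains [j]. *)
pose q := match j with Posz i => i | Negz i => i end.
exists q.+1.
have mq : (m <= q)%N by move: jm; rewrite mem_int_window /q; case: (j) => i; rewrite -leqNgt.
apply: (@le_trans _ _ (1 + window_count q (- k%:R) k%:R w)).
  by rewrite -natr1 addrC lerD2l (le_trans IH)// window_count_mono.
rewrite window_countS addrA lerD2r.
have one : \1_(`](- k%:R), k%:R]%classic) (site j w) = 1 :> R by rewrite indicE mem_set//= in_itv.
by rewrite /q; case: (j) one => i ->; rewrite ?lerDl ?lerDr.
Qed.

Lemma window_count_stable w (k M m : nat) u v :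
  (forall j, j \notin int_window M -> ~ (- k%:R < site j w <= k%:R)) -> - k%:R <= u -> v <= k%:R ->
  (M <= m)%N -> window_count m u v w = window_count M u v w.
Proof.
move=> H ku vk /subnK <-; elim: (m - M)%N => [|n IH] //; rewrite addSn window_countS IH.
have out j : j \notin int_window M -> \1_(`]u, v]%classic) (site j w) = 0 :> R.
  move=> jM; rewrite indicE memNset//= in_itv /= => /andP[h1 h2]; apply: (H j jM).
  by rewrite (le_lt_trans ku h1) (le_trans h2 vk).
by rewrite !out ?add0r// mem_int_window -leqNgt leq_addl.
Qed.

(* Equal to [0] on the null set where infinitely many particles lie in a bounded interval. *)
Definition count_ioc (u v : R) (w : T) : R := lim ((fun m => \1_(~` degenerate) w * window_count m u v w) @ \oo).

Lemma cvg_count_ioc u v w : (fun m => \1_(~` degenerate) w * window_count m u v w) @ \oo --> count_ioc u v w.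
Proof.
suff [l hl] : exists l, \forall m \near \oo, \1_(~` degenerate) w * window_count m u v w = l.
  have c : (fun m => \1_(~` degenerate) w * window_count m u v w) @ \oo --> l by exact: cvg_near_cst.
  by rewrite /count_ioc (cvg_lim _ c).
have [dw|nd] := pselect (degenerate w).
  by exists 0; apply: nearW => m; rewrite indicE memNset ?mul0r//= => /(_ dw).
pose k := (Num.truncn (`|u| + `|v|)).+1.
have kb : `|u| + `|v| <= k%:R by apply: ltW; exact: truncnS_gt.
have [M HM] := locally_finite k nd.
exists (window_count M u v w); exists M => // m /= Mm.
rewrite indicE mem_set// mul1r; apply: window_count_stable HM _ _ Mm.
  by have := ler_norm (- u); rewrite normrN; have := normr_ge0 v; lra.
by have := ler_norm v; have := normr_ge0 u; lra.
Qed.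

Lemma count_iocE w (k M : nat) u v : ~ degenerate w ->
  (forall j, j \notin int_window M -> ~ (- k%:R < site j w <= k%:R)) -> - k%:R <= u -> v <= k%:R ->
  forall m, (M <= m)%N -> count_ioc u v w = window_count m u v w.
Proof.
move=> nd H ku vk m Mm.
have c : (fun m => \1_(~` degenerate) w * window_count m u v w) @ \oo --> window_count m u v w.
  apply: cvg_near_cst; exists m => // n /= mn; rewrite indicE mem_set// mul1r.
  rewrite (window_count_stable H ku vk Mm) (window_count_stable H ku vk)//; exact: leq_trans mn.
by rewrite /count_ioc (cvg_lim _ c).
Qed.

Lemma measurable_count_ioc u v : measurable_fun setT (count_ioc u v).
Proof.
apply: (measurable_fun_cvg (h := fun m w => \1_(~` degenerate) w * window_count m u v w)).
  move=> m; apply: measurable_funM; last exact: measurable_window_count.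
  by apply: measurable_indic; apply: measurableC; case: degenerate_null.
by move=> w _; exact: cvg_count_ioc.
Qed.

(** Off the null set [degenerate] the window sums are eventually constant in [m], so bounds valid
    for all large windows survive by dominated convergence. *)
Lemma transfer_count (I : Type) (s : seq I) (l u v : I -> R) (Psi : R -> R) (lo hi : R) :
  measurable_fun setT Psi -> (exists M : R, forall y, `|Psi y| <= M) ->
  (exists m0, forall m, (m0 <= m)%N -> lo <= \int[P]_w Psi (window_sum Y a s l u v m (eps w) w) <= hi) ->
  lo <= \int[P]_w Psi (\sum_(i <- s) l i * count_ioc (u i) (v i) w) <= hi.
Proof.
move=> mPsi [M PM] [m0 H].
have cv : (fun m => \int[P]_w Psi (window_sum Y a s l u v m (eps w) w)) @ \oo -->
    \int[P]_w Psi (\sum_(i <- s) l i * count_ioc (u i) (v i) w).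
  have [mD PD] := degenerate_null.
  apply: (@ER_cvg _ _ _ P _ _ M degenerate) => //.
  - move=> m; apply: measurableT_comp => //; exact: measurable_window_sum.
  - apply: measurableT_comp => //.
    elim: s {H} => [|i s' IH]; first by under eq_fun do rewrite big_nil; exact: measurable_cst.
    under eq_fun do rewrite big_cons; apply: measurable_funD => //; apply: measurable_funM => //.
    exact: measurable_count_ioc.
  - move=> w nd; apply: cvg_near_cst.
    suff : \forall m \near \oo, window_sum Y a s l u v m (eps w) w = \sum_(i <- s) l i * count_ioc (u i) (v i) w.
      by apply: filterS => m ->.
    under eq_near do rewrite window_sumE.
    elim: s {H} => [|i s' IH]; first by apply: nearW => m; rewrite !big_nil.
    pose k := (Num.truncn (`|u i| + `|v i|)).+1.
    have kb : `|u i| + `|v i| <= k%:R by apply: ltW; exact: truncnS_gt.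
    have [M' HM] := locally_finite k nd.
    near=> m; rewrite !big_cons; congr (_ + _); last by near: m.
    congr (_ * _); symmetry; apply: (count_iocE nd HM).
    - by have := ler_norm (- u i); rewrite normrN; have := normr_ge0 (v i); lra.
    - by have := ler_norm (v i); have := normr_ge0 (u i); lra.
    - by near: m; exact: nbhs_infty_ge.
apply/andP; split.
  by apply: (cvgr_to_ge cv); exists m0 => // m /= /H/andP[].
by apply: (cvgr_to_le cv); exists m0 => // m /= /H/andP[].
Unshelve. all: end_near. Qed.

Lemma count_ioc_tail (u v y : R) : u <= v -> 0 < y ->
  Pr P [set w | y <= `|count_ioc u v w - (v - u) / a|] <= tail_const * Num.max (v - u) 1 ^+ 2 / y ^+ 4.
Proof.
move=> uv y0.
pose S := [set z : R | y <= `|z - (v - u) / a|].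
have mS : measurable S.
  by apply: measurable_ge_set; apply: measurableT_comp => //; exact: measurable_funB.
have mc : measurable [set w | y <= `|count_ioc u v w - (v - u) / a|].
  by apply: measurable_ge_set; apply: measurableT_comp => //; apply: measurable_funB => //; exact: measurable_count_ioc.
have mw m : measurable [set w | y <= `|window_count m u v w - (v - u) / a|].
  by apply: measurable_ge_set; apply: measurableT_comp => //; apply: measurable_funB => //; exact: measurable_window_count.
have [m0 H] := window_count_tail uv y0.
have := @transfer_count unit [:: tt] (fun=> 1) (fun=> u) (fun=> v) (\1_S) 0
  (tail_const * Num.max (v - u) 1 ^+ 2 / y ^+ 4) (measurable_indic mS).
move=> /(_ _ _)/andP[||_].
- by exists 1 => z; rewrite indicE; case: (_ \in _); rewrite ?normr1 ?normr0.
- exists m0 => m mm0.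
  rewrite (@eq_ER _ _ _ P _ (\1_[set w | y <= `|window_count m u v w - (v - u) / a|])).
    by rewrite ER_indic// Pr_ge0 H.
  by move=> w; rewrite window_sumE big_seq1 mul1r.
rewrite (@eq_ER _ _ _ P _ (\1_[set w | y <= `|count_ioc u v w - (v - u) / a|])).
  by rewrite ER_indic.
by move=> w; rewrite big_seq1 mul1r.
Qed.

End Counting.

(** * Mean and variance of a step function of one particle *)

Section StepMoments.
Context {R : realType} {d : measure_display} {T : measurableType d} (P : probability T R).
Context (Z : T -> R) (mZ : measurable_fun setT Z).

Let p (u v : R) : R := Pr P (Z @^-1` `]u, v]%classic).
Let q (u v : R) : R := p u v - p u v ^+ 2.

Let mZi u v : measurable (Z @^-1` `]u, v]%classic).
Proof. by rewrite -[X in measurable X]setTI; apply: mZ => //; exact: measurable_itv. Qed.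

Let bI u v : bmeas (fun w => \1_(`]u, v]%classic) (Z w) : R).
Proof. exact: (bmeas_indic (mZi u v)). Qed.

Let EI u v : \int[P]_w \1_(`]u, v]%classic) (Z w) = p u v.
Proof. exact: (ER_indic P (mZi u v)). Qed.

Lemma step_mean (I : Type) (s : seq I) (l u v : I -> R) :
  \int[P]_w step_comb s l u v (Z w) = \sum_(i <- s) l i * p (u i) (v i).
Proof.
rewrite /step_comb ER_sum; last by move=> i; apply: bmeasZ; exact: bI.
by apply: eq_bigr => i _; rewrite ERZ ?EI.
Qed.

(** Polarization: the square of the difference of the two indicators is the indicator of the
    interval between [x] and [y]. It gives covariances the shape of [cov_fun], so that only
    variances of indicators of intervals have to be computed. *)
Lemma indic_ioc_cross (x y z : R) : 0 <= x -> 0 <= y ->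
  \1_(`]0, x]%classic) z * \1_(`]0, y]%classic) z =
  (\1_(`]0, x]%classic) z + \1_(`]0, y]%classic) z - \1_(`]Num.min x y, Num.max x y]%classic) z) / 2 :> R.
Proof.
move=> x0 y0.
have E u v : \1_(`]u, v]%classic) z = ((u < z) && (z <= v))%R%:R :> R.
  rewrite indicE; congr (_%:R); congr nat_of_bool; apply/idP/idP => [/set_mem|h]; first by rewrite /= in_itv.
  by apply/mem_set; rewrite /= in_itv.
wlog xy : x y x0 y0 / x <= y => [H|].
  case/orP: (le_total x y) => xy; first exact: H.
  by rewrite mulrC H// minC maxC; lra.
rewrite min_l// max_r// !E.
have [z0|z0] := leP z 0.
  by rewrite /= (_ : x < z = false) /=; [lra | apply/negbTE; rewrite -leNgt (le_trans z0)].
have [zx|xz] := leP z x.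
  by rewrite (le_trans zx xy) /=; lra.
by case: (z <= y); rewrite /=; lra.
Qed.

Lemma p_diff (x y : R) : 0 <= x -> 0 <= y -> p (Num.min x y) (Num.max x y) ^+ 2 = (p 0 x - p 0 y) ^+ 2.
Proof.
wlog xy : x y / x <= y => [H x0 y0|].
  case/orP: (le_total x y) => xy; first exact: H.
  by rewrite minC maxC H// -sqrrN opprB.
move=> x0 y0; rewrite min_l// max_r//.
suff -> : p x y = p 0 y - p 0 x by rewrite -sqrrN opprB.
rewrite -!EI -ERB//; apply: eq_ER => w.
have := @indic_ioc_cross x y (Z w) x0 y0; rewrite min_l// max_r//.
rewrite !indicE; have E u v : (Z w \in `]u, v]%classic) = ((u < Z w) && (Z w <= v)).
  by apply/idP/idP => [/set_mem|h]; [rewrite /= in_itv | apply/mem_set; rewrite /= in_itv].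
rewrite !E; have [Zx|xZ] := leP (Z w) x; first by rewrite (le_trans Zx xy) !andbT /=; case: (0 < Z w) => /=; lra.
by rewrite (le_lt_trans x0 xZ) /=; case: (Z w <= y) => /=; lra.
Qed.

Lemma step_variance (I : Type) (s : seq I) (l v : I -> R) : (forall i, 0 <= v i) ->
  \int[P]_w (step_comb s l (fun=> 0) v (Z w) - \int[P]_w step_comb s l (fun=> 0) v (Z w)) ^+ 2 =
  \sum_(i <- s) \sum_(j <- s) l i * l j *
    ((q 0 (v i) + q 0 (v j) - q (Num.min (v i) (v j)) (Num.max (v i) (v j))) / 2).
Proof.
move=> v0; set m := \int[P]_w step_comb _ _ _ _ _.
have bh : bmeas (fun w => step_comb s l (fun=> 0) v (Z w)).
  by rewrite /step_comb; apply: bmeas_sum => i; apply: bmeasZ; exact: bI.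
have -> : \int[P]_w (step_comb s l (fun=> 0) v (Z w) - m) ^+ 2 =
    \int[P]_w (step_comb s l (fun=> 0) v (Z w) * step_comb s l (fun=> 0) v (Z w)) - m * m.
  rewrite (@eq_ER _ _ _ P _ (fun w => step_comb s l (fun=> 0) v (Z w) * step_comb s l (fun=> 0) v (Z w)
     + ((- 2 * m) * step_comb s l (fun=> 0) v (Z w) + m * m))); last by move=> w; ring.
  have bz : bmeas (fun w => - 2 * m * step_comb s l (fun=> 0) v (Z w)) by exact: bmeasZ.
  rewrite ERD; [|exact: bmeasM|by apply: bmeasD => //; exact: bmeas_cst].
  rewrite ERD//; last exact: bmeas_cst.
  by rewrite ERZ// ER_cst -/m; ring.
have -> : \int[P]_w (step_comb s l (fun=> 0) v (Z w) * step_comb s l (fun=> 0) v (Z w)) =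
    \sum_(i <- s) \sum_(j <- s) l i * l j * ((p 0 (v i) + p 0 (v j) - p (Num.min (v i) (v j)) (Num.max (v i) (v j))) / 2).
  have bc i j : bmeas (fun w => (\1_(`]0, v i]%classic) (Z w) + \1_(`]0, v j]%classic) (Z w) -
        \1_(`]Num.min (v i) (v j), Num.max (v i) (v j)]%classic) (Z w)) : R).
    by apply: bmeasB => //; exact: bmeasD.
  rewrite (@eq_ER _ _ _ P _ (fun w => \sum_(i <- s) \sum_(j <- s) (l i * l j / 2) *
     (\1_(`]0, v i]%classic) (Z w) + \1_(`]0, v j]%classic) (Z w) - \1_(`]Num.min (v i) (v j), Num.max (v i) (v j)]%classic) (Z w)))).
    rewrite ER_sum; last by move=> i; apply: bmeas_sum => j; exact: bmeasZ.
    apply: eq_bigr => i _; rewrite ER_sum; last by move=> j; exact: bmeasZ.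
    apply: eq_bigr => j _; rewrite ERZ// ERB//; last exact: bmeasD.
    by rewrite ERD// !EI; field.
  move=> w; rewrite {1}/step_comb mulr_suml; apply: eq_bigr => i _.
  rewrite /step_comb mulr_sumr; apply: eq_bigr => j _.
  by have := indic_ioc_cross (Z w) (v0 i) (v0 j) => h; rewrite mulrACA h; field.
have -> : m * m = \sum_(i <- s) \sum_(j <- s) l i * l j * (p 0 (v i) * p 0 (v j)).
  rewrite /m step_mean mulr_suml; apply: eq_bigr => i _; rewrite mulr_sumr; apply: eq_bigr => j _.
  by rewrite mulrACA.
rewrite -sumrB; apply: eq_bigr => i _; rewrite -sumrB; apply: eq_bigr => j _.
by rewrite /q (p_diff (v0 i) (v0 j)); field.
Qed.

End StepMoments.

(** * Characteristic function of a difference of independent variables *)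

Section IndependentDifference.
Context {R : realType} {d : measure_display} {T : measurableType d} (P : probability T R).
Context (V V' : T -> R) (mV : measurable_fun setT V) (mV' : measurable_fun setT V').
Hypothesis ind : forall A B : set R, measurable A -> measurable B ->
  Pr P (V @^-1` A `&` V' @^-1` B) = Pr P (V @^-1` A) * Pr P (V' @^-1` B).

(** [f] is replaced by [fn], its value rounded down to a multiple of [1 / n.+1], which is a finite
    combination of indicators and differs from [f] by at most [1 / n.+1]. Used twice, it passes from
    product events to products of two bounded functions. *)
Lemma ER_mul_of_indic (W U : T -> R) (kappa : R) (f : R -> R) : bmeas W -> measurable_fun setT U ->
  (forall B : set R, measurable B -> \int[P]_w (W w * \1_B (U w)) = kappa * Pr P (U @^-1` B)) ->
  measurable_fun setT f -> (exists M : R, forall x, `|f x| <= M) ->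
  \int[P]_w (W w * f (U w)) = kappa * \int[P]_w f (U w).
Proof.
move=> bW mU H mf [M fM]; have [mW [MW WM]] := bW.
have M0 : 0 <= M by apply: le_trans (fM 0).
have MW0 : 0 <= MW by apply: le_trans (WM point).
have bf : bmeas (fun w => f (U w)) by apply: bmeas_comp => //; exists M.
apply/eqP; rewrite -subr_eq0 -normr_le0; apply/ler_addgt0Pr => e e0; rewrite add0r.
pose n := (Num.truncn ((MW + `|kappa|) / e)).+1.
have n1 : 0 < n.+1%:R :> R by rewrite ltr0n.
have nb : (MW + `|kappa|) / n.+1%:R <= e.
  rewrite ler_pdivrMr// mulrC -ler_pdivrMr//; apply: ltW; apply: lt_trans (truncnS_gt _) _.
  by rewrite ltr_nat.
pose N := (Num.truncn (n.+1%:R * (2 * M))).+1.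
pose cell k : set R := `[k%:R / n.+1%:R, k.+1%:R / n.+1%:R[%classic.
pose B k : set R := (fun x => f x + M) @^-1` cell k.
have mB k : measurable (B k).
  by rewrite -[X in measurable X]setTI; apply: (measurable_funD mf (measurable_cst _)) => //; exact: measurable_itv.
pose fn x : R := \sum_(k < N) \1_(B k) x * (k%:R / n.+1%:R) - M.
have fnE x : `|f x - fn x| <= n.+1%:R^-1.
  have x0 : 0 <= f x + M by have := fM x; rewrite ler_norml => /andP[]; lra.
  have x2 : f x + M <= 2 * M by have := fM x; rewrite ler_norml => /andP[]; lra.
  have := @sum_cells R n N (f x + M) (fun k => k%:R / n.+1%:R).
  have tN : (Num.truncn (n.+1%:R * (f x + M)) < N)%N.
    by rewrite ltnS le_truncn// ler_pM2l.
  rewrite x0 tN /= => S; rewrite /fn.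
  have -> : \sum_(k < N) \1_(B k) x * (k%:R / n.+1%:R) = (Num.truncn (n.+1%:R * (f x + M)))%:R / n.+1%:R :> R.
    by rewrite -S; apply: eq_bigr => k _; congr (_ * _); rewrite !indicE.
  have /andP[t1 t2] := @truncn_itv R (n.+1%:R * (f x + M)) (mulr_ge0 (ltW n1) x0).
  set tr := (Num.truncn _)%:R in t1 *.
  rewrite -[(Num.truncn _).+1%:R]natr1 -/tr in t2.
  rewrite ger0_norm.
    by rewrite (_ : f x - _ = (n.+1%:R * (f x + M) - tr) / n.+1%:R); [rewrite ler_pdivrMr// mulVf ?gt_eqF//; lra | field; rewrite gt_eqF].
  rewrite (_ : f x - _ = (n.+1%:R * (f x + M) - tr) / n.+1%:R); first by rewrite divr_ge0 ?(ltW n1)//; lra.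
  by field; rewrite gt_eqF.
have bBU k : bmeas (fun w => \1_(B k) (U w) : R).
  by apply: (bmeas_indic (A := U @^-1` B k)); rewrite -[X in measurable X]setTI; exact: mU.
have bfn : bmeas (fun w => fn (U w)).
  by apply: bmeasB; [apply: bmeas_sum => k; apply: bmeasM => //; exact: bmeas_cst | exact: bmeas_cst].
have kW : \int[P]_w W w = kappa.
  have := H setT measurableT; rewrite preimage_setT PrT mulr1 => <-.
  by apply: eq_ER => w; rewrite indicT mulr1.
have En : \int[P]_w (W w * fn (U w)) = kappa * \int[P]_w fn (U w).
  rewrite (@eq_ER _ _ _ P _ (fun w => \sum_(k < N) (k%:R / n.+1%:R) * (W w * \1_(B k) (U w)) - M * W w)); last first.
    by move=> w; rewrite /fn mulrBr mulr_sumr (mulrC M); congr (_ - _); apply: eq_bigr => k _; ring.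
  have bWB k : bmeas (fun w => W w * \1_(B k) (U w)) by exact: bmeasM.
  have bWB' k : bmeas (fun w => (k%:R / n.+1%:R) * (W w * \1_(B k) (U w))) by exact: bmeasZ.
  rewrite ERB; [|by apply: bmeas_sum|exact: bmeasZ].
  rewrite ER_sum// ERZ// kW /fn ERB; [|by apply: bmeas_sum => k; apply: bmeasM => //; exact: bmeas_cst|exact: bmeas_cst].
  rewrite ER_cst mulrBr (mulrC M); congr (_ - _).
  rewrite ER_sum; last by move=> k; apply: bmeasM => //; exact: bmeas_cst.
  rewrite mulr_sumr; apply: eq_bigr => k _; rewrite ERZ// H//.
  rewrite (@eq_ER _ _ _ P (fun w => \1_(B k) (U w) * _) (fun w => (k%:R / n.+1%:R) * \1_(U @^-1` B k) w)).
    have mUB : measurable (U @^-1` B k) by rewrite -[X in measurable X]setTI; exact: mU.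
    by rewrite ERZ ?ER_indic//; [ring | exact: bmeas_indic].
  by move=> w; rewrite mulrC; congr (_ * _); rewrite !indicE.
rewrite (_ : _ - _ = \int[P]_w (W w * (f (U w) - fn (U w))) - kappa * \int[P]_w (f (U w) - fn (U w))); last first.
  have -> : \int[P]_w (W w * (f (U w) - fn (U w))) = \int[P]_w (W w * f (U w)) - kappa * \int[P]_w fn (U w).
    rewrite -En -ERB; [|exact: bmeasM|exact: bmeasM].
    by apply: eq_ER => w; ring.
  by rewrite ERB//; ring.
have bd : bmeas (fun w => f (U w) - fn (U w)) by exact: bmeasB.
have n1' : 0 <= n.+1%:R^-1 :> R by rewrite invr_ge0 ltW.
apply: le_trans nb; rewrite mulrDl; apply: (le_trans (ler_normB _ _)); apply: lerD.
  apply: (le_trans (ER_norm P (bmeasM bW bd))); rewrite -[leRHS](ER_cst P).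
  apply: ER_le; [by apply: bmeas_norm; exact: bmeasM|exact: bmeas_cst|] => w.
  by rewrite normrM ler_pM.
rewrite normrM ler_wpM2l//; apply: (le_trans (ER_norm P bd)); rewrite -[leRHS](ER_cst P).
by apply: ER_le; [exact: bmeas_norm|exact: bmeas_cst|] => w.
Qed.

Lemma indep_ER_mul (f g : R -> R) : measurable_fun setT f -> measurable_fun setT g ->
  (exists M : R, forall x, `|f x| <= M) -> (exists M : R, forall x, `|g x| <= M) ->
  \int[P]_w (f (V w) * g (V' w)) = \int[P]_w f (V w) * \int[P]_w g (V' w).
Proof.
move=> mf mg bf bg.
have mVi (A : set R) : measurable A -> measurable (V @^-1` A) by move=> mA; rewrite -[X in measurable X]setTI; exact: mV.
have mVi' (A : set R) : measurable A -> measurable (V' @^-1` A) by move=> mA; rewrite -[X in measurable X]setTI; exact: mV'.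
apply: ER_mul_of_indic => //; first exact: bmeas_comp.
move=> B mB.
rewrite (@eq_ER _ _ _ P _ (fun w => \1_(V' @^-1` B) w * f (V w))); last by move=> w; rewrite mulrC !indicE.
rewrite (@ER_mul_of_indic (\1_(V' @^-1` B)) V (Pr P (V' @^-1` B)))//; first by rewrite mulrC.
  by apply: bmeas_indic; exact: mVi'.
move=> A mA; rewrite (mulrC (Pr P _)) -ind// -ER_indic; last by apply: measurableI; [exact: mVi | exact: mVi'].
by apply: eq_ER => w; rewrite indicI mulrC !indicE.
Qed.

Lemma indep_cos_diff th : \int[P]_w cos (th * (V w - V' w)) =
  \int[P]_w cos (th * V w) * \int[P]_w cos (th * V' w) + \int[P]_w sin (th * V w) * \int[P]_w sin (th * V' w).
Proof.
have mc : measurable_fun setT (fun x : R => cos (th * x)).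
  by apply: measurableT_comp; [apply: continuous_measurable_fun; exact: continuous_cos | exact: measurable_funM].
have ms : measurable_fun setT (fun x : R => sin (th * x)).
  by apply: measurableT_comp; [apply: continuous_measurable_fun; exact: continuous_sin | exact: measurable_funM].
have bc : exists M : R, forall x, `|cos (th * x)| <= M by exists 1 => x; exact: cos_max.
have bs : exists M : R, forall x, `|sin (th * x)| <= M by exists 1 => x; exact: sin_max.
have <- : \int[P]_w (cos (th * V w) * cos (th * V' w)) = \int[P]_w cos (th * V w) * \int[P]_w cos (th * V' w).
  exact: (indep_ER_mul mc mc bc bc).
have <- : \int[P]_w (sin (th * V w) * sin (th * V' w)) = \int[P]_w sin (th * V w) * \int[P]_w sin (th * V' w).
  exact: (indep_ER_mul ms ms bs bs).
have bcV (W : T -> R) : measurable_fun setT W -> bmeas (fun w => cos (th * W w)).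
  by move=> mW; exact: (bmeas_comp mc bc mW).
have bsV (W : T -> R) : measurable_fun setT W -> bmeas (fun w => sin (th * W w)).
  by move=> mW; exact: (bmeas_comp ms bs mW).
rewrite -ERD; [|by apply: bmeasM; exact: bcV|by apply: bmeasM; exact: bsV].
by apply: eq_ER => w; rewrite mulrBr cosB.
Qed.

End IndependentDifference.

(** * Finite-dimensional limits *)

Section FiniteDimensional.
Context {R : realType} {d : measure_display} {T : measurableType d} (P : probability T R).
Context (a : R) (a0 : 0 < a).
Context (Y : int -> T -> R) (mY : forall j, measurable_fun setT (Y j)) (eps : T -> R).
Hypothesis epsU : uniform01 P eps.
Hypothesis indY : forall (B : set R) (s : seq int), measurable B -> uniq s ->
  indep_with P Y (eps @^-1` B) s.
Hypothesis lawY : forall j u v, Pr P (Y j @^-1` `]u, v]%classic) = Pr P (Y 0 @^-1` `]u, v]%classic).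
Context (tau sq : R) (fv : R -> R).
Hypothesis sq0 : 0 < sq.
Hypothesis sqE : sq ^+ 2 = tau.
Hypothesis fvE : forall s, 0 <= s -> (\int[P]_w Num.min (s * tau) `|Y 0 w - Y 1 w|) / a = tau * fv s.

Lemma EE_shift (qs : seq (seq (R * R))) (Psi : R -> R) x y :
  EE qs (fun z => Psi (x + z)) y = EE qs Psi (x + y).
Proof.
elim: qs y => [|q qs IH] y //=; apply: eq_bigr => pc _.
by rewrite IH addrA.
Qed.

Lemma expR_lip (x y : R) : -1 <= x -> -1 <= y -> `|expR (- x) - expR (- y)| <= expR 1 * `|x - y|.
Proof.
wlog xy : x y / x <= y => [H x1 y1|x1 _].
  case/orP: (le_total x y) => xy; first exact: H.
  by rewrite distrC (distrC x) H.
have e1 : expR (- y) <= expR (- x) by rewrite ler_expR lerN2.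
rewrite ger0_norm ?subr_ge0// distrC ger0_norm ?subr_ge0//.
have -> : expR (- x) - expR (- y) = expR (- x) * (1 - expR (- (y - x))).
  by rewrite mulrBr mulr1 -expRD; congr (_ - expR _); ring.
apply: ler_pM; rewrite ?expR_ge0//.
- by rewrite subr_ge0 -[leRHS]expR0 ler_expR; lra.
- by rewrite ler_expR; lra.
- by have := expR_ge1Dx (- (y - x)); lra.
Qed.

Lemma cos_lip (x y : R) : `|cos x - cos y| <= `|x - y|.
Proof.
have E : cos x - cos y = - 2 * (sin ((x + y) / 2) * sin ((x - y) / 2)).
  have ex : cos x = cos ((x + y) / 2 + (x - y) / 2) by congr cos; field.
  have ey : cos y = cos ((x + y) / 2 - (x - y) / 2) by congr cos; field.
  by rewrite ex ey cosD cosB; ring.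
have s1 (z : R) : `|sin z| <= `|z|.
  wlog z0 : z / 0 <= z => [H|].
    case/orP: (le_total 0 z) => h; first exact: H.
    by rewrite -normrN -sinN -[`|z|]normrN H// oppr_ge0.
  have [z1|z1] := leP z 1; last first.
    by apply: (le_trans (sin_max _)); rewrite ger0_norm// ltW.
  rewrite !ger0_norm ?sin_le_id//.
  have := sin_ge_cubic z0; have : z ^+ 3 <= z; last lra.
  by rewrite exprS ler_piMr// exprn_ile1.
have -> : cos x - cos y = - (2 * (sin ((x + y) / 2) * sin ((x - y) / 2))) by rewrite E; ring.
rewrite normrN 2!normrM (ger0_norm (ler0n R 2)).
have h := s1 ((x - y) / 2).
have -> : `|x - y| = 2 * (1 * `|(x - y) / 2|) by rewrite normrM mul1r normfV (ger0_norm (ler0n R 2)); field.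
by rewrite ler_pM2l//; apply: ler_pM => //; exact: sin_max.
Qed.

(** In these lists the first component is a weight and the second one a time. *)
Definition sum_abs (ls : seq (R * R)) : R := \sum_(k <- ls) `|k.1|.

Definition gauss_var (ls : seq (R * R)) : R :=
  \sum_(k <- ls) \sum_(k' <- ls) k.1 * k'.1 * ((fv k.2 + fv k'.2 - fv `|k.2 - k'.2|) / 2).

Definition normalized_count (s : R) (w : T) : R := (count_ioc a Y eps 0 (s * tau) w - s * tau / a) / sq.

Let tau0 : 0 < tau. Proof. by rewrite -sqE exprn_gt0. Qed.

Lemma uniform_eventually (J : eqType) (A : J -> nat -> Prop) (L : seq J) :
  (forall i, exists m0, forall m, (m0 <= m)%N -> A i m) ->
  exists m0, forall m, (m0 <= m)%N -> forall i, i \in L -> A i m.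
Proof.
move=> H; elim: L => [|i L [m1 H1]]; first by exists 0%N.
have [m2 H2] := H i; exists (maxn m1 m2) => m; rewrite geq_max => /andP[mm1 mm2] k.
by rewrite in_cons => /orP[/eqP->|kL]; [exact: H2 | exact: H1].
Qed.

Lemma sum_dist (I : eqType) (s : seq I) (c F F' : I -> R) (K : R) :
  (forall i, i \in s -> `|F i - F' i| <= K) ->
  `|\sum_(i <- s) c i * F i - \sum_(i <- s) c i * F' i| <= (\sum_(i <- s) `|c i|) * K.
Proof.
move=> H; rewrite -sumrB mulr_suml; apply: (le_trans (ler_norm_sum _ _ _)).
rewrite big_seq [leRHS]big_seq; apply: ler_sum => i si.
by rewrite -mulrBr normrM ler_wpM2l// H.
Qed.

Lemma dist_half_polar (x y z x' y' z' : R) : `|x - x'| <= 4 -> `|y - y'| <= 4 -> `|z - z'| <= 4 ->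
  `|(x + y - z) / 2 - (x' + y' - z') / 2| <= 6.
Proof.
by rewrite !ler_norml => /andP[? ?] /andP[? ?] /andP[? ?]; apply/andP; split; lra.
Qed.

Lemma fdd_frozen (ls : seq (R * R)) (x0 : R) : (forall k, k \in ls -> 0 <= k.2) ->
  let La := sum_abs ls in 2 * La / sq <= 1 -> 6 * La ^+ 2 / tau <= 1 ->
  `|\int[P]_w cos (x0 + \sum_(k <- ls) k.1 * normalized_count k.2 w) - cos x0 * expR (- (gauss_var ls / 2))|
    <= 6 * La / sq * (`|gauss_var ls| + 1) + 2 * La / sq + expR 1 * (6 * La ^+ 2 / tau).
Proof.
move=> ls0 La h1 h2.
(* The absolute value makes [v] nonnegative at every pair, not only at members of [ls], where it
   changes nothing. *)
pose l (k : R * R) := k.1 / sq; pose v (k : R * R) := `|k.2| * tau.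
have v0 k : 0 <= v k by rewrite mulr_ge0// ltW.
have [bs hrep] := @step_rep_sum R _ ls l (fun i => `]0, v i]%classic) (fun i => measurable_itv _).
set K := \sum_(i <- ls) `|l i| in hrep.
have La0 : 0 <= La by apply: sumr_ge0.
have KE : K = La / sq.
  by rewrite /K /La /sum_abs mulr_suml; apply: eq_bigr => k _; rewrite normrM normfV (gtr0_norm sq0).
have K0 : 0 <= K by rewrite KE divr_ge0// ltW.
have K2E : K * K = La ^+ 2 / tau by rewrite KE -sqE; field; rewrite gt_eqF.
(* The centering is moved into the phase, which leaves a pure linear combination of counts. *)
pose x1 := x0 - \sum_(k <- ls) l k * (v k / a).
have xE w : cos (x0 + \sum_(k <- ls) k.1 * normalized_count k.2 w) =
    cos (x1 + \sum_(k <- ls) l k * count_ioc a Y eps 0 (v k) w).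
  congr cos; rewrite /x1 -addrA; congr (_ + _); rewrite addrC -sumrB big_seq [RHS]big_seq.
  apply: eq_bigr => k kl; rewrite /normalized_count /l /v ger0_norm ?ls0//.
  by ring.
rewrite (eq_ER _ xE); set E := 6 * La / sq * _ + _ + _.
set c0 := cos x0 * _.
have mPsi : measurable_fun setT (fun z : R => cos (x1 + z)).
  by apply: measurableT_comp; [apply: continuous_measurable_fun; exact: continuous_cos | exact: measurable_funD].
have bPsi : exists M : R, forall z, `|cos (x1 + z)| <= M by exists 1 => z; exact: cos_max.
suff : c0 - E <= \int[P]_w cos (x1 + \sum_(k <- ls) l k * count_ioc a Y eps 0 (v k) w) <= c0 + E.
  by rewrite ler_norml => /andP[? ?]; apply/andP; split; lra.
apply: (@transfer_count _ _ _ P a a0 Y mY eps epsU indY lawY _ ls l (fun=> 0) v (fun z => cos (x1 + z))) => //.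
have [m1 H1] := @uniform_eventually (R * R)%type (fun k m => forall e, 0 <= e <= 2 ->
    `|\sum_(j <- int_window m) site_prob P a Y e 0 (v k) j - v k / a| <= 2) ls
    (fun k => let: ex_intro m0 h := sum_site_prob a0 mY lawY (v0 k) in
      ex_intro _ m0 (fun m mm e e02 => eq_ind _ (fun z => `|_ - z / a| <= 2) (h m e mm e02) _ (subr0 _))).
have ind01 := fun A B => @indep_pair _ _ _ P Y eps indY A B.
pose J u w := \int[P]_z Num.min (w - u) `|Y 0 z - Y 1 z| / a.
pose q e u w j := site_prob P a Y e u w j - site_prob P a Y e u w j ^+ 2.
have Hq u w : u <= w -> exists m0, forall m, (m0 <= m)%N -> forall e, 0 <= e <= 2 ->
    `|\sum_(j <- int_window m) q e u w j - J u w| <= 4.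
  move=> uw; have [m0 h] := sum_site_variance a0 mY lawY ind01 uw.
  by exists m0 => m mm e e02; exact: h.
have mv k k' : Num.min (v k) (v k') <= Num.max (v k) (v k') by rewrite ge_min le_max lexx.
have [m2 H2] := @uniform_eventually (R * R)%type (fun k m => forall e, 0 <= e <= 2 ->
    `|\sum_(j <- int_window m) q e 0 (v k) j - J 0 (v k)| <= 4) ls (fun k => Hq _ _ (v0 k)).
have [m3 H3] := @uniform_eventually ((R * R) * (R * R))%type (fun k m => forall e, 0 <= e <= 2 ->
    `|\sum_(j <- int_window m) q e (Num.min (v k.1) (v k.2)) (Num.max (v k.1) (v k.2)) j -
      J (Num.min (v k.1) (v k.2)) (Num.max (v k.1) (v k.2))| <= 4) [seq (k, k') | k <- ls, k' <- ls] (fun k => Hq _ _ (mv k.1 k.2)).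
exists (maxn m1 (maxn m2 m3)) => m; rewrite !geq_max => /and3P[mm1 mm2 mm3].
apply: (@transfer_eps _ _ _ P Y mY eps a a0 epsU indY _ ls l (fun=> 0) v K bs hrep (fun z => cos (x1 + z))) => // e e02.
rewrite EE_shift addr0.
set qs := [seq _ | _ <- _].
pose hj (j : int) (y : R) := step_comb ls l (fun=> 0) v (y + a * (j%:~R - e)).
have hjrep j : step_rep K (hj j) [seq ((fun y => y + a * (j%:~R - e)) @^-1` b.1, b.2) | b <- bs] by exact: (frozen_rep a hrep).
have lawq p : p \in qs -> is_law p.
  by move=> /mapP[j _ ->]; exact: (discrete_law_is_law P mY hjrep).
have devq p pc : p \in qs -> pc \in p -> `|pc.2 - law_mean p| <= 2 * K.
  by move=> /mapP[j _ ->]; exact: (discrete_law_dev mY hjrep).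
have K2 : 0 <= 2 * K <= 1 by rewrite mulr_ge0//= KE mulrA.
have main := EE_cos x1 K2 lawq devq.
set M := \sum_(p <- qs) law_mean p in main.
set V := \sum_(p <- qs) law_variance p in main.
have mZ j : measurable_fun setT (fun w => Y j w + a * (j%:~R - e)) by exact: measurable_funD.
have ME : M = \sum_(k <- ls) l k * \sum_(j <- int_window m) site_prob P a Y e 0 (v k) j.
  rewrite /M big_map; under eq_bigr => j _ do rewrite /frozen_law (discrete_law_mean P mY hjrep) /hj (step_mean P (mZ j)).
  by rewrite exchange_big /=; apply: eq_bigr => k _; rewrite mulr_sumr.
have Mb : `|M - \sum_(k <- ls) l k * (v k / a)| <= K * 2.
  by rewrite ME; apply: sum_dist => k kl; apply: H1.
have V0 : 0 <= V by rewrite /V big_seq; apply: sumr_ge0 => p pq; apply: law_variance_ge0; exact: lawq.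
pose kk := [seq (k, k') | k <- ls, k' <- ls].
have VE : V = \sum_(p <- kk) l p.1 * l p.2 * \sum_(j <- int_window m)
    ((q e 0 (v p.1) j + q e 0 (v p.2) j - q e (Num.min (v p.1) (v p.2)) (Num.max (v p.1) (v p.2)) j) / 2).
  rewrite /V big_map /kk big_allpairs.
  under eq_bigr => j _ do rewrite /frozen_law (discrete_law_variance P mY hjrep) /hj (step_variance P (mZ j) _ _ v0).
  rewrite exchange_big /=; apply: eq_bigr => k _; rewrite exchange_big /=; apply: eq_bigr => k' _.
  by rewrite mulr_sumr.
have gE : gauss_var ls = \sum_(p <- kk) l p.1 * l p.2 *
    ((J 0 (v p.1) + J 0 (v p.2) - J (Num.min (v p.1) (v p.2)) (Num.max (v p.1) (v p.2))) / 2).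
  have JE s s' : 0 <= s -> 0 <= s' -> J (Num.min (s * tau) (s' * tau)) (Num.max (s * tau) (s' * tau)) = tau * fv `|s - s'|.
    move=> s0 s0'; rewrite /J -fvE//; congr (_ / a); apply: eq_ER => w; congr (Num.min _ _).
    case/orP: (le_total s s') => ss; have ss' := ler_wpM2r (ltW tau0) ss.
      by rewrite min_l// max_r// ler0_norm ?subr_le0//; ring.
    by rewrite min_r// max_l// ger0_norm ?subr_ge0//; ring.
  rewrite /kk big_allpairs /gauss_var big_seq [RHS]big_seq; apply: eq_bigr => k kl.
  rewrite big_seq [RHS]big_seq; apply: eq_bigr => k' kl'.
  have [k0 k0'] : 0 <= k.2 /\ 0 <= k'.2 by split; exact: ls0.
  rewrite /= /v (ger0_norm k0) (ger0_norm k0') JE// /J !subr0 !fvE// /l -sqE; field.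
  by rewrite gt_eqF.
have Vb : `|V - gauss_var ls| <= 6 * La ^+ 2 / tau.
  have -> : 6 * La ^+ 2 / tau = (\sum_(p <- kk) `|l p.1 * l p.2|) * 6.
    have -> : \sum_(p <- kk) `|l p.1 * l p.2| = K * K.
      rewrite /kk big_allpairs /= {1}/K mulr_suml; apply: eq_bigr => k _.
      rewrite /K mulr_sumr; apply: eq_bigr => k' _; exact: normrM.
    transitivity (La ^+ 2 / tau * 6); first by ring.
    by congr (_ * _); exact: esym K2E.
  rewrite VE gE; apply: sum_dist => -[k k'] kl /=.
  have [kl1 kl2] : k \in ls /\ k' \in ls by move: kl => /allpairsP[[x y] [xl yl [-> ->]]].
  rewrite -mulr_suml sumrB big_split /=.
  exact: (dist_half_polar (H2 m mm2 k kl1 e e02) (H2 m mm2 k' kl2 e e02) (H3 m mm3 (k, k') kl e e02)).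
have Vg : V <= `|gauss_var ls| + 1.
  have := ler_norm (gauss_var ls); have := ler_norm (V - gauss_var ls); lra.
have e1 : expR (- V / 2) <= 1 by rewrite -[leRHS]expR0 ler_expR; lra.
have b1 : `|EE qs cos x1 - cos (x1 + M) * expR (- V / 2)| <= 6 * La / sq * (`|gauss_var ls| + 1).
  apply: (le_trans main); rewrite (_ : 3 * _ = 6 * La / sq); last by rewrite KE; ring.
  by rewrite ler_wpM2l// divr_ge0 ?(ltW sq0)// mulr_ge0.
have b2 : `|cos (x1 + M) * expR (- V / 2) - cos x0 * expR (- V / 2)| <= 2 * La / sq.
  rewrite -mulrBl normrM (ger0_norm (expR_ge0 _)) -[leRHS]mulr1; apply: ler_pM => //.
  apply: (le_trans (cos_lip _ _)); rewrite (_ : x1 + M - x0 = M - \sum_(k <- ls) l k * (v k / a)).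
    by apply: (le_trans Mb); rewrite KE le_eqVlt; apply/orP; left; apply/eqP; ring.
  by rewrite /x1; ring.
have b3 : `|cos x0 * expR (- V / 2) - c0| <= expR 1 * (6 * La ^+ 2 / tau).
  rewrite /c0 -mulrBr normrM -[leRHS]mul1r; apply: ler_pM => //; first exact: cos_max.
  rewrite (_ : - V / 2 = - (V / 2)); last by ring.
  have [V1 g1] : -1 <= V / 2 /\ -1 <= gauss_var ls / 2.
    clear -V0 Vb h2; move: Vb; rewrite ler_norml => /andP[? ?]; split; lra.
  apply: (le_trans (expR_lip V1 g1)).
  rewrite ler_pM2l ?expR_gt0// -mulrBl normrM normfV (ger0_norm (ler0n R 2)).
  by rewrite ler_pdivrMr// (le_trans Vb)// ler_peMr//; [apply: (le_trans (normr_ge0 _) Vb)|lra].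
move: b1 b2 b3; rewrite /E; clear; rewrite !ler_norml => /andP[? ?] /andP[? ?] /andP[? ?]; apply/andP; split; lra.
Qed.

End FiniteDimensional.

Lemma big_mkseq (V : nmodType) (I : Type) (h : nat -> I) (m : nat) (F : I -> V) :
  \sum_(p <- mkseq h m) F p = \sum_(i < m) F (h i).
Proof. by rewrite big_map -(big_mkord xpredT (fun i => F (h i))) /index_iota subn0. Qed.

(** * Scaling of the stable model and its Gaussian limit *)

Section Model.
Context {R : realType} (alpha c a : R) {d : measure_display} {T : measurableType d} (P : probability T R).
Context (X : int -> R -> T -> R) (eps : T -> R).
Hypothesis alpha0 : 0 < alpha.
Hypothesis a0 : 0 < a.
Hypothesis stableX : forall j, sym_stable_process P alpha c (X j).
Hypothesis epsU : uniform01 P eps.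
Hypothesis indX : mutually_independent P (fun i : option int =>
    match i with None => preimage_events eps | Some j => process_events (X j) end).

Lemma measurable_position t j : 0 <= t -> measurable_fun setT (X j t).
Proof. by case: (stableX j) => -[mX _ _ _ _] _; exact: mX. Qed.

Lemma position_indep t (B : set R) (s : seq int) : 0 <= t -> measurable B -> uniq s ->
  indep_with P (fun j => X j t) (eps @^-1` B) s.
Proof.
move=> t0 mB us C mC.
have uJ : uniq (None :: map Some s).
  rewrite /= map_inj_uniq ?us ?andbT; last by move=> x y [].
  by apply/negP => /mapP[].
pose A (i : option int) := match i with None => eps @^-1` B | Some j => X j t @^-1` C j end.
have HA i : i \in None :: map Some s ->
    match i with None => preimage_events eps | Some j => process_events (X j) end (A i).
  move=> _; case: i => [j|] /=; last by exists B.
  apply: sub_sigma_algebra; exists t; split => //; by exists (C j).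
have := indX uJ HA; rewrite big_cons big_map /= => H; rewrite -[RHS]H; congr (fine (P _)).
apply/seteqP; split => w /=.
  move=> [Bw h] i /=; rewrite in_cons => /orP[/eqP-> //|/mapP[j js ->]]; exact: h.
move=> h; split; first by have := h None; rewrite /= mem_head; apply.
by move=> j js; have := h (Some j); rewrite /= in_cons mem_map ?js ?orbT; [apply | move=> x y []].
Qed.

Lemma position_law t j u v : 0 <= t ->
  Pr P (X j t @^-1` `]u, v]%classic) = Pr P (X 0 t @^-1` `]u, v]%classic).
Proof.
move=> t0; apply: same_cf_itv; try exact: measurable_position.
- by move=> th; have [_ /(_ t th t0)[-> _]] := stableX j; have [_ /(_ t th t0)[-> _]] := stableX 0.
- by move=> th; have [_ /(_ t th t0)[_ ->]] := stableX j; have [_ /(_ t th t0)[_ ->]] := stableX 0.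
Qed.

Let tau t := t `^ alpha^-1.
Let sq t := t `^ (2 * alpha)^-1.

Lemma scale_gt0 t : 0 < t -> 0 < sq t. Proof. by move=> t0; exact: powR_gt0. Qed.

Lemma sqr_scale t : sq t ^+ 2 = tau t.
Proof.
rewrite /sq /tau -powR_mulrn ?powR_ge0// -powRrM; congr (_ `^ _).
by field; rewrite gt_eqF.
Qed.

Lemma spatial_scale_powR t : 0 < t -> tau t `^ alpha = t.
Proof. by move=> t0; rewrite /tau -powRrM mulVf ?gt_eqF// powRr1// ltW. Qed.

(** Self-similarity: as [tau t ^ alpha = t], the difference of two particles divided by [tau t] has
    a characteristic function free of [t], to which [f_funE] applies. *)
Lemma mean_min_position t s : 0 < t -> 0 <= s ->
  (\int[P]_w Num.min (s * tau t) `|X 0 t w - X 1 t w|) / a = tau t * f_fun alpha c a s.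
Proof.
move=> t0; rewrite le_eqVlt => /orP[/eqP<-|s0].
  rewrite /f_fun eqxx mulr0 mul0r (@eq_ER _ _ _ P _ (fun=> 0)) ?ER_cst ?mul0r// => w.
  by rewrite min_l.
have ta0 : 0 < tau t by exact: powR_gt0.
pose D w := (X 0 t w - X 1 t w) / tau t.
have mX j : measurable_fun setT (X j t) by exact: measurable_position (ltW t0).
have mD : measurable_fun setT D by apply: measurable_funM => //; exact: measurable_funB.
have cfD th : 0 <= th -> \int[P]_w cos (th * D w) = expR (- (2 * c * th `^ alpha)).
  move=> th0; pose k := th / tau t.
  rewrite (@eq_ER _ _ _ P _ (fun w => cos (k * (X 0 t w - X 1 t w)))); last first.
    by move=> w; rewrite /D /k; congr cos; ring.
  rewrite indep_cos_diff//; last first.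
    move=> A B mA mB; exact: (indep_pair (fun B s mB us => position_indep (ltW t0) mB us)).
  have [_ /(_ t k (ltW t0))[-> ->]] := stableX 0; have [_ /(_ t k (ltW t0))[-> ->]] := stableX 1.
  rewrite mulr0 addr0 -expRD; congr expR.
  have -> : t * c * `|k| `^ alpha = c * th `^ alpha; last by ring.
  rewrite /k ger0_norm; last by rewrite divr_ge0// ltW.
  rewrite powRM// ?invr_ge0 ?(ltW ta0)// -(powR_inv1 (ltW ta0)) -powRrM mulrC.
  rewrite (_ : -1 * alpha = alpha * -1); last by ring.
  rewrite powRrM spatial_scale_powR// powR_inv1 ?ltW//.
  by field; rewrite gt_eqF.
have := f_funE mD cfD a0 s0 => /(congr1 (fun z => tau t * z / a)).
rewrite (_ : tau t * (a * _) / a = tau t * f_fun alpha c a s); last by field; rewrite gt_eqF.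
move=> ->; congr (_ / a); rewrite -ERZ; last first.
  split; first by apply: measurable_minr => //; exact: measurableT_comp.
  exists s => w; rewrite ger0_norm; first by rewrite ge_min lexx.
  by rewrite le_min (ltW s0) normr_ge0.
apply: eq_ER => w; rewrite minr_pMr ?(ltW ta0)// mulrC; congr Num.min.
by rewrite /D normrM normfV (gtr0_norm ta0) mulrC divfK// gt_eqF.
Qed.

Lemma powR_cvgy (p : R) : 0 < p -> (fun t : R => t `^ p) @ +oo --> +oo.
Proof.
move=> p0; apply/cvgryPge => A.
have B0 : 0 <= `|A| `^ p^-1 by exact: powR_ge0.
near=> t; apply: (@le_trans _ _ ((`|A| `^ p^-1) `^ p)).
  by rewrite -powRrM mulVf ?gt_eqF// powRr1// ler_norm.
have At : `|A| `^ p^-1 <= t by near: t; exact: nbhs_pinfty_ge.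
by apply: ge0_ler_powR; rewrite ?nnegrE ?(ltW p0)// (le_trans B0).
Unshelve. all: end_near. Qed.

Lemma scale_cvgy : sq @ +oo --> +oo.
Proof. by apply: powR_cvgy; rewrite invr_gt0 mulr_gt0. Qed.

(** The value 0 for [t <= 0] makes these variables measurable for every real index, as the
    convergence theorem along [t] requires. *)
Definition scaled_count (s t : R) (w : T) : R :=
  if 0 < t then normalized_count a (fun j => X j t) eps (tau t) (sq t) s w else 0.

Lemma measurable_scaled_count s t : measurable_fun setT (scaled_count s t).
Proof.
rewrite /scaled_count; case: ltP => [t0|]; last by move=> _; exact: measurable_cst.
apply: measurable_funM => //; apply: measurable_funB => //.
apply: (measurable_count_ioc a0 _ epsU).
- by move=> j; exact: measurable_position (ltW t0).
- by move=> B s' mB us; exact: position_indep (ltW t0) mB us.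
- by move=> j u v; exact: position_law (ltW t0).
Qed.

Lemma fdd_cvg (ls : seq (R * R)) (x0 : R) : (forall k, k \in ls -> 0 <= k.2) ->
  \int[P]_w cos (x0 + \sum_(k <- ls) k.1 * scaled_count k.2 t w) @[t --> +oo] -->
  cos x0 * expR (- (gauss_var (f_fun alpha c a) ls / 2)).
Proof.
move=> ls0; set g := gauss_var _ _.
set La := sum_abs ls.
have La0 : 0 <= La by apply: sumr_ge0.
pose C1 := 6 * La * (`|g| + 1) + 2 * La; pose C2 := expR 1 * (6 * La ^+ 2).
have C10 : 0 <= C1 by rewrite /C1 addr_ge0 ?mulr_ge0// addr_ge0.
have C20 : 0 <= C2 by rewrite /C2 !mulr_ge0 ?expR_ge0// sqr_ge0.
apply/cvgrPdist_le => e e0; near=> t.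
have t0 : 0 < t by near: t; exact: nbhs_pinfty_gt.
(* The summands give, in this order, [sq t >= 1], the final error [e], and the two smallness
   conditions of [fdd_frozen]. *)
have st : 1 + (C1 + C2) / e + 2 * La + 6 * La ^+ 2 <= sq t.
  by near: t; apply: (cvgryPge _).1; exact: scale_cvgy.
have s0 := scale_gt0 t0.
have [C0 L2] : 0 <= (C1 + C2) / e /\ 0 <= 6 * La ^+ 2.
  by split; [apply: divr_ge0; [exact: addr_ge0 | exact: ltW] | apply: mulr_ge0 => //; exact: sqr_ge0].
have s1 : 1 <= sq t by lra.
have h1 : 2 * La / sq t <= 1 by rewrite ler_pdivrMr// mul1r; lra.
have h2 : 6 * La ^+ 2 / tau t <= 1.
  rewrite -sqr_scale ler_pdivrMr ?exprn_gt0// mul1r; apply: (@le_trans _ _ (sq t)); first by lra.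
  by rewrite expr2 ler_peMr// ltW.
rewrite distrC; have := @fdd_frozen _ _ _ P a a0 (fun j => X j t) (fun j => measurable_position j (ltW t0)) eps epsU
  (fun B s mB us => position_indep (ltW t0) mB us) (fun j u v => position_law j u v (ltW t0)) (tau t) (sq t)
  (f_fun alpha c a) s0 (sqr_scale t) (fun s s0 => mean_min_position t0 s0) ls x0 ls0 h1 h2.
rewrite /scaled_count t0 => H; apply: (le_trans H).
rewrite -/g -/La -sqr_scale (_ : _ + _ = C1 / sq t + C2 / sq t ^+ 2); last by rewrite /C1 /C2; ring.
apply: (@le_trans _ _ ((C1 + C2) / sq t)).
  rewrite [leRHS]mulrDl lerD2l ler_wpM2l// lef_pV2 ?posrE ?exprn_gt0//.
  by rewrite expr2 ler_peMr// ltW.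
by rewrite ler_pdivrMr// mulrC -ler_pdivrMr//; lra.
Unshelve. all: end_near. Qed.

Definition deviation (u v t : R) (w : T) : R :=
  count_ioc a (fun j => X j t) eps (u * tau t) (v * tau t) w - (v - u) * tau t / a.

(** Since [sq ^ 4 = tau ^ 2], all powers of [t] cancel except in the cut-off [1 / tau t], the scaled
    form of the length 1. *)
Lemma deviation_tail (u v t y : R) : 0 < t -> u <= v -> 0 < y ->
  measurable [set w | y * sq t <= `|deviation u v t w|] /\
  Pr P [set w | y * sq t <= `|deviation u v t w|] <= tail_const a * Num.max (v - u) (tau t)^-1 ^+ 2 / y ^+ 4.
Proof.
move=> t0 uv y0; have ta0 : 0 < tau t by exact: powR_gt0.
have s0 := scale_gt0 t0.
have mX j : measurable_fun setT (X j t) := measurable_position j (ltW t0).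
have iX B s (mB : measurable B) us := @position_indep t B s (ltW t0) mB us.
have lX j u' v' := @position_law t j u' v' (ltW t0).
split.
  apply: measurable_ge_set; apply: measurableT_comp => //; apply: measurable_funB => //.
  exact: (measurable_count_ioc a0 mX epsU iX lX).
have uvt : u * tau t <= v * tau t by rewrite ler_pM2r.
have ys : 0 < y * sq t by exact: mulr_gt0.
have := count_ioc_tail a0 mX epsU iX lX uvt ys; rewrite -mulrBl => H; apply: (le_trans H).
rewrite (_ : Num.max ((v - u) * tau t) 1 = Num.max (v - u) (tau t)^-1 * tau t); last first.
  by rewrite maxr_pMl ?(ltW ta0)// mulVf// gt_eqF.
rewrite le_eqVlt; apply/orP; left; apply/eqP.
rewrite 2!exprMn (_ : sq t ^+ 4 = tau t ^+ 2); last by rewrite -sqr_scale -exprM.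
by field; rewrite !gt_eqF.
Qed.

Lemma scaled_countE s t w : 0 < t -> scaled_count s t w = deviation 0 s t w / sq t.
Proof. by move=> t0; rewrite /scaled_count t0 /deviation mul0r subr0. Qed.

Lemma scaled_count_tight s del : 0 <= s -> 0 < del ->
  exists K : R, \forall t \near +oo, Pr P [set w | K < `|scaled_count s t w|] <= del.
Proof.
move=> s0 d0; pose C := tail_const a * (s + 1) ^+ 2.
have C0 : 0 <= C by rewrite /C mulr_ge0 ?sqr_ge0// /tail_const mulr_ge0 ?expR_ge0.
pose K := 1 + C / del; exists K.
have Cd : 0 <= C / del by rewrite divr_ge0// ltW.
have K1 : 1 <= K by rewrite /K; lra.
have K0 : 0 < K by lra.
near=> t.
have t0 : 0 < t by near: t; exact: nbhs_pinfty_gt.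
have ta1 : 1 <= tau t by near: t; apply: (cvgryPge _).1; apply: powR_cvgy; rewrite invr_gt0.
have [mK HK] := deviation_tail t0 s0 K0.
apply: (@le_trans _ _ (Pr P [set w | K * sq t <= `|deviation 0 s t w|])).
  apply: Pr_le => //; last first.
    move=> w /=; rewrite scaled_countE// normrM normfV (gtr0_norm (scale_gt0 t0)).
    by rewrite ltr_pdivlMr ?scale_gt0// => /ltW.
  rewrite (_ : [set w | _] = ~` [set w | `|scaled_count s t w| <= K]).
    by apply: measurableC; apply: measurable_le_set; apply: measurableT_comp => //; exact: measurable_scaled_count.
  by apply/seteqP; split => w /=; [rewrite ltNge => /negP | rewrite ltNge => /negP].
apply: (le_trans HK); rewrite subr0.
have m1 : Num.max s (tau t)^-1 <= s + 1.
  by rewrite ge_max lerDl ler01 /= (le_trans (_ : _ <= 1)) ?invf_le1 ?(lt_le_trans ltr01)// lerDr.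
have m0 : 0 <= Num.max s (tau t)^-1 by rewrite le_max s0.
apply: (@le_trans _ _ (C / K)).
  rewrite /C; apply: ler_pM.
  - by rewrite mulr_ge0 ?sqr_ge0// /tail_const mulr_ge0 ?expR_ge0.
  - by rewrite invr_ge0 exprn_ge0 ?(ltW K0).
  - rewrite ler_wpM2l//; first by rewrite /tail_const mulr_ge0 ?expR_ge0.
    by rewrite lerXn2r ?nnegrE ?(le_trans m0).
  - by rewrite lef_pV2 ?posrE ?exprn_gt0// exprS ler_peMr ?(ltW K0)// exprn_ege1.
by rewrite ler_pdivrMr// mulrC -ler_pdivrMr// /K; lra.
Unshelve. all: end_near. Qed.

Section GaussianLimit.
Context {d' : measure_display} {T' : measurableType d'} (P' : probability T' R) (G : R -> T' -> R).
Hypothesis gaussG : centered_gaussian_process P' G (cov_fun alpha c a).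

Lemma gaussian_cos (m : nat) (sig lam : nat -> R) (x0 : R) : (forall i, 0 <= sig i <= 1) ->
  \int[P']_w cos (x0 + \sum_(i < m) lam i * G (sig i) w) =
  cos x0 * expR (- (gauss_var (f_fun alpha c a) (mkseq (fun i => (lam i, sig i)) m) / 2)).
Proof.
move=> sig01; have [mG HG] := gaussG.
have [] := HG (mkseq sig m) (mkseq lam m).
- by rewrite !size_mkseq.
- by apply/allP => s /mapP[i _ ->].
have SE w : \sum_(k < size (mkseq sig m)) (mkseq lam m)`_k * G (mkseq sig m)`_k w = \sum_(i < m) lam i * G (sig i) w.
  by rewrite size_mkseq; apply: eq_bigr => i _; rewrite !nth_mkseq.
have IE (f : R -> R) : \int[P']_w f (\sum_(k < size (mkseq sig m)) (mkseq lam m)`_k * G (mkseq sig m)`_k w) =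
    \int[P']_w f (\sum_(i < m) lam i * G (sig i) w) by apply: eq_ER => w; rewrite SE.
rewrite (IE cos) (IE sin) => Ec Es.
have mS : measurable_fun setT (fun w => \sum_(i < m) lam i * G (sig i) w).
  by apply: measurable_sum => i; apply: measurable_funM => //; exact: mG.
have bc : bmeas (fun w => cos (\sum_(i < m) lam i * G (sig i) w)).
  apply: (bmeas_comp _ _ mS); first by apply: continuous_measurable_fun; exact: continuous_cos.
  by exists 1 => x; exact: cos_max.
have bs : bmeas (fun w => sin (\sum_(i < m) lam i * G (sig i) w)).
  apply: (bmeas_comp _ _ mS); first by apply: continuous_measurable_fun; exact: continuous_sin.
  by exists 1 => x; exact: sin_max.
rewrite (@eq_ER _ _ _ P' _ (fun w => cos x0 * cos (\sum_(i < m) lam i * G (sig i) w) - sin x0 * sin (\sum_(i < m) lam i * G (sig i) w))); last by move=> w; rewrite cosD.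
rewrite ERB ?ERZ//; [|exact: bmeasZ|exact: bmeasZ].
rewrite Ec Es mulr0 subr0; congr (_ * expR _).
rewrite mulNr; congr (- (_ / _)); rewrite /gauss_var big_mkseq size_mkseq; apply: eq_bigr => i _.
by rewrite big_mkseq; apply: eq_bigr => j _; rewrite !nth_mkseq.
Qed.

Lemma lipschitz_functional_cvg (m : nat) (sig : nat -> R) (g : seq R -> R) (K M : R) : (forall i, 0 <= sig i <= 1) ->
  0 <= K -> lipschitz_seq K g -> (forall xs, `|g xs| <= M) ->
  \int[P]_w g (mkseq (fun i => scaled_count (sig i) t w) m) @[t --> +oo] -->
  \int[P']_w g (mkseq (fun i => G (sig i) w) m).
Proof.
move=> sig01 K0 gK gM.
apply: (cf_cvg_lipschitz (V := fun t i => scaled_count (sig i) t) (V' := fun i => G (sig i)) _ _ _ _ K0 gK gM).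
- by move=> t i; exact: measurable_scaled_count.
- by move=> i; case: gaussG => mG _; exact: mG.
- move=> x0 lam; rewrite gaussian_cos//.
  have h : forall k, k \in mkseq (fun i => (lam i, sig i)) m -> 0 <= k.2.
    by move=> k /mapP[i _ ->] /=; case/andP: (sig01 i).
  have := @fdd_cvg _ x0 h; rewrite (_ : (fun t => _) = (fun t => \int[P]_w cos (x0 + \sum_(i < m) lam i * scaled_count (sig i) t w)))//.
  apply/funext => t; apply: eq_ER => w; congr cos; congr (_ + _).
  by rewrite big_mkseq.
- by move=> i del _ d0; apply: scaled_count_tight => //; case/andP: (sig01 i).
Qed.

End GaussianLimit.

End Model.

(** * Interpolation between jumps *)

Section Interpolation.
Context {R : realType}.

Lemma seq_argmax (s : seq R) (Q : pred R) (x0 : R) : Q x0 ->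
  exists p, [/\ Q p, p = x0 \/ p \in s & forall x, x \in x0 :: s -> Q x -> x <= p].
Proof.
move=> Q0; elim: s => [|y s [p [Qp ps H]]].
  by exists x0; split=> //; [left | move=> x; rewrite inE => /eqP->].
have [/andP[py Qy]|h] := boolP ((p <= y) && Q y).
  exists y; split=> //; first by right; rewrite mem_head.
  move=> x; rewrite !in_cons => /or3P[/eqP-> _|/eqP-> //|xs Qx]; apply: le_trans py.
    by apply: H => //; rewrite mem_head.
  by apply: H => //; rewrite in_cons xs orbT.
exists p; split=> //; first by case: ps => ps; [left | right; rewrite in_cons ps orbT].
move=> x; rewrite !in_cons => /or3P[/eqP-> _|/eqP-> Qy|xs Qx].
- by apply: H => //; rewrite mem_head.
- by move: h; rewrite Qy andbT -ltNge => /ltW.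
- by apply: H => //; rewrite in_cons xs orbT.
Qed.

Context (D : set R) (F : R -> R).
Hypothesis D0 : forall x, D x -> 0 <= x.
Hypothesis Dfin : forall K : R, exists s : seq R, forall x, D x -> x <= K -> x \in s.

Definition gap (p q : R) : Prop :=
  [/\ p < q, p = 0 \/ D p, D q & forall x, p < x < q -> ~ D x].

Definition last_gap (p : R) : Prop := (p = 0 \/ D p) /\ forall x, p < x -> ~ D x.

Lemma jump_ge0 p : p = 0 \/ D p -> 0 <= p. Proof. by case=> [->//|/D0]. Qed.

Lemma last_jump (Q : pred R) (L : R) : Q 0 -> (forall x, Q x -> x <= L) ->
  exists p, [/\ Q p, p = 0 \/ D p & forall x, D x -> Q x -> x <= p].
Proof.
move=> Q0 QL; have [s hs] := Dfin L.
have Q0' : [pred x | Q x && ((x == 0) || `[< D x >])] 0 by rewrite /= Q0 eqxx.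
have [p [/andP[Qp /orP Dp] ps H]] := seq_argmax s Q0'.
exists p; split=> //.
  by case: Dp => [/eqP->|/asboolP]; [left|right].
move=> x Dx Qx; apply: H; last by rewrite /= Qx; apply/orP; right; apply/asboolP.
by rewrite in_cons (hs x Dx (QL x Qx)) orbT.
Qed.

Lemma next_jump (Q : pred R) x1 : D x1 -> Q x1 ->
  exists q, [/\ D q, Q q & forall x, D x -> Q x -> q <= x].
Proof.
move=> D1 Q1; have [s hs] := Dfin x1.
have Q1' : [pred x | Q (- x) && `[< D (- x) >]] (- x1) by rewrite /= opprK Q1; apply/asboolP.
have [p [/andP[Qp /asboolP Dp] ps H]] := seq_argmax [seq - x | x <- s] Q1'.
exists (- p); split=> // x Dx Qx; rewrite lerNl; case/orP: (le_total x x1) => xx1.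
  apply: H; last by rewrite /= opprK Qx; apply/asboolP.
  by rewrite in_cons map_f ?orbT// hs.
apply: (@le_trans _ _ (- x1)); first by rewrite lerN2.
by apply: H; [rewrite mem_head | rewrite /= opprK Q1; apply/asboolP].
Qed.

(** Valid at both ends as well, so that the affine pieces on the two sides of a jump agree there;
    continuity rests on this. *)
Lemma interp_gap p q L : gap p q -> p <= L <= q ->
  interp D F L = F p + (L - p) / (q - p) * (F q - F p).
Proof.
move=> [pq Dp Dq noD] /andP[pL Lq]; have qp0 : q - p != 0 by rewrite gt_eqF// subr_gt0.
have p0 := jump_ge0 Dp.
rewrite /interp; set Hi := [set x | D x /\ L < x]; set Lo := [set 0] `|` _.
have [LD|nLD] := pselect (D L).
  rewrite asboolT; last by left.
  have [pLs|Lp] := ltP p L; last first.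
    by rewrite (_ : L = p) ?subrr ?mul0r ?addr0//; apply/le_anti; rewrite pL Lp.
  have qL : q <= L by rewrite leNgt; apply/negP => Lq'; apply: (noD L); rewrite ?pLs.
  by rewrite (_ : L = q) ?divff ?mul1r ?subrKC//; apply/le_anti; rewrite qL Lq.
have {}Lq : L < q by rewrite lt_neqAle Lq andbT; apply/eqP => E; apply: nLD; rewrite E.
have Hiq : Hi q by split.
rewrite asboolF; last by move=> [//|E]; rewrite E in Hiq.
have Lop : Lo p.
  by case: Dp => [->|Dp]; [left | right; split=> //; rewrite p0].
have -> : sup Lo = p.
  apply/le_anti/andP; split.
    apply: ge_sup; first by exists p.
    move=> x [->//|[Dx /andP[x0 xL]]]; rewrite leNgt; apply/negP => px.
    by apply: (noD x) => //; rewrite px (le_lt_trans xL Lq).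
  apply: ub_le_sup => //; exists L => x [->|[_ /andP[]]//].
  exact: le_trans pL.
have -> : inf Hi = q.
  apply/le_anti/andP; split.
    by apply: ge_inf => //; exists L => x [_ /ltW].
  apply: lb_le_inf; first by exists q.
  move=> x [Dx Lx]; rewrite leNgt; apply/negP => xq; apply: (noD x) => //.
  by rewrite xq andbT (le_lt_trans pL).
by [].
Qed.

Lemma interp_last_gap p L : last_gap p -> p <= L -> interp D F L = F L.
Proof.
move=> [Dp noD] pL; rewrite /interp; case: asboolP => // h; exfalso; apply: h; right.
by apply/seteqP; split => x //= [Dx Lx]; apply: (noD x) => //; exact: le_lt_trans Lx.
Qed.

Lemma right_gap L : 0 <= L -> (exists p q, gap p q /\ p <= L < q) \/ (exists2 p, last_gap p & p <= L).
Proof.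
move=> L0; have [p [pL Dp H]] := @last_jump (fun x => x <= L) L L0 (fun x h => h).
have [[x1 [D1 L1]]|no] := pselect (exists x, D x /\ L < x).
  have [q [Dq Lq Hq]] := @next_jump (fun x => L < x) x1 D1 L1.
  left; exists p, q; split; last by rewrite pL.
  split=> //; first exact: le_lt_trans Lq.
  move=> x /andP[px xq] Dx; have [xL|Lx] := leP x L.
    by have := H x Dx xL; rewrite leNgt px.
  by have := Hq x Dx Lx; rewrite leNgt xq.
right; exists p => //; split=> // x px Dx; have [xL|Lx] := leP x L.
  by have := H x Dx xL; rewrite leNgt px.
by apply: no; exists x.
Qed.

Lemma left_gap L : 0 < L -> (exists p q, gap p q /\ p < L <= q) \/ (exists2 p, last_gap p & p < L).
Proof.
move=> L0; have [p [pL Dp H]] := @last_jump (fun x => x < L) L L0 (fun x h => ltW h).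
have [[x1 [D1 L1]]|no] := pselect (exists x, D x /\ L <= x).
  have [q [Dq Lq Hq]] := @next_jump (fun x => L <= x) x1 D1 L1.
  left; exists p, q; split; last by rewrite pL.
  split=> //; first exact: lt_le_trans Lq.
  move=> x /andP[px xq] Dx; have [Lx|xL] := leP L x.
    by have := Hq x Dx Lx; rewrite leNgt xq.
  by have := H x Dx xL; rewrite leNgt px.
right; exists p => //; split=> // x px Dx; have [Lx|xL] := leP L x.
  by apply: no; exists x.
by have := H x Dx xL; rewrite leNgt px.
Qed.

Hypothesis Fcst : forall p x, last_gap p -> p <= x -> F x = F p.

(** On either side of [L] the function is affine on a gap that contains [L], or constant beyond the
    last jump; the one-sided moduli are combined at the end. *)
Lemma interp_continuous_at L : 0 <= L -> forall e, 0 < e -> exists2 del, 0 < del &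
  forall x, 0 <= x -> `|x - L| < del -> `|interp D F x - interp D F L| < e.
Proof.
move=> L0.
have aff p q (k : R) : p < L -> forall x, F p + (x - p) / (q - p) * k - (F p + (L - p) / (q - p) * k) = (x - L) * (k / (q - p)).
  by move=> _ x; ring.
have slope (b k : R) e : 0 < e -> 0 < b -> exists2 del, 0 < del &
    forall x, `|x - L| < del -> `|x - L| < b /\ `|(x - L) * k| < e.
  move=> e0 b0; exists (Num.min b (e / (`|k| + 1))).
    by rewrite lt_min b0 divr_gt0// ltr_wpDl.
  move=> x; rewrite lt_min => /andP[xb]; rewrite ltr_pdivlMr ?ltr_wpDl// => xe; split=> //.
  rewrite normrM; apply: le_lt_trans xe; rewrite ler_wpM2l// lerDl ler01//.
have right e : 0 < e -> exists2 del, 0 < del &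
    forall x, L <= x -> `|x - L| < del -> `|interp D F x - interp D F L| < e.
  move=> e0; have [[p [q [g /andP[pL Lq]]]]|[p g pL]] := right_gap L0; last first.
    by exists 1 => // x Lx _; rewrite !(interp_last_gap g) ?(le_trans pL)// !(Fcst g) ?subrr ?normr0 ?(le_trans pL).
  have [del d0 H] := slope (q - L) ((F q - F p) / (q - p)) e e0 ltac:(by rewrite subr_gt0).
  exists del => // x Lx /H[xb xe]; rewrite (interp_gap g) ?(interp_gap g).
  - by rewrite (_ : _ - _ = (x - L) * ((F q - F p) / (q - p)))//; ring.
  - by rewrite pL ltW.
  - by rewrite (le_trans pL Lx) /=; move: xb; rewrite ger0_norm ?subr_ge0// ltrBlDr subrK => /ltW.
have left e : 0 < e -> exists2 del, 0 < del &
    forall x, 0 <= x -> x <= L -> `|x - L| < del -> `|interp D F x - interp D F L| < e.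
  move=> e0; move: L0; rewrite le_eqVlt => /orP[/eqP L0|L0].
    exists 1 => // x x0 xL _; rewrite (_ : x = L) ?subrr ?normr0//.
    by apply/le_anti; rewrite xL -L0.
  have [[p [q [g /andP[pL Lq]]]]|[p g pL]] := left_gap L0; last first.
    exists (L - p); first by rewrite subr_gt0.
    move=> x x0 xL; rewrite ler0_norm ?subr_le0// opprB ltrD2l ltrN2 => /ltW px.
    by rewrite !(interp_last_gap g) ?(ltW pL)// !(Fcst g) ?subrr ?normr0 ?(ltW pL).
  have [del d0 H] := slope (L - p) ((F q - F p) / (q - p)) e e0 ltac:(by rewrite subr_gt0).
  exists del => // x x0 xL /H[xb xe]; rewrite (interp_gap g) ?(interp_gap g).
  - by rewrite (_ : _ - _ = (x - L) * ((F q - F p) / (q - p)))//; ring.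
  - by rewrite (ltW pL).
  - by rewrite (le_trans xL Lq) andbT; move: xb; rewrite ler0_norm ?subr_le0// opprB ltrD2l ltrN2 => /ltW.
move=> e e0; have [d1 d10 H1] := right e e0; have [d2 d20 H2] := left e e0.
exists (Num.min d1 d2); first by rewrite lt_min d10.
move=> x x0; rewrite lt_min => /andP[x1 x2]; case/orP: (le_total L x) => h; [exact: H1|exact: H2].
Qed.

End Interpolation.

(** * Chaining over dyadic levels *)

Section Chaining.
Context {R : realType} (W : R -> R) (y : nat -> R) (m0 M : nat).

Definition dyadic_floor (m : nat) (x : R) : R := (Num.truncn (x * 2 ^+ m))%:R / 2 ^+ m.

Lemma pow2_gt0 (m : nat) : 0 < 2 ^+ m :> R. Proof. by rewrite exprn_gt0. Qed.

Lemma dyadic_floor_itv m x : 0 <= x -> dyadic_floor m x <= x < dyadic_floor m x + (2 ^+ m)^-1.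
Proof.
move=> x0; have /andP[h1 h2] := truncn_itv (mulr_ge0 x0 (ltW (pow2_gt0 m))).
rewrite /dyadic_floor ler_pdivrMr ?pow2_gt0// h1 /=.
rewrite -[X in _ + X]mul1r -mulrDl ltr_pdivlMr ?pow2_gt0//.
by rewrite natr1.
Qed.

Lemma truncn_double (x : R) : 0 <= x ->
  Num.truncn (x * 2) = (2 * Num.truncn x)%N \/ Num.truncn (x * 2) = (2 * Num.truncn x).+1.
Proof.
move=> x0; have /andP[h1 h2] := truncn_itv x0; rewrite -natr1 in h2.
have x20 : 0 <= x * 2 by rewrite mulr_ge0.
have [h|h] := ltP (x * 2) (2 * (Num.truncn x)%:R + 1).
  left; apply/eqP; rewrite truncn_eq// -natr1 natrM; apply/andP; split; lra.
right; apply/eqP; rewrite truncn_eq// -[X in _ < X]natr1 -natr1 natrM; apply/andP; split; lra.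
Qed.

(** The cells fill [[0, 2[] rather than the unit interval, because the jump that follows a point of
    the unit interval may lie beyond 1. *)
Hypothesis incr : forall m i, (m0 <= m <= M)%N -> (i < 2 * 2 ^ m)%N ->
  `|W (i.+1%:R / 2 ^+ m) - W (i%:R / 2 ^+ m)| <= y m.

(** By [truncn_double], passing to the next level moves the dyadic floor of [x] by no cell or by one
    cell of the finer level, at a cost of at most [y k.+1]. *)
Lemma chaining m x : (m0 <= m <= M)%N -> 0 <= x < 2 ->
  `|W (dyadic_floor m x) - W (dyadic_floor m0 x)| <= \sum_(m0 <= k < m) y k.+1.
Proof.
move=> /andP[/subnKC <-]; elim: (m - m0)%N => [|n IH] mM x02.
  by rewrite addn0 subrr normr0 big_geq.
have /andP[x0 x2] := x02.
rewrite addnS big_nat_recr ?leq_addr//=; set k := (m0 + n)%N in IH mM *.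
have kM : (k < M)%N by rewrite addnS in mM.
rewrite -(subrK (W (dyadic_floor k x)) (W (dyadic_floor k.+1 x))) -addrA addrC.
apply: (le_trans (ler_normD _ _)); apply: lerD; first by apply: IH => //; exact: ltnW.
have xk : 0 <= x * 2 ^+ k by rewrite mulr_ge0// ltW// pow2_gt0.
have tk : (Num.truncn (x * 2 ^+ k.+1) < 2 * 2 ^ k.+1)%N.
  rewrite truncn_lt_nat; last by rewrite mulr_ge0// ltW// pow2_gt0.
  by rewrite natrM natrX ltr_pM2r ?pow2_gt0.
have y0 : 0 <= y k.+1.
  by apply: le_trans (normr_ge0 _) (incr (m := k.+1) (i := 0) _ _); rewrite ?muln_gt0 ?expn_gt0// kM leqW// leq_addr.
rewrite {1 2}/dyadic_floor; have := truncn_double xk.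
have -> : x * 2 ^+ k * 2 = x * 2 ^+ k.+1 by rewrite exprS; ring.
have E : W ((Num.truncn (x * 2 ^+ k))%:R / 2 ^+ k) = W ((2 * Num.truncn (x * 2 ^+ k))%:R / 2 ^+ k.+1).
  by congr W; rewrite natrM exprS; field; rewrite gt_eqF ?pow2_gt0.
rewrite E => -[->|h]; first by rewrite subrr normr0.
by rewrite h; apply: incr; [rewrite kM leqW// leq_addr | rewrite h in tk; exact: ltnW].
Qed.

End Chaining.

Lemma cell_index_bounds (i N : nat) : (i <= N)%N -> (4 <= N)%N ->
  [/\ (i.-1 < 2 * N)%N, (i.+1 < 2 * N)%N & (i.+2 < 2 * N)%N].
Proof. by move=> h1 h2; split; lia. Qed.

(** * Comparison of an interpolated path with its values on a dyadic grid *)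

Section GridApproximation.
Context {R : realType} (D : set R) (F : R -> R) (a tau sq N0 eta : R) (m0 M : nat).
Hypothesis D0 : forall x, D x -> 0 <= x.
Hypothesis Dfin : forall K : R, exists s : seq R, forall x, D x -> x <= K -> x \in s.
Hypothesis a0 : 0 < a.
Hypothesis tau0 : 0 < tau.
Hypothesis sq0 : 0 < sq.
Hypothesis eta0 : 0 < eta.
Hypothesis Fmono : forall u v, 0 <= u -> u <= v -> v <= 2 * tau -> F u <= F v.
Hypothesis Fjump : forall u v, 0 <= u -> u <= v -> v <= 2 * tau -> (forall x, u < x <= v -> ~ D x) -> F u = F v.

Let W x := (F (x * tau) - x * tau / a) / sq.
(* The ratio [9/10] makes [y] summable while [2 ^ m (2 ^ - m) ^ 2 / y m ^ 4] still decays, as [(10/9) ^ 4 < 2]. *)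
Let y m := eta / 10 * (9 / 10) ^+ (m - m0).

Hypothesis incr : forall m i, (m0 <= m <= M)%N -> (i < 2 * 2 ^ m)%N ->
  `|W (i.+1%:R / 2 ^+ m) - W (i%:R / 2 ^+ m)| <= y m.
Hypothesis m02 : (2 <= m0)%N.
Hypothesis m0M : (m0 <= M)%N.
Hypothesis tauM : tau <= 2 * 2 ^+ M.
Hypothesis sq_large : 2 / a <= eta * sq.
Hypothesis sq_large0 : eta * a * 2 ^+ m0 * sq < 10 * tau.
(** [N0] stands for the number of particles exactly at the origin, which counts over []0, L]]
    omit. *)
Hypothesis N00 : 0 <= N0 <= eta * sq.

Lemma sum_level_bounds m : (m0 <= m)%N -> \sum_(m0 <= k < m) y k.+1 <= eta.
Proof.
move=> /subnKC <-; suff -> : \sum_(m0 <= k < m0 + (m - m0)) y k.+1 = 9 / 10 * eta * (1 - (9 / 10) ^+ (m - m0)).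
  have : 0 <= (9 / 10) ^+ (m - m0) :> R by rewrite exprn_ge0.
  by move=> /(mulr_ge0 (ltW eta0)); rewrite mulrBr mulr1 -(mulrA (9 / 10)); have := eta0; lra.
elim: (m - m0)%N => [|n IH]; first by rewrite addn0 big_geq// expr0 subrr mulr0.
rewrite addnS big_nat_recr ?leq_addr//= IH /y subSn ?leq_addr// addKn !exprS.
by field.
Qed.

Lemma level_bound_le m : (m0 <= m)%N -> y m <= eta / 10.
Proof. by move=> _; rewrite /y ler_piMr ?divr_ge0 ?(ltW eta0)// exprn_ile1//; lra. Qed.

(** Chaining down to level [M] costs [eta]. Within a finest cell the monotone [F] is squeezed
    between its values at the two ends, which differ in [W] by at most [eta / 10], while the linear
    mean varies by at most [eta]. *)
Lemma oscillation x : 0 <= x < 2 -> `|W x - W (dyadic_floor m0 x)| <= 3 * eta.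
Proof.
move=> x02; have /andP[x0 x2] := x02.
have M1 : (m0 <= M <= M)%N by rewrite m0M leqnn.
have c1 := le_trans (chaining incr M1 x02) (sum_level_bounds m0M).
set f := dyadic_floor M x in c1.
have /andP[fx xf] := dyadic_floor_itv M x0; rewrite -/f in fx xf.
have p0 : 0 < 2 ^+ M :> R := pow2_gt0 M.
have f0 : 0 <= f by rewrite /f /dyadic_floor divr_ge0// ltW.
have tk : (Num.truncn (x * 2 ^+ M) < 2 * 2 ^ M)%N.
  rewrite truncn_lt_nat; last by rewrite mulr_ge0// ltW.
  by rewrite natrM natrX ltr_pM2r.
have fE : f + (2 ^+ M)^-1 = (Num.truncn (x * 2 ^+ M)).+1%:R / 2 ^+ M.
  by rewrite /f /dyadic_floor -[X in _ = X / _]natr1 mulrDl mul1r.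
have f2 : f + (2 ^+ M)^-1 <= 2.
  by rewrite fE ler_pdivrMr//; move: tk; set n := Num.truncn _ => tk; rewrite -natrX -natrM ler_nat.
have := incr M1 tk; rewrite -fE -/(dyadic_floor M x) -/f => i1.
have {}i1 := le_trans i1 (level_bound_le m0M).
have F1 : F (f * tau) <= F (x * tau) by apply: Fmono; rewrite ?mulr_ge0 ?ler_pM2r// ?(ltW tau0)// ltW.
have F2 : F (x * tau) <= F ((f + (2 ^+ M)^-1) * tau).
  by apply: Fmono; rewrite ?mulr_ge0 ?ler_pM2r// ?(ltW tau0)// ltW.
have dt : (2 ^+ M)^-1 * tau / a / sq <= eta.
  rewrite ler_pdivrMr//; apply: le_trans sq_large; rewrite ler_pM2r ?invr_gt0//.
  by rewrite mulrC ler_pdivrMr.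
have xft : 0 <= (x - f) * tau / a / sq <= (2 ^+ M)^-1 * tau / a / sq.
  rewrite !mulr_ge0 ?subr_ge0// ?invr_ge0 ?(ltW tau0) ?(ltW a0) ?(ltW sq0)//=.
  by rewrite !ler_pM2r ?invr_gt0// lerBlDl ltW.
have lo : - eta <= W x - W f.
  have : 0 <= (F (x * tau) - F (f * tau)) / sq by rewrite divr_ge0 ?subr_ge0// ltW.
  rewrite /W; move: (F _) (F _) => A B h; lra.
have hi : W x - W f <= eta / 10 + eta.
  have : (F (x * tau) - F ((f + (2 ^+ M)^-1) * tau)) / sq <= 0 by rewrite pmulr_lle0 ?invr_gt0// subr_le0.
  move: i1; rewrite ler_norml /W => /andP[_]; move: (F _) (F _) (F _) => A B C h1 h2; lra.
rewrite -(subrK (W f) (W x)) -addrA; apply: (le_trans (ler_normD _ _)).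
have : `|W x - W f| <= eta / 10 + eta by rewrite ler_norml; apply/andP; split; lra.
by move: c1; lra.
Qed.

Lemma grid_steps j n : (j + n <= 2 * 2 ^ m0)%N ->
  `|W ((j + n)%:R / 2 ^+ m0) - W (j%:R / 2 ^+ m0)| <= n%:R * (eta / 10).
Proof.
elim: n => [|n IH] jn; first by rewrite addn0 subrr normr0 mul0r.
rewrite addnS in jn *; rewrite -(subrK (W ((j + n)%:R / 2 ^+ m0)) (W _)) -addrA.
apply: (le_trans (ler_normD _ _)); rewrite -[n.+1%:R]natr1 mulrDl mul1r addrC [leRHS]addrC addrC; apply: lerD.
  by apply: (le_trans (incr _ jn)); [rewrite leqnn m0M | exact: level_bound_le].
by apply: IH; exact: ltnW.
Qed.

(** Without a jump [F] would be constant on the cell, and the linear mean alone would make [W] drop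
    by more than the allowed [eta / 10]; this is the purpose of [sq_large0]. *)
Lemma cell_has_jump j : (j < 2 * 2 ^ m0)%N ->
  exists2 x, D x & j%:R / 2 ^+ m0 * tau < x <= j.+1%:R / 2 ^+ m0 * tau.
Proof.
move=> jm; apply: contrapT => no; have p0 : 0 < 2 ^+ m0 :> R := pow2_gt0 m0.
have E : F (j%:R / 2 ^+ m0 * tau) = F (j.+1%:R / 2 ^+ m0 * tau).
  apply: Fjump.
  - by rewrite mulr_ge0 ?divr_ge0 ?(ltW tau0) ?(ltW p0).
  - by rewrite ler_pM2r// ler_pM2r ?invr_gt0// ler_nat.
  - by rewrite ler_pM2r// ler_pdivrMr// -natrX -natrM ler_nat.
  - by move=> x xj Dx; apply: no; exists x.
have m1 : (m0 <= m0 <= M)%N by rewrite leqnn.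
have := le_trans (incr m1 jm) (level_bound_le (leqnn m0)).
rewrite (_ : _ - _ = - (tau / (a * 2 ^+ m0 * sq))); last first.
  by rewrite /W E; move: (F _) => A; rewrite -natr1; field; rewrite !gt_eqF.
rewrite normrN ger0_norm; last by rewrite divr_ge0 ?(ltW tau0)// ltW// !mulr_gt0.
apply/negP; rewrite -ltNge ltr_pdivlMr ?mulr_gt0//.
by have := sq_large0; lra.
Qed.

(** Up to [N0 / sq <= eta], the left term is a convex combination of [W] at the two jumps [p] and
    [q] around [s * tau]. Both lie within two cells of [s], so each value is off by at most [3 eta]
    for the oscillation and [2 eta / 10] for the grid steps, less than [4 eta]. *)
Lemma interp_grid_approximation s : 0 <= s <= 1 ->
  `|(interp D (fun L => N0 + F L) (s * tau) - s * tau / a) / sq - W (dyadic_floor m0 s)| <= 5 * eta.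
Proof.
move=> /andP[s0 s1]; have p0 : 0 < 2 ^+ m0 :> R := pow2_gt0 m0.
have st0 : 0 <= s * tau by rewrite mulr_ge0// ltW.
have N1 : 0 <= N0 / sq <= eta.
  by case/andP: N00 => n0 n1; rewrite divr_ge0 ?(ltW sq0)//= ler_pdivrMr.
have s02 : 0 <= s < 2 by rewrite s0 (le_lt_trans s1)// ltr1n.
case: (right_gap Dfin st0) => [[p [q [g /andP[pL Lq]]]]|[p g pL]]; last first.
  rewrite (interp_last_gap _ g pL).
  rewrite (_ : _ - _ = N0 / sq + (W s - W (dyadic_floor m0 s))); last by rewrite /W; ring.
  have := oscillation s02; rewrite !ler_norml => /andP[h1 h2]; apply/andP; split; lra.
have [pq Dp Dq noD] := g.
have p00 := jump_ge0 D0 Dp.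
set i := Num.truncn (s * 2 ^+ m0).
have sm0 : 0 <= s * 2 ^+ m0 by rewrite mulr_ge0// ltW.
have /andP[i1 i2] := truncn_itv sm0; rewrite -/i in i1 i2.
have im : (i <= 2 ^ m0)%N.
  by rewrite -(ler_nat R) natrX; apply: (le_trans i1); rewrite ler_piMl// ltW.
have pow4 : (4 <= 2 ^ m0)%N by rewrite (leq_trans _ (leq_pexp2l (m := 2) _ m02)).
have [ci1 ci2 ci3] := cell_index_bounds im pow4.
have itau (k : nat) x : (k%:R / 2 ^+ m0 * tau <= x) = (k%:R <= x / tau * 2 ^+ m0).
  by rewrite -ler_pdivlMr// ler_pdivrMr.
have itau' (k : nat) x : (x < k%:R / 2 ^+ m0 * tau) = (x / tau * 2 ^+ m0 < k%:R).
  by rewrite -ltr_pdivrMr// ltr_pdivlMr.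
have Ls : s * tau / tau = s by rewrite mulfK// gt_eqF.
(* Cell [i] contains [s], and its jump may precede [s]; the jump of cell [i.+1] certainly follows.
   Symmetrically, [p] is located by the jump of cell [i.-1], or by [0 <= p] when [i = 0]. *)
have qi : q <= i.+2%:R / 2 ^+ m0 * tau.
  have [x Dx /andP[x1 x2]] := cell_has_jump ci2.
  apply: le_trans x2; rewrite leNgt; apply/negP => xq; apply: (noD x) => //.
  rewrite xq andbT (le_lt_trans pL)// (lt_trans _ x1)// itau' Ls.
  exact: i2.
have q2 : q / tau < 2.
  rewrite ltr_pdivrMr//; apply: (le_lt_trans qi); rewrite ltr_pM2r// ltr_pdivrMr//.
  by rewrite -natrX -natrM ltr_nat.
have p2 : p / tau < 2 by apply: lt_trans q2; rewrite ltr_pM2r// invr_gt0.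
have q0 : 0 <= q := D0 Dq.
have pt0 : 0 <= p / tau by rewrite divr_ge0// ltW.
have qt0 : 0 <= q / tau by rewrite divr_ge0// ltW.
have pi : i.-1%:R / 2 ^+ m0 * tau <= p.
  case: (posnP i) => [->|ipos]; first by rewrite mul0r mul0r.
  have [x Dx /andP[x1 x2]] := cell_has_jump ci1.
  rewrite prednK// in x2.
  rewrite leNgt; apply/negP => pi; apply: (noD x) => //.
  rewrite (lt_trans pi x1) (le_lt_trans x2)// (le_lt_trans _ Lq)// itau Ls; exact: i1.
set jp := Num.truncn (p / tau * 2 ^+ m0); set jq := Num.truncn (q / tau * 2 ^+ m0).
have jp1 : (i.-1 <= jp)%N by rewrite -[i.-1](@natrK R) le_truncn// -itau.
have jp2 : (jp <= i)%N.
  by rewrite le_truncn// ler_pM2r// ler_pdivrMr.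
have jq1 : (i <= jq)%N by rewrite le_truncn// ler_pM2r// ler_pdivlMr// ltW.
have jq2 : (jq <= i.+2)%N.
  rewrite -[i.+2](@natrK R) le_truncn//; move: qi; rewrite -ler_pdivrMr// ler_pdivlMr//.
have Wp : `|W (p / tau) - W (dyadic_floor m0 s)| <= 4 * eta.
  have o1 := oscillation (x := p / tau) ltac:(by rewrite pt0 p2).
  have o2 := @grid_steps jp (i - jp); rewrite subnKC// in o2; have {}o2 := o2 (leq_trans (leqnSn _) (ltnW ci2)).
  rewrite -/i -/(dyadic_floor m0 s) -/(dyadic_floor m0 (p / tau)) in o2.
  have k1 : ((i - jp)%:R : R) <= 1 by rewrite (ler_nat R _ 1) leq_subLR addn1 (leq_trans (leqSpred _)).
  have k2 : (i - jp)%:R * (eta / 10) <= 1 * (eta / 10) by rewrite ler_pM2r// divr_gt0.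
  move: o1 (le_trans o2 k2); rewrite /dyadic_floor -/jp -/i; move: (W _) (W _) (W _) => A B C.
  by rewrite !ler_norml => /andP[h1 h2] /andP[h3 h4]; apply/andP; split; lra.
have Wq : `|W (q / tau) - W (dyadic_floor m0 s)| <= 4 * eta.
  have o1 := oscillation (x := q / tau) ltac:(by rewrite qt0 q2).
  have o2 := @grid_steps i (jq - i); rewrite subnKC// in o2; have {}o2 := o2 (leq_trans jq2 (ltnW ci3)).
  have k1 : ((jq - i)%:R : R) <= 2 by rewrite (ler_nat R _ 2) leq_subLR addn2.
  have k2 : (jq - i)%:R * (eta / 10) <= 2 * (eta / 10) by rewrite ler_pM2r// divr_gt0.
  move: o1 (le_trans o2 k2); rewrite /dyadic_floor -/jq -/i; move: (W _) (W _) (W _) => A B C.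
  by rewrite !ler_norml => /andP[h1 h2] /andP[h3 h4]; apply/andP; split; lra.
rewrite (interp_gap _ D0 g); last by rewrite pL ltW.
set th := (s * tau - p) / (q - p).
have qp0 : 0 < q - p by rewrite subr_gt0.
have th0 : 0 <= th by rewrite divr_ge0 ?subr_ge0// ltW.
have th1 : th <= 1 by rewrite ler_pdivrMr// mul1r lerD2r ltW.
have sE : s * tau = p + th * (q - p) by rewrite /th divfK ?gt_eqF// addrC subrK.
rewrite {1}sE.
have -> : (N0 + F p + th * (N0 + F q - (N0 + F p)) - (p + th * (q - p)) / a) / sq - W (dyadic_floor m0 s) =
   N0 / sq + ((1 - th) * (W (p / tau) - W (dyadic_floor m0 s)) + th * (W (q / tau) - W (dyadic_floor m0 s))).
  have WE x : W (x / tau) = (F x - x / a) / sq by rewrite /W divfK ?gt_eqF.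
  by rewrite !WE; generalize th (W (dyadic_floor m0 s)) => th' B; field; rewrite !gt_eqF.
have th1' : 0 <= 1 - th by rewrite subr_ge0.
have b1 : `|(1 - th) * (W (p / tau) - W (dyadic_floor m0 s))| <= (1 - th) * (4 * eta).
  by rewrite normrM ger0_norm// ler_wpM2l.
have b2 : `|th * (W (q / tau) - W (dyadic_floor m0 s))| <= th * (4 * eta).
  by rewrite normrM ger0_norm// ler_wpM2l.
move: b1 b2; move: (_ * (W _ - _)) (_ * (W _ - _)) => A B b1 b2.
apply: (le_trans (ler_normD _ _)); rewrite ger0_norm; last by case/andP: N1.
have := ler_normD B A; case/andP: N1 => _; rewrite mulrBl mul1r in b1; move: b1 b2; lra.
Qed.

End GridApproximation.

(** * Paths of the model *)

Section UnitInterval.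
Context {R : realType}.

Lemma within_continuousP (f : R -> R) :
  {within `[0, 1]%classic, continuous f} <->
  forall x, 0 <= x <= 1 -> forall e, 0 < e -> exists2 del, 0 < del &
    forall y, 0 <= y <= 1 -> `|y - x| < del -> `|f y - f x| < e.
Proof.
have I01 (x : R) : `[0, 1]%classic x = (0 <= x <= 1) :> Prop by rewrite /= in_itv.
split.
  move=> /subspace_continuousP cf x x01 e e0.
  have /cvgrPdist_lt/(_ e e0) := cf x ltac:(by rewrite I01).
  rewrite near_withinE => /nbhs_ballP[del /= d0 H]; exists del => // y y01 yx.
  by rewrite distrC; apply: H; [rewrite /ball /= distrC | rewrite in_itv].
move=> H; apply/subspace_continuousP => x; rewrite I01 => x01; apply/cvgrPdist_lt => e e0.
have [del d0 Hd] := H x x01 e e0; rewrite near_withinE; apply/nbhs_ballP; exists del => //= y yx.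
by rewrite in_itv /= => y01; rewrite distrC; apply: Hd => //; rewrite distrC.
Qed.

Lemma dyadic_floor_cvg (f : R -> R) : {within `[0, 1]%classic, continuous f} ->
  forall e, 0 < e -> \forall m \near \oo, forall x, 0 <= x <= 1 -> `|f (dyadic_floor m x) - f x| < e.
Proof.
move=> /within_continuousP cf e e0.
have cpt := @segment_compact R 0 1.
have /compact_near_coveringP cov := cpt.
have [] := cov nat \oo (fun m x => 0 <= x <= 1 -> `|f (dyadic_floor m x) - f x| < e) _.
  move=> x /=; rewrite in_itv /= => x01.
  have e2 : 0 < e / 2 by lra.
  have [del d0 Hd] := cf x x01 _ e2.
  have nx : \forall x' \near x, `|x' - x| < del / 2.
    by apply/nbhs_ballP; exists (del / 2) => /=; [lra | move=> y; rewrite /ball /= distrC].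
  have nm : \forall m \near \oo, (2 ^+ m)^-1 < del / 2 :> R.
    have : (2^-1 : R) ^+ n @[n --> \oo] --> (0 : R) by apply: cvg_expr; rewrite gtr0_norm//; lra.
    move=> /cvgrPdist_lt/(_ (del / 2) ltac:(lra)); apply: filterS => m.
    by rewrite sub0r normrN exprVn ger0_norm// invr_ge0 exprn_ge0.
  near=> x' m => /= /andP[x0' x1'].
  have m2 : (2 ^+ m)^-1 < del / 2 :> R by near: m.
  have xx : `|x' - x| < del / 2 by near: x'.
  have /andP[f1 f2] := dyadic_floor_itv m x0'.
  have f01 : 0 <= dyadic_floor m x' <= 1.
    by rewrite (le_trans f1 x1') andbT /dyadic_floor divr_ge0// exprn_ge0.
  have h1 : `|f (dyadic_floor m x') - f x| < e / 2.
    apply: Hd => //; move: xx; rewrite !ltr_norml => /andP[? ?]; apply/andP; split; lra.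
  have h2 : `|f x' - f x| < e / 2 by apply: Hd; [rewrite x0' | lra].
  by move: h1 h2; rewrite !ltr_norml => /andP[? ?] /andP[? ?]; apply/andP; split; lra.
move=> N _ H; exists N => // m Nm x x01; exact: (H m Nm).
Unshelve. all: end_near. Qed.

End UnitInterval.

Section CountingPath.
Context {R : realType} {d : measure_display} {T : measurableType d}.
Context (X : int -> R -> T -> R) (eps : T -> R) (a t : R) (w : T).
Let Y j := X j t.
Hypothesis a0 : 0 < a.
Hypothesis nd : ~ degenerate a Y eps w.

Definition jumps : set R := [set x | exists j, x = particle X eps a t w j /\ 0 <= x].

Definition path_count (L : R) : R := count_ioc a Y eps 0 L w.

(** The margin 1 keeps the origin strictly inside and covers []-1, 0]] even for [K = 0]. *)
Lemma finite_window (K : R) : exists M, (forall j, j \notin int_window M -> ~ (- `|K| - 1 < site a Y eps j w <= `|K| + 1)) /\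
  forall u v, - `|K| - 1 <= u -> v <= `|K| + 1 ->
    count_ioc a Y eps u v w = \sum_(j <- int_window M) \1_(`]u, v]%classic) (site a Y eps j w).
Proof.
pose k := (Num.truncn (`|K| + 1)).+1.
have hk : `|K| + 1 <= k%:R by apply: ltW; exact: truncnS_gt.
have [M HM] := locally_finite k nd; exists M; split.
  move=> j jM /andP[h1 h2]; apply: (HM j jM); apply/andP; split; lra.
move=> u v ku vk; apply: (count_iocE nd HM) => //; lra.
Qed.

Lemma esum_window (M : nat) (b : int -> R) : (forall j, 0 <= b j) -> (forall j, j \notin int_window M -> b j = 0) ->
  fine (\esum_(j in [set: int]) (b j)%:E) = \sum_(j <- int_window M) b j.
Proof.
move=> b0 bM; pose A := [set` int_window M].
have -> : \esum_(j in [set: int]) (b j)%:E = \esum_(j in A) (b j)%:E.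
  rewrite [RHS]esum_mkcond; apply: eq_esum => j _; case: ifPn => // jA; rewrite bM//.
  by apply/negP => h; move/negP: jA; apply; apply/mem_set.
rewrite esum_fset; [|exact: finite_seq|by move=> j _; rewrite lee_fin].
rewrite -fsbig_seq ?int_window_uniq// sumEFin //.
Qed.

Lemma countN_window (L K : R) M : 0 <= L -> L <= `|K| + 1 ->
  (forall j, j \notin int_window M -> ~ (- `|K| - 1 < site a Y eps j w <= `|K| + 1)) ->
  countN X eps a t L w = \sum_(j <- int_window M) (if 0 <= site a Y eps j w <= L then 1 else 0).
Proof.
move=> L0 LK HM; rewrite /countN (@esum_window M).
- by [].
- by move=> j; case: ifP.
- move=> j jM; case: ifP => // /andP[h1 h2]; exfalso; apply: (HM j jM).
  apply/andP; split; last exact: le_trans LK.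
  apply: lt_le_trans h1; have := normr_ge0 K; lra.
Qed.

Lemma countN_path_count L : 0 <= L -> countN X eps a t L w = countN X eps a t 0 w + path_count L.
Proof.
move=> L0; have [M [HM HE]] := finite_window L.
have LL : L <= `|L| + 1 by have := ler_norm L; lra.
have n0 := normr_ge0 L; have L1 : 0 <= `|L| + 1 by lra.
rewrite (countN_window L0 LL HM) (countN_window (lexx 0) L1 HM).
rewrite /path_count HE; [|lra|lra].
rewrite -big_split /=; apply: eq_bigr => j _; rewrite indicE.
rewrite (_ : (_ \in _) = (0 < site a Y eps j w <= L)); last first.
  by apply/idP/idP => [/set_mem|h]; [rewrite /= in_itv | apply/mem_set; rewrite /= in_itv].
have [s0|s0|s0] := ltgtP 0 (site a Y eps j w).
- by rewrite /=; case: (_ <= L); rewrite add0r.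
- by rewrite /= addr0.
- by rewrite -s0 L0 /= addr0.
Qed.

Lemma path_countB u v : 0 <= u -> u <= v -> path_count v - path_count u = count_ioc a Y eps u v w.
Proof.
move=> u0 uv; have v0 := le_trans u0 uv; have [M [HM HE]] := finite_window v.
have vv : v <= `|v| + 1 by have := ler_norm v; lra.
have n0 := normr_ge0 v.
rewrite /path_count !HE//; try lra.
rewrite -sumrB; apply: eq_bigr => j _; rewrite !indicE.
have E x y : (site a Y eps j w \in `]x, y]%classic) = (x < site a Y eps j w <= y).
  by apply/idP/idP => [/set_mem|h]; [rewrite /= in_itv | apply/mem_set; rewrite /= in_itv].
rewrite !E; have [su|us] := leP (site a Y eps j w) u.
  by rewrite (le_trans su uv) !andbT /= subrr.
by rewrite (le_lt_trans u0 us) /= subr0.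
Qed.

Lemma count_ioc_ge0 u v : 0 <= count_ioc a Y eps u v w.
Proof.
have [M [_ HE]] := finite_window (`|u| + `|v|).
have e : `| `|u| + `|v| | = `|u| + `|v| by rewrite ger0_norm// addr_ge0.
have u0 := normr_ge0 u; have v0 := normr_ge0 v; have v1 := ler_norm v.
have u1 := ler_norm (- u); rewrite normrN in u1.
rewrite e in HE; rewrite HE; [|lra|lra].
by apply: sumr_ge0 => j _.
Qed.

Lemma path_count_mono u v : 0 <= u -> u <= v -> path_count u <= path_count v.
Proof. by move=> u0 uv; rewrite -subr_ge0 path_countB// count_ioc_ge0. Qed.

Lemma path_count_jump u v : 0 <= u -> u <= v -> (forall x, u < x <= v -> ~ jumps x) -> path_count u = path_count v.
Proof.
move=> u0 uv H; apply/esym/eqP; rewrite -subr_eq0 path_countB//; apply/eqP.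
have [M [_ HE]] := finite_window v; have n0 := normr_ge0 v.
rewrite HE; [|lra|by have := ler_norm v; lra].
apply: big1 => j _; rewrite indicE memNset//= in_itv /= => h.
apply: (H _ h); exists j; split=> //.
by case/andP: h => h _; rewrite (le_trans u0) ?ltW.
Qed.

Lemma jumps_ge0 x : jumps x -> 0 <= x. Proof. by case=> j []. Qed.

Lemma jumps_finite (K : R) : exists s : seq R, forall x, jumps x -> x <= K -> x \in s.
Proof.
have [M [HM _]] := finite_window K; have n0 := normr_ge0 K.
exists [seq site a Y eps j w | j <- int_window M] => x [j [-> x0] xK].
apply: map_f; apply: contrapT => /negP jM; apply: (HM j jM).
rewrite -[site a Y eps j w]/(particle X eps a t w j); apply/andP; split; first by lra.
by have := ler_norm K; lra.
Qed.

(** The particles at the origin are among those in []-1, 0]], whose number the tail bound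
    controls. *)
Lemma countN0_bounds : 0 <= countN X eps a t 0 w <= count_ioc a Y eps (- 1) 0 w.
Proof.
have [M [HM HE]] := finite_window 0; rewrite normr0 in HE.
rewrite HE; [|lra|lra]; rewrite (countN_window (lexx 0) _ HM); last by rewrite normr0 add0r.
apply/andP; split; first by apply: sumr_ge0 => j _; case: ifP.
apply: ler_sum => j _; case: ifP => // /andP[h1 h2].
by rewrite indicE mem_set//= in_itv /= h2 andbT (lt_le_trans _ h1).
Qed.

Lemma interp_countN L : 0 <= L ->
  interp jumps (fun L => countN X eps a t L w) L = interp jumps (fun L => countN X eps a t 0 w + path_count L) L.
Proof.
move=> L0; case: (right_gap jumps_finite L0) => [[p [q [g /andP[pL Lq]]]]|[p g pL]]; last first.
  by rewrite !(interp_last_gap _ g pL) countN_path_count.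
have pLq : p <= L <= q by rewrite pL ltW.
have [pq Dp Dq _] := g.
rewrite !(interp_gap _ jumps_ge0 g pLq) !(countN_path_count (jump_ge0 jumps_ge0 Dp)).
by rewrite !(countN_path_count (jumps_ge0 Dq)).
Qed.

Lemma countN_last_gap p x : last_gap jumps p -> p <= x -> countN X eps a t x w = countN X eps a t p w.
Proof.
move=> [Dp H] px; have p0 := jump_ge0 jumps_ge0 Dp.
rewrite (countN_path_count p0) (countN_path_count (le_trans p0 px)); congr (_ + _).
by apply/esym/path_count_jump => // y /andP[py _]; exact: H.
Qed.

Lemma hatZ_continuous (alpha : R) : 0 < t -> {within `[0, 1]%classic, continuous (fun s => hatZ alpha a X eps t s w)}.
Proof.
move=> t0; have ta0 : 0 < t `^ alpha^-1 by exact: powR_gt0.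
have st0 : 0 < t `^ (2 * alpha)^-1 by exact: powR_gt0.
set ta := t `^ alpha^-1 in ta0; set st := t `^ (2 * alpha)^-1 in st0.
apply/within_continuousP => s /andP[s0 s1] e e0.
have sta : 0 <= s * ta by rewrite mulr_ge0// ltW.
pose H s := interp jumps (fun L => countN X eps a t L w) (s * ta).
have e2 : 0 < e * st / 2 by rewrite !mulr_gt0// invr_gt0.
have [del d0 Hd] := interp_continuous_at jumps_ge0 jumps_finite (F := fun L => countN X eps a t L w) (@countN_last_gap) sta e2.
exists (Num.min (del / ta) (e * st * a / (2 * ta))); first by rewrite lt_min !divr_gt0 ?mulr_gt0.
move=> x /andP[x0 x1]; rewrite lt_min => /andP[xd xe].
have h1 : `|x * ta - s * ta| < del.
  by rewrite -mulrBl normrM (gtr0_norm ta0) -ltr_pdivlMr.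
have := Hd (x * ta) (mulr_ge0 x0 (ltW ta0)) h1; rewrite -/(H x) -/(H s) => h2.
rewrite /hatZ -/ta -/st -[interp _ _ (x * ta)]/(H x) -[interp _ _ (s * ta)]/(H s).
rewrite (_ : _ - _ = (H x - H s) / st - (x - s) * (ta / (a * st))); last by field; rewrite !gt_eqF.
apply: (le_lt_trans (ler_normB _ _)).
have k1 : `|(H x - H s) / st| < e / 2.
  by rewrite normrM normfV (gtr0_norm st0) ltr_pdivrMr// mulrAC.
have k2 : `|(x - s) * (ta / (a * st))| <= e / 2.
  have q0 : 0 < ta / (a * st) by rewrite divr_gt0// mulr_gt0.
  rewrite normrM (gtr0_norm q0) -ler_pdivlMr//; apply: ltW; apply: (lt_le_trans xe).
  by rewrite le_eqVlt; apply/orP; left; apply/eqP; field; rewrite !gt_eqF.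
lra.
Qed.

End CountingPath.

Lemma tail_const_ge0 (R : realType) (a : R) : 0 <= tail_const a.
Proof. by rewrite /tail_const mulr_ge0 ?expR_ge0. Qed.

(** * The event on which all increments are small *)

Section GoodEvent.
Context {R : realType} (alpha c a : R) {d : measure_display} {T : measurableType d} (P : probability T R).
Context (X : int -> R -> T -> R) (eps : T -> R).
Hypothesis alpha0 : 0 < alpha.
Hypothesis a0 : 0 < a.
Hypothesis stableX : forall j, sym_stable_process P alpha c (X j).
Hypothesis epsU : uniform01 P eps.
Hypothesis indX : mutually_independent P (fun i : option int =>
    match i with None => preimage_events eps | Some j => process_events (X j) end).

(** For [x = tau t], [M] is the finest level whose cells still have unscaled length at least 1;
    there the chaining stops. *)
Lemma dyadic_scale (x : R) : 1 <= x -> exists M, 2 ^+ M <= x < 2 * 2 ^+ M /\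
  forall m, 2 ^+ m <= x -> (m <= M)%N.
Proof.
move=> x1; have x0 : 0 <= x by apply: le_trans x1.
have /andP[h1 h2] := truncn_itv x0; set n := Num.truncn x in h1 h2.
have n0 : (0 < n)%N by rewrite /n truncn_gt0.
exists (trunc_log 2 n); split; last first.
  move=> m mx; apply: trunc_log_max => //.
  by rewrite -(@natrK R (2 ^ m)) le_truncn// natrX.
apply/andP; split.
  by apply: le_trans h1; rewrite -natrX ler_nat trunc_logP.
apply: (lt_le_trans h2); rewrite -natrX -natrM ler_nat -expnS.
exact: trunc_log_ltn.
Qed.

Let level (eta : R) (m0 m : nat) : R := eta / 10 * (9 / 10) ^+ (m - m0).

Definition bad_cell (eta : R) (m0 : nat) (t : R) (m i : nat) : set T :=
  [set w | level eta m0 m * t `^ (2 * alpha)^-1 <= `|deviation alpha a X eps (i%:R / 2 ^+ m) (i.+1%:R / 2 ^+ m) t w|].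

(** The union bound at level [m] gives [K] times the power [m - m0] of [(10/9) ^ 4 / 2], a ratio
    below [4/5]. The geometric series contributes the factor 5, which turns the 2 of [K] into 10. *)
Lemma bad_cells_prob (eta t : R) (m0 M : nat) : 0 < eta -> 0 < t -> 2 ^+ M <= t `^ alpha^-1 ->
  let B := \big[setU/set0]_(m <- iota m0 (M.+1 - m0)) \big[setU/set0]_(i <- iota 0 (2 * 2 ^ m)) bad_cell eta m0 t m i in
  measurable B /\ Pr P B <= 10 * tail_const a * (10 / eta) ^+ 4 / 2 ^+ m0.
Proof.
move=> e0 t0 Mt B.
have level0 m : 0 < level eta m0 m by rewrite mulr_gt0 ?divr_gt0// exprn_gt0// divr_gt0.
have uv m i : i%:R / 2 ^+ m <= i.+1%:R / 2 ^+ m :> R.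
  by rewrite ler_pM2r ?invr_gt0 ?exprn_gt0// ler_nat.
have mc m i : measurable (bad_cell eta m0 t m i).
  by case: (deviation_tail alpha0 a0 stableX epsU indX t0 (uv m i) (level0 m)).
have cU m := Pr_bigU P (iota 0 (2 * 2 ^ m)) (mc m).
have [mB PB] := Pr_bigU P (iota m0 (M.+1 - m0)) (fun m => (cU m).1).
split=> //; apply: (le_trans PB).
pose K := 2 * tail_const a * (10 / eta) ^+ 4 / 2 ^+ m0.
have K0 : 0 <= K.
  apply: mulr_ge0; last by rewrite invr_ge0 exprn_ge0.
  apply: mulr_ge0; first by apply: mulr_ge0 => //; exact: tail_const_ge0.
  by rewrite exprn_ge0// divr_ge0// ltW.
have lev m : (m0 <= m <= M)%N ->
    Pr P (\big[setU/set0]_(i <- iota 0 (2 * 2 ^ m)) bad_cell eta m0 t m i) <= K * (4 / 5) ^+ (m - m0).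
  move=> /andP[m0m mM]; apply: (le_trans (cU m).2).
  have p0 : 0 < 2 ^+ m :> R by rewrite exprn_gt0.
  apply: (@le_trans _ _ (\sum_(i <- iota 0 (2 * 2 ^ m)) (tail_const a * (2 ^+ m)^-1 ^+ 2 / level eta m0 m ^+ 4))).
    apply: ler_sum => i _.
    have [_] := deviation_tail alpha0 a0 stableX epsU indX t0 (uv m i) (level0 m).
    rewrite (_ : i.+1%:R / 2 ^+ m - i%:R / 2 ^+ m = (2 ^+ m)^-1); last by rewrite -natr1; field; rewrite gt_eqF.
    (* Up to level [M] the cells are not shorter than the cut-off [1 / tau]. *)
    rewrite max_l//.
    rewrite lef_pV2 ?posrE ?powR_gt0//; apply: le_trans Mt.
    by rewrite ler_eXn2l// ltr1n.
  rewrite big_const_seq count_predT size_iota iter_addr_0 -(mulr_natl (_ / _)) natrM natrX.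
  rewrite -(subnKC m0m) /level addKn; move: (m - m0)%N => n.
  rewrite [leLHS](_ : _ = K * ((10 / 9) ^+ 4 / 2) ^+ n); last first.
    rewrite (_ : (10 / 9) ^+ 4 / 2 = ((9 / 10) ^+ 4 * 2)^-1); last by field.
    rewrite (_ : ((9 / 10) ^+ 4 * 2)^-1 ^+ n = (((9 / 10) ^+ n) ^+ 4 * 2 ^+ n)^-1); last by rewrite exprVn exprMn -!exprM mulnC.
    rewrite exprD /K.
    have z0 : (9 / 10) ^+ n != 0 :> R by rewrite gt_eqF// exprn_gt0// divr_gt0.
    have q0 : 2 ^+ n != 0 :> R by rewrite gt_eqF// exprn_gt0.
    have r0 : 2 ^+ m0 != 0 :> R by rewrite gt_eqF// exprn_gt0.
    have e1 : eta != 0 by rewrite gt_eqF.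
    move: z0 q0 r0; move: ((9 / 10) ^+ n) (2 ^+ n) (2 ^+ m0) (tail_const a) => z q r tc z0 q0 r0.
    by field; rewrite z0 q0 r0 e1.
  by apply: ler_wpM2l => //; apply: lerXn2r; rewrite ?nnegrE; lra.
apply: (@le_trans _ _ (\sum_(m <- iota m0 (M.+1 - m0)) K * (4 / 5) ^+ (m - m0))).
  rewrite big_seq [leRHS]big_seq; apply: ler_sum => m; rewrite mem_iota => /andP[h1 h2].
  by apply: lev; lia.
rewrite -[iota _ _]/(index_iota m0 M.+1) -mulr_sumr.
have geo n : \sum_(m0 <= m < m0 + n) (4 / 5 : R) ^+ (m - m0) = 5 * (1 - (4 / 5) ^+ n).
  elim: n => [|n IH]; first by rewrite addn0 big_geq// expr0 subrr mulr0.
  rewrite addnS big_nat_recr ?leq_addr//= IH addKn exprS; by field.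
rewrite (_ : 10 * _ * _ / _ = K * 5); last by rewrite /K; ring.
rewrite ler_wpM2l//; case: (leqP m0 M.+1) => mM; last by rewrite big_geq// ltnW.
rewrite -(subnKC mM) geo; have : 0 <= (4 / 5) ^+ (M.+1 - m0) :> R by rewrite exprn_ge0.
lra.
Qed.

(** The exceptional event joins the null set [degenerate], the bad cells, rare once [m0] is large,
    and a deviation on []-1, 0]], which governs the particles at the origin and is rare once [t] is
    large. *)
Lemma good_event (eta del : R) : 0 < eta -> 0 < del -> exists m1, forall m0, (m1 <= m0)%N ->
  \forall t \near +oo, exists B, [/\ measurable B, Pr P B <= del &
    forall w, ~ B w -> {within `[0, 1]%classic, continuous (fun s => hatZ alpha a X eps t s w)} /\
      forall s, 0 <= s <= 1 ->
        `|hatZ alpha a X eps t s w - scaled_count alpha a X eps (dyadic_floor m0 s) t w| <= 5 * eta].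
Proof.
move=> e0 d0; pose C := 10 * tail_const a * (10 / eta) ^+ 4.
have C0 : 0 <= C.
  apply: mulr_ge0; first by apply: mulr_ge0 => //; exact: tail_const_ge0.
  by rewrite exprn_ge0// divr_ge0// ltW.
pose m1 := (Num.truncn (2 * C / del) + 2)%N; exists m1 => m0 mm.
have Cm : C / 2 ^+ m0 <= del / 2.
  rewrite ler_pdivrMr ?exprn_gt0// mulrC -ler_pdivrMr ?divr_gt0//.
  rewrite (_ : C / (del / 2) = 2 * C / del); last by field; rewrite gt_eqF.
  apply: ltW; apply: lt_le_trans (truncnS_gt _) _; rewrite -natrX ler_nat.
  apply: (leq_trans _ (ltnW (ltn_expl m0 (ltnSn 1)))); apply: leq_trans mm.
  by rewrite /m1 addn2.
have m02 : (2 <= m0)%N by apply: leq_trans mm; rewrite /m1 leq_addl.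
pose tau t := t `^ alpha^-1 : R; pose sq t := t `^ (2 * alpha)^-1 : R.
pose C2 := tail_const a * (2 / eta) ^+ 4.
have C20 : 0 <= C2.
  by apply: mulr_ge0; [exact: tail_const_ge0 | rewrite exprn_ge0// divr_ge0// ltW].
near=> t.
have t0 : 0 < t by near: t; exact: nbhs_pinfty_gt.
have s0 : 0 < sq t := powR_gt0 _ t0.
have ta0 : 0 < tau t := powR_gt0 _ t0.
have sqt : sq t ^+ 2 = tau t := sqr_scale alpha0 t.
(* In this order the summands serve [m0 <= M], the probability of [B2], the conditions on [2 / a]
   and on [N0], and the presence of a jump in every grid cell. *)
have big : 2 ^+ m0 + 2 * C2 / del + 2 / (a * eta) + eta * a * 2 ^+ m0 <= sq t.
  by near: t; apply: (cvgryPge _).1; exact: scale_cvgy.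
have [b1 b2 b3 b4] : [/\ 1 <= 2 ^+ m0 :> R, 0 <= 2 * C2 / del, 0 <= 2 / (a * eta) & 0 <= eta * a * 2 ^+ m0].
  split; first by rewrite exprn_ege1// ler1n.
  - by apply: divr_ge0; [exact: mulr_ge0 | exact: ltW].
  - by apply: divr_ge0 => //; apply: mulr_ge0; exact: ltW.
  - by apply: mulr_ge0; [apply: mulr_ge0; exact: ltW | exact: exprn_ge0].
have sq1 : 1 <= sq t by lra.
have sqtau : sq t <= tau t by rewrite -sqt expr2 ler_peMr// ltW.
have tau1 : 1 <= tau t by lra.
have [M [/andP[M1 M2] HM]] := dyadic_scale tau1.
have m0M : (m0 <= M)%N by apply: HM; lra.
have [mB PB] := bad_cells_prob m0 e0 t0 M1; set B1 := \big[_/_]_(_ <- _) _ in mB PB.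
have u0 : - (tau t)^-1 <= 0 by rewrite oppr_le0 invr_ge0 ltW.
have e2 : 0 < eta / 2 by lra.
have [mB2 PB2] := deviation_tail alpha0 a0 stableX epsU indX t0 u0 e2.
set B2 := [set w | _] in mB2 PB2.
have [mdeg Pdeg] := degenerate_null a0 (fun j => measurable_position stableX j (ltW t0)) epsU
  (fun B s mB us => position_indep indX (ltW t0) mB us) (fun j u v => position_law stableX j u v (ltW t0)).
exists (degenerate a (fun j => X j t) eps `|` (B1 `|` B2)); split.
- by apply: measurableU => //; exact: measurableU.
- apply: (le_trans (PrU P mdeg (measurableU _ _ mB mB2))); rewrite Pdeg add0r.
  apply: (le_trans (PrU P mB mB2)).
  suff : Pr P B2 <= del / 2 by move: (le_trans PB Cm); lra.
  apply: (le_trans PB2); rewrite sub0r opprK maxxx.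
  have -> : tail_const a * (tau t)^-1 ^+ 2 / (eta / 2) ^+ 4 = C2 / tau t ^+ 2.
    by rewrite /C2; field; rewrite !gt_eqF.
  rewrite ler_pdivrMr ?exprn_gt0// mulrC -ler_pdivrMr ?divr_gt0//.
  rewrite (_ : C2 / (del / 2) = 2 * C2 / del); last by field; rewrite gt_eqF.
  by apply: (@le_trans _ _ (tau t)); [lra | rewrite expr2 ler_peMr// ltW].
move=> w nB.
have nd : ~ degenerate a (fun j => X j t) eps w by move=> h; apply: nB; left.
have nB1 : ~ B1 w by move=> h; apply: nB; right; left.
have nB2 : ~ B2 w by move=> h; apply: nB; right; right.
split; first exact: hatZ_continuous.
move=> s s01; have /andP[s00 s1] := s01.
pose N0 := countN X eps a t 0 w; pose F := path_count X eps a t w.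
rewrite /hatZ -/(tau t) -/(sq t) -/(jumps X eps a t w) interp_countN//; last by rewrite mulr_ge0// ltW.
rewrite /scaled_count t0 /normalized_count.
apply: (@interp_grid_approximation _ (jumps X eps a t w) F a (tau t) (sq t) N0 eta m0 M) => //.
- exact: jumps_ge0.
- exact: jumps_finite.
- by move=> u v u0' uv _; exact: path_count_mono.
- by move=> u v u0' uv _ H; exact: path_count_jump.
- move=> m i /andP[m0m mM] im.
  have nc : ~ bad_cell eta m0 t m i w.
    move=> h; apply: nB1; rewrite /B1 -bigcup_seq; exists m; first by rewrite /= mem_iota m0m subnKC ?ltnS// leqW.
    by rewrite -bigcup_seq; exists i => //; rewrite /= mem_iota.
  have uv : i%:R / 2 ^+ m * tau t <= i.+1%:R / 2 ^+ m * tau t.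
    by rewrite ler_pM2r// ler_pM2r ?invr_gt0 ?exprn_gt0// ler_nat.
  have i0 : 0 <= i%:R / 2 ^+ m * tau t by rewrite !mulr_ge0 ?invr_ge0 ?exprn_ge0 ?(ltW ta0).
  rewrite -mulrBl normrM normfV (gtr0_norm s0) ler_pdivrMr//.
  have := path_countB nd i0 uv; rewrite -/F => E.
  rewrite (_ : _ - _ = deviation alpha a X eps (i%:R / 2 ^+ m) (i.+1%:R / 2 ^+ m) t w); last first.
    by rewrite /deviation -/(tau t) -E; move: (F _) (F _) => A1 A2; ring.
  by apply: ltW; rewrite ltNge; apply/negP.
- by rewrite ltW.
- rewrite (_ : 2 / a = eta * (2 / (a * eta))); last by field; rewrite !gt_eqF.
  by rewrite ler_pM2l//; lra.
- apply: (@le_lt_trans _ _ (sq t * sq t)); first by rewrite ler_pM2r//; lra.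
  by rewrite -expr2 sqt ltr_pMl// ltr1n.
- have /andP[h1 h2] := countN0_bounds nd; rewrite h1 /=; apply: (le_trans h2).
  have : `|deviation alpha a X eps (- (tau t)^-1) 0 t w| < eta / 2 * sq t by rewrite ltNge; apply/negP.
  rewrite /deviation -/(tau t) mul0r mulNr mulVf ?gt_eqF// sub0r opprK mulVf ?gt_eqF// ltr_norml => /andP[_ h3].
  have h4 : 1 / a <= eta / 2 * sq t.
    rewrite (_ : 1 / a = eta / 2 * (2 / (a * eta))); last by field; rewrite !gt_eqF.
    by rewrite ler_pM2l//; lra.
  move: h3 h4; lra.
Unshelve. all: end_near. Qed.

End GoodEvent.

(** * Bounded continuous functionals *)

Section LipschitzApproximation.
Context {R : realType} (phi : (R -> R) -> R) (M : R).
Hypothesis phiM : forall g, `|phi g| <= M.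

Definition close01 (r : R) (g h : R -> R) : Prop := forall s, 0 <= s <= 1 -> `|g s - h s| <= r.

(* The Lipschitz regularization of [phi]; [g] itself need not be continuous. *)
Definition envelope_values (k : R) (g : R -> R) : set R :=
  [set x | x = M \/ exists (h : R -> R) (r : R), [/\ {within `[0, 1]%classic, continuous h}, 0 <= r, close01 r g h & x = phi h + k * r]].

Definition envelope (k : R) (g : R -> R) : R := inf (envelope_values k g).

Context (k : R) (k0 : 0 <= k).

Let phi_ge g : - M <= phi g. Proof. by have := phiM g; rewrite ler_norml => /andP[]. Qed.
Let M0 : 0 <= M. Proof. exact: le_trans (phiM id). Qed.

Let values_ge g x : envelope_values k g x -> - M <= x.
Proof.
case=> [->|[h [r [_ r0 _ ->]]]]; first by have := M0; lra.
by have := phi_ge h; have := mulr_ge0 k0 r0; lra.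
Qed.

Let has_lb g : has_lbound (envelope_values k g).
Proof. by exists (- M) => x; exact: values_ge. Qed.

Lemma envelope_le g x : envelope_values k g x -> envelope k g <= x.
Proof. by move=> gx; apply: ge_inf. Qed.

Lemma envelope_ge g y : (forall x, envelope_values k g x -> y <= x) -> y <= envelope k g.
Proof. by move=> H; apply: lb_le_inf => //; exists M; left. Qed.

Lemma envelope_bound g : `|envelope k g| <= M.
Proof.
rewrite ler_norml; apply/andP; split; first by apply: envelope_ge => x; exact: values_ge.
by apply: envelope_le; left.
Qed.

Lemma envelope_le_near (g h : R -> R) (r : R) : {within `[0, 1]%classic, continuous h} -> 0 <= r -> close01 r g h ->
  envelope k g <= phi h + k * r.
Proof. by move=> ch r0 gh; apply: envelope_le; right; exists h, r. Qed.

Lemma envelope_lipschitz (g g' : R -> R) (r : R) : 0 <= r -> close01 r g g' -> `|envelope k g - envelope k g'| <= k * r.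
Proof.
have half g1 g2 : 0 <= r -> close01 r g1 g2 -> envelope k g2 - k * r <= envelope k g1.
  move=> r0 gg; apply: envelope_ge => x [->|[h [r' [ch r0' gh ->]]]].
    have : envelope k g2 <= M by apply: envelope_le; left.
    by have := mulr_ge0 k0 r0; lra.
  rewrite lerBlDr -addrA -mulrDr; apply: envelope_le_near => //; first exact: addr_ge0.
  move=> s s01; rewrite -(subrK (g1 s) (g2 s)) -addrA.
  by apply: (le_trans (ler_normD _ _)); rewrite [leRHS]addrC; apply: lerD; [rewrite distrC gg | exact: gh].
move=> r0 gg; have h1 := half _ _ r0 gg.
have gg' : close01 r g' g by move=> s s01; rewrite distrC gg.
have h2 := half _ _ r0 gg'.
by rewrite ler_norml; apply/andP; split; lra.
Qed.

End LipschitzApproximation.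

Section EnvelopeLimit.
Context {R : realType} (phi : (R -> R) -> R) (M : R).
Hypothesis phiM : forall g, `|phi g| <= M.
Hypothesis phi_cont : forall g : R -> R, {within `[0, 1]%classic, continuous g} ->
        forall e, 0 < e -> exists2 del, 0 < del &
          forall h : R -> R, {within `[0, 1]%classic, continuous h} ->
            (forall s, 0 <= s <= 1 -> `|g s - h s| < del) ->
            `|phi g - phi h| < e.

(** Competitors within [del] of [g] have nearly the value [phi g]; for all others the penalty is at
    least [k * del >= 2 * M] and outweighs any gain. *)
Lemma envelope_cvg (g : R -> R) : {within `[0, 1]%classic, continuous g} ->
  (fun k : nat => envelope phi M k%:R g) @ \oo --> phi g.
Proof.
move=> cg; apply/cvgrPdist_le => e e0; have [del d0 H] := phi_cont cg e0.
have M0 : 0 <= M by exact: le_trans (phiM id).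
near=> k.
have k0 : 0 <= k%:R :> R by exact: ler0n.
have kd : 2 * M / del <= k%:R by near: k; exact: nbhs_infty_ger.
have up : envelope phi M k%:R g <= phi g.
  have := @envelope_le_near _ phi M phiM k%:R k0 g g 0 cg (lexx 0); rewrite mulr0 addr0; apply.
  by move=> s _; rewrite subrr normr0.
have phg : phi g <= M by have := phiM g; rewrite ler_norml => /andP[].
have lo : phi g - e <= envelope phi M k%:R g.
  apply: envelope_ge => x [->|[h [r [ch r0 gh ->]]]]; first by lra.
  have [rd|dr] := ltP r del.
    have : `|phi g - phi h| < e by apply: H => // s s01; exact: le_lt_trans (gh s s01) rd.
    by have := mulr_ge0 k0 r0; rewrite ltr_norml => ? /andP[]; lra.
  have : 2 * M <= k%:R * r.
    by apply: (@le_trans _ _ (k%:R * del)); [rewrite -ler_pdivrMr | rewrite ler_wpM2l].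
  have := phiM h; rewrite ler_norml => /andP[]; lra.
by rewrite ler_norml; apply/andP; split; lra.
Unshelve. all: end_near. Qed.

End EnvelopeLimit.

Section StepFunctional.
Context {R : realType} (phi : (R -> R) -> R) (M : R).
Hypothesis phiM : forall g, `|phi g| <= M.

Definition step_path (m : nat) (xs : seq R) (s : R) : R := xs`_(Num.truncn (s * 2 ^+ m)).

(** The clamp puts every index into the unit interval, as the statements quantified over all indices
    require; up to [2 ^ m] it changes nothing. *)
Definition grid (m : nat) (i : nat) : R := Num.min 1 (i%:R / 2 ^+ m).

Lemma grid_itv m i : 0 <= grid m i <= 1.
Proof. by rewrite /grid le_min ler01 ge_min lexx /= divr_ge0// exprn_ge0. Qed.

Lemma step_path_grid m (V : R -> R) s : 0 <= s <= 1 ->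
  step_path m (mkseq (fun i => V (grid m i)) (2 ^ m).+1) s = V (dyadic_floor m s).
Proof.
move=> /andP[s0 s1]; have p0 : 0 < 2 ^+ m :> R by rewrite exprn_gt0.
have jm : (Num.truncn (s * 2 ^+ m) <= 2 ^ m)%N.
  by rewrite -[X in (_ <= X)%N](@natrK R) natrX le_truncn// ler_piMl// ltW.
rewrite /step_path nth_mkseq//; congr V; rewrite /grid min_r//.
by rewrite ler_pdivrMr// mul1r; move: jm; set n := Num.truncn _ => jm; rewrite -natrX ler_nat.
Qed.

Lemma lipschitz_seq_envelope k m : 0 <= k -> lipschitz_seq k (fun xs => envelope phi M k (step_path m xs)).
Proof.
move=> k0 xs ys sxy; apply: envelope_lipschitz => //; first by apply: sumr_ge0.
move=> s _; rewrite /step_path; set j := Num.truncn _.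
have [jx|xj] := ltnP j (size xs).
  by rewrite (bigD1 (Ordinal jx))//= lerDl sumr_ge0.
by rewrite !nth_default -?sxy// subrr normr0 sumr_ge0.
Qed.

Lemma envelope_step_cvg (k : R) (g : R -> R) : 0 <= k -> {within `[0, 1]%classic, continuous g} ->
  (fun m => envelope phi M k (step_path m (mkseq (fun i => g (grid m i)) (2 ^ m).+1))) @ \oo --> envelope phi M k g.
Proof.
move=> k0 cg; apply/cvgrPdist_le => e e0.
have e1 : 0 < e / (k + 1) by rewrite divr_gt0// ltr_wpDl.
have := dyadic_floor_cvg cg e1; apply: filterS => m H.
apply: (le_trans (envelope_lipschitz phiM k0 (ltW e1) _)).
  by move=> s s01; rewrite step_path_grid// distrC ltW// H.
by rewrite mulrCA ler_piMr ?(ltW e0)// ler_pdivrMr ?ltr_wpDl// mul1r lerDl.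
Qed.

End StepFunctional.

(** * Lower bound for the limit and weak convergence *)

Section WeakConvergence.
Context {R : realType} (alpha c a : R) {d : measure_display} {T : measurableType d} (P : probability T R).
Context (X : int -> R -> T -> R) (eps : T -> R).
Context {d' : measure_display} {T' : measurableType d'} (P' : probability T' R) (G : R -> T' -> R).
Hypothesis alpha0 : 0 < alpha.
Hypothesis a0 : 0 < a.
Hypothesis stableX : forall j, sym_stable_process P alpha c (X j).
Hypothesis epsU : uniform01 P eps.
Hypothesis indX : mutually_independent P (fun i : option int =>
    match i with None => preimage_events eps | Some j => process_events (X j) end).
Hypothesis contG : forall w, {within `[0, 1]%classic, continuous (fun s => G s w)}.
Hypothesis gaussG : centered_gaussian_process P' G (cov_fun alpha c a).

(** Five losses of [e / 5]: from [phi] to the envelope with constant [k], from the limit path to its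
    grid values, from the limit law to time [t], from the grid path back to [hatZ], and on the
    exceptional event. The order of choice is [k], then [eta] and [del], then [m], then [t]. *)
Lemma liminf_bound (phi : (R -> R) -> R) : bcont_C01 phi -> forall e, 0 < e ->
  \forall t \near +oo, \int[P']_w phi (fun s => G s w) - e <= \int[P]_w phi (fun s => hatZ alpha a X eps t s w).
Proof.
move=> [[M phiM] _ phic] e e0.
have M0 : 0 <= M by exact: le_trans (phiM id).
have [mG _] := gaussG.
pose gk (k m : nat) (xs : seq R) := envelope phi M k%:R (step_path m xs).
pose VG m w := mkseq (fun i => G (grid m i) w) (2 ^ m).+1.
have gkL k m : lipschitz_seq k%:R (gk k m) by apply: lipschitz_seq_envelope => //; exact: ler0n.
have gkM k m xs : `|gk k m xs| <= M by apply: envelope_bound => //; exact: ler0n.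
have mgk k m : measurable_fun setT (fun w => gk k m (VG m w)).
  have [] // := lipschitz_seq_measurable P' (2 ^ m).+1 (V := fun i => G (grid m i)) _ (ler0n R k) (gkL k m) (gkM k m).
  by move=> i; apply: mG; exact: grid_itv.
have cvm k w : (fun m => gk k m (VG m w)) @ \oo --> envelope phi M k%:R (fun s => G s w).
  exact: (envelope_step_cvg phiM (ler0n R k) (@contG w)).
have mek (k : nat) : measurable_fun setT (fun w => envelope phi M k%:R (fun s => G s w)).
  by apply: (measurable_fun_cvg (h := fun m w => gk k m (VG m w))) => // w _; exact: cvm.
have cvk w : (fun k : nat => envelope phi M k%:R (fun s => G s w)) @ \oo --> phi (fun s => G s w).
  by apply: envelope_cvg.
(* Measurability is derived rather than assumed: along continuous paths [phi] is a limit of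
   envelopes, which in turn are limits of Lipschitz functions of finitely many coordinates. *)
have mphi : measurable_fun setT (fun w => phi (fun s => G s w)).
  by apply: (measurable_fun_cvg (h := fun (k : nat) w => envelope phi M k%:R (fun s => G s w))) => // w _; exact: cvk.
have P0 : Pr P' set0 = 0 by rewrite /Pr measure0.
have e5 : 0 < e / 5 by rewrite divr_gt0.
have I1 : \int[P']_w envelope phi M k%:R (fun s => G s w) @[k --> \oo] --> \int[P']_w phi (fun s => G s w).
  apply: (@ER_cvg _ _ _ P' _ _ M set0 measurable0 P0) => // k w; exact: envelope_bound (ler0n R k) _.
have [k Hk] : exists k : nat, \int[P']_w phi (fun s => G s w) - e / 5 <= \int[P']_w envelope phi M k%:R (fun s => G s w).
  have /cvgrPdist_le/(_ _ e5)[k _ Hk] := I1; exists k; have := Hk k (leqnn k).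
  by rewrite /= ler_norml => /andP[_]; lra.
have I2 : \int[P']_w gk k m (VG m w) @[m --> \oo] --> \int[P']_w envelope phi M k%:R (fun s => G s w).
  by apply: (@ER_cvg _ _ _ P' _ _ M set0 measurable0 P0) => // m w _; exact: cvm.
pose eta := e / (25 * (k%:R + 1)); pose del := e / (10 * (M + 1)).
have k1 : 0 < k%:R + 1 :> R by rewrite ltr_wpDl.
have M1 : 0 < M + 1 by rewrite ltr_wpDl.
have eta0 : 0 < eta by rewrite divr_gt0// mulr_gt0.
have del0 : 0 < del by rewrite divr_gt0// mulr_gt0.
have [m1 Hm1] := good_event alpha0 a0 stableX epsU indX eta0 del0.
have [m [mm1 Hm]] : exists m, (m1 <= m)%N /\ \int[P']_w envelope phi M k%:R (fun s => G s w) - e / 5 <= \int[P']_w gk k m (VG m w).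
  have /cvgrPdist_le/(_ _ e5)[m _ Hm] := I2; exists (maxn m m1); split; first exact: leq_maxr.
  have := Hm (maxn m m1) (leq_maxl _ _); by rewrite /= ler_norml => /andP[_]; lra.
pose VZ t w := mkseq (fun i => scaled_count alpha a X eps (grid m i) t w) (2 ^ m).+1.
have I3 : \int[P]_w gk k m (VZ t w) @[t --> +oo] --> \int[P']_w gk k m (VG m w).
  by apply: (lipschitz_functional_cvg alpha0 a0 stableX epsU indX gaussG (grid_itv m) (ler0n R k) (gkL k m) (gkM k m)).
have mVZ t : bmeas (fun w => gk k m (VZ t w)).
  apply: (lipschitz_seq_measurable P (2 ^ m).+1 (V := fun i => scaled_count alpha a X eps (grid m i) t) _ (ler0n R k) (gkL k m) (gkM k m)).
  by move=> i; exact: (measurable_scaled_count a0 stableX epsU indX).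
have near3 : \forall t \near +oo, \int[P']_w gk k m (VG m w) - e / 5 <= \int[P]_w gk k m (VZ t w).
  have /cvgrPdist_le/(_ _ e5) := I3; apply: filterS => t; by rewrite ler_norml => /andP[_]; lra.
near=> t.
have [B [mB PB HB]] : exists B, [/\ measurable B, Pr P B <= del &
    forall w, ~ B w -> {within `[0, 1]%classic, continuous (fun s => hatZ alpha a X eps t s w)} /\
      forall s, 0 <= s <= 1 ->
        `|hatZ alpha a X eps t s w - scaled_count alpha a X eps (dyadic_floor m s) t w| <= 5 * eta].
  by near: t; exact: Hm1.
have H3 : \int[P']_w gk k m (VG m w) - e / 5 <= \int[P]_w gk k m (VZ t w) by near: t.
have bB : bmeas (fun w => 2 * M * \1_B w : R) by apply: bmeasZ; exact: bmeas_indic.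
(* A measurable minorant of [phi] at [hatZ]: off [B] by the definition of the envelope with distance
   [5 * eta], and on [B] because it is at most [- M]. *)
pose low w := gk k m (VZ t w) - k%:R * (5 * eta) - 2 * M * \1_B w.
have bc : bmeas (fun w : T => k%:R * (5 * eta)) by exact: bmeas_cst.
have bd : bmeas (fun w => gk k m (VZ t w) - k%:R * (5 * eta)) by exact: bmeasB.
have blow : bmeas low by exact: bmeasB.
have low_le w : low w <= phi (fun s => hatZ alpha a X eps t s w).
  have ke0 : 0 <= k%:R * (5 * eta) by rewrite mulr_ge0// mulr_ge0// ltW.
  rewrite /low indicE; have [wB|wB] := pselect (B w).
    rewrite mem_set// mulr1; have := gkM k m (VZ t w); have := phiM (fun s => hatZ alpha a X eps t s w).
    by rewrite !ler_norml => /andP[? ?] /andP[? ?]; lra.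
  rewrite memNset// mulr0 subr0 lerBlDr; have [cZ aZ] := HB w wB.
  apply: envelope_le_near => //; first by rewrite mulr_ge0// ltW.
  by move=> s s01; rewrite (step_path_grid m (fun x => scaled_count alpha a X eps x t w))// distrC aZ.
have bphi : exists M' : R, forall w, `|phi (fun s => hatZ alpha a X eps t s w)| <= M' by exists M.
have := ER_le_nonmeas P blow bphi low_le.
have -> : \int[P]_w low w = \int[P]_w gk k m (VZ t w) - k%:R * (5 * eta) - 2 * M * Pr P B.
  by rewrite /low ERB// ERB// ER_cst ERZ ?ER_indic//; exact: bmeas_indic.
have c1 : k%:R * (5 * eta) <= e / 5.
  rewrite /eta [leLHS](_ : _ = (k%:R / (k%:R + 1)) * (e / 5)); last by field; rewrite gt_eqF.
  by rewrite ler_piMl ?(ltW e5)// ler_pdivrMr// mul1r lerDl.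
have c2 : 2 * M * Pr P B <= e / 5.
  apply: (@le_trans _ _ (2 * M * del)); first by rewrite ler_wpM2l// mulr_ge0.
  rewrite /del [leLHS](_ : _ = (M / (M + 1)) * (e / 5)); last by field; rewrite gt_eqF.
  by rewrite ler_piMl ?(ltW e5)// ler_pdivrMr// mul1r lerDl.
move: Hk Hm H3 c1 c2; lra.
Unshelve. all: end_near. Qed.

Lemma weak_cvg (phi : (R -> R) -> R) : bcont_C01 phi ->
  \int[P]_w phi (fun s => hatZ alpha a X eps t s w) @[t --> +oo] --> \int[P']_w phi (fun s => G s w).
Proof.
move=> bphi; have [[M phiM] phir phic] := bphi.
have bphiN : bcont_C01 (fun g => - phi g).
  split; first by exists M => g; rewrite normrN.
    by move=> g h gh; rewrite (phir g h gh).
  move=> g cg e e0; have [del d0 H] := phic g cg e e0; exists del => // h ch gh.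
  by rewrite -opprD normrN H.
apply/cvgrPdist_le => e e0.
have lo := liminf_bound bphi e0; have hi := liminf_bound bphiN e0.
near=> t.
have h1 : \int[P']_w phi (fun s => G s w) - e <= \int[P]_w phi (fun s => hatZ alpha a X eps t s w) by near: t.
have : \int[P']_w (- phi (fun s => G s w)) - e <= \int[P]_w (- phi (fun s => hatZ alpha a X eps t s w)) by near: t.
rewrite !ERN_nonmeas; [|by exists M|by exists M] => h2.
by rewrite ler_norml; apply/andP; split; lra.
Unshelve. all: end_near. Qed.

End WeakConvergence.
Theorem theorem3p3 (R : realType) (alpha c a : R)
  (d : measure_display) (T : measurableType d) (P : probability T R)
  (X : int -> R -> T -> R) (eps : T -> R)
  (d' : measure_display) (T' : measurableType d') (P' : probability T' R)
  (G : R -> T' -> R) :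
  0 < alpha <= 2 -> 0 < c -> 0 < a ->
  (forall j, sym_stable_process P alpha c (X j)) ->
  uniform01 P eps ->
  mutually_independent P (fun i : option int =>
    match i with None => preimage_events eps | Some j => process_events (X j) end) ->
  (forall w, {within `[0, 1]%classic, continuous (fun s => G s w)}) ->
  centered_gaussian_process P' G (cov_fun alpha c a) ->
  forall phi : (R -> R) -> R, bcont_C01 phi ->
    \int[P]_w phi (fun s => hatZ alpha a X eps t s w) @[t --> +oo]
      --> \int[P']_w phi (fun s => G s w).
Proof.
move=> /andP[alpha0 _] _ a0 stableX epsU indX contG gaussG phi bphi.
exact: (weak_cvg alpha0 a0 stableX epsU indX contG gaussG bphi).
Qed.
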